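(* Let $\beta>\beta_c$ and let $(v_L)$ be a sequence of positive numbers that make $m^\star|\Lambda_L|-2m^\star v_L$ an allowed value of $M_L=\sum_{x\in\Lambda_L}\sigma_x$ for all $L$. Suppose that the limit $\lim_{L\to\infty}v_L^{3/2}/|\Lambda_L|$ exists and lies in $(0,\infty)$. For $\varkappa,s>0$ let $$\mathcal A^{\rm c}_{\varkappa,s,L}=\bigl\{\sigma:\text{ there exists an external contour }\gamma\text{ of }\sigma\text{ in }\Lambda_L\text{ with }s\le\operatorname{diam}\gamma\le\varkappa\sqrt{v_L}\bigr\}.$$ Then for each $c_0>0$ there exist $\varkappa>0$, $K_0<\infty$ and $L_0<\infty$ such that if $K\ge K_0$, $L\ge L_0$ and $s=K\log L$, then $$P_L^{+,\beta}\bigl(\mathcal A^{\rm c}_{\varkappa,s,L}\,\big|\,M_L=m^\star|\Lambda_L|-2m^\star v_L\bigr)\le L^{-c_0}.$$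
   Context: Ising model on $\mathbb Z^2$: for finite $\Lambda\subset\mathbb Z^2$ let $\partial\Lambda$ be the set of sites outside $\Lambda$ having a nearest neighbor in $\Lambda$. With spins $\sigma_x\in\{-1,+1\}$ let $\mathscr H_\Lambda(\sigma)=-\sum_{\langle x,y\rangle:\{x,y\}\cap\Lambda\ne\emptyset}\sigma_x\sigma_y$ (nearest-neighbor pairs), where $\sigma_x=+1$ for $x\in\partial\Lambda$ (plus boundary condition). $P_\Lambda^{+,\beta}$ has weights proportional to $e^{-\beta\mathscr H_\Lambda(\sigma)}$. $\Lambda_L$ is a square of $L\times L$ sites and $P_L^{+,\beta}=P_{\Lambda_L}^{+,\beta}$. ''Allowed value'' means a value that the random variable can attain. $\beta_c$ is the critical inverse temperature, $e^{2\beta_c}=1+\sqrt2$; $m^\star=m^\star(\beta)=\langle\sigma_0\rangle^{+,\beta}$, the expectation of $\sigma_0$ in the infinite-volume (weak) limit of $P_L^{+,\beta}$. Contours: for a configuration in $\Lambda$ with plus boundary condition, take all dual-lattice bonds (bonds of $(\mathbb Z^2)^*=(\mathbb Z+\frac12)^2$) crossing direct bonds that join a plus spin to a minus spin. When two such bonds meet at a dual site they are connected; when four meet, the crossing is resolved by the south-east/north-west rounding rule (the south and east bonds are joined, and the north and west bonds are joined). This decomposes the bonds into non-self-intersecting closed polygons with rounded corners, the contours. $V(\gamma)\subset\mathbb R^2$ is the bounded set enclosed by $\gamma$, and $\operatorname{diam}\gamma$ is the Euclidean diameter of $V(\gamma)$. A contour is external if it is not surrounded by any other contour of the configuration. *)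

(* Defs.v *)
From HB Require Import structures.
From Stdlib Require Import Relations.
From mathcomp Require Import all_boot all_order all_algebra finmap.
From mathcomp Require Import all_classical all_reals all_analysis.

Set Implicit Arguments.
Unset Strict Implicit.
Unset Printing Implicit Defensive.

Import Order.TTheory GRing.Theory Num.Theory.
Import numFieldNormedType.Exports.

Local Open Scope classical_set_scope.
Local Open Scope ring_scope.

Notation site := (int * int)%type.

(** The bond [(x, true)] joins [x] to its right neighbour, [(x, false)] joins
    [x] to its upper neighbour; each unordered nearest-neighbour pair is thus
    represented exactly once. *)
Notation bond := (site * bool)%type.

Definition bond_fst (b : bond) : site := b.1.
Definition bond_snd (b : bond) : site :=
  if b.2 then (b.1.1 + 1, b.1.2) else (b.1.1, b.1.2 + 1).

(** Configurations on the whole lattice, [true] standing for the spin [+1],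
    with the product topology and its Borel sigma-algebra. *)
Definition spins := prod_topology (fun _ : site => bool).
HB.instance Definition _ := Topological.on spins.
HB.instance Definition _ := isPointed.Build spins (fun=> true).
Definition spinsB := g_sigma_algebraType (@open spins).
HB.instance Definition _ := Measurable.on spinsB.

Section gibbs.
Variable R : realType.
Implicit Types (beta : R) (Lam : {fset site}).

Definition spin (b : bool) : R := if b then 1 else -1.

(** Plus boundary condition.  The Hamiltonian only involves sites of [Lam] and
    of its outer boundary, so it is harmless to put [+1] on every other site. *)
Definition plus_ext Lam (sigma : {ffun Lam -> bool}) : spins :=
  fun x => if insub x is Some y then sigma y else true.

Definition hamiltonian Lam (sigma : {ffun Lam -> bool}) : R :=
  - \sum_(b \in [set b | (bond_fst b \in Lam) || (bond_snd b \in Lam)])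
      spin (plus_ext sigma (bond_fst b)) * spin (plus_ext sigma (bond_snd b)).

Definition weight beta Lam (sigma : {ffun Lam -> bool}) : R :=
  expR (- beta * hamiltonian sigma).

Definition partition_function beta Lam : R :=
  \sum_(sigma : {ffun Lam -> bool}) weight beta sigma.

Definition gibbs_mean beta Lam (f : {ffun Lam -> bool} -> R) : R :=
  (\sum_sigma f sigma * weight beta sigma) / partition_function beta Lam.

Definition gibbs beta Lam (A : set {ffun Lam -> bool}) : R :=
  (\sum_(sigma | sigma \in A) weight beta sigma) / partition_function beta Lam.

Definition gibbs_cond beta Lam (A B : set {ffun Lam -> bool}) : R :=
  gibbs beta (A `&` B) / gibbs beta B.

Definition magnetization Lam (sigma : {ffun Lam -> bool}) : R :=
  \sum_(x : Lam) spin (sigma x).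

(** The [L] by [L] square, placed so as to exhaust the lattice as [L] grows. *)
Definition box (L : nat) : {fset site} :=
  [fset ((i%:Z - (L./2)%:Z, j%:Z - (L./2)%:Z) : site)
    | i in iota 0 L, j in iota 0 L]%fset.

Definition beta_c : R := ln (1 + Num.sqrt 2) / 2.

(** Weak convergence of the laws of the configurations [plus_ext sigma], with
    [sigma] sampled in [box L], to [mu]; [spins] is compact, so every
    continuous function is bounded. *)
Definition plus_state beta (mu : probability spinsB R) : Prop :=
  forall f : spins -> R, continuous f ->
    (gibbs_mean beta (fun sigma : {ffun box L -> bool} => f (plus_ext sigma)))%:E
      @[L --> \oo] --> 'E_mu[f]%E.

Definition m_star (mu : probability spinsB R) : R :=
  fine 'E_mu[fun omega : spinsB => spin (omega (0, 0)%R)]%E.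

End gibbs.

(** ** Contours

    The dual site [(a + 1/2, b + 1/2)] is represented by [(a, b)], and a dual
    bond by the direct bond that it crosses. *)

Inductive compass := North | East | South | West.

(** The dual bond leaving the dual site [p] in direction [i]. *)
Definition dual_bond (p : site) (i : compass) : bond :=
  match i with
  | North => ((p.1, p.2 + 1), true)
  | South => (p, true)
  | East => ((p.1 + 1, p.2), false)
  | West => (p, false)
  end.

Definition disagreement (omega : spins) : set bond :=
  [set b | omega (bond_fst b) <> omega (bond_snd b)].

Definition rounded_pair (i j : compass) : Prop :=
  match i, j with
  | South, East | East, South | North, West | West, North => True
  | _, _ => False
  end.

(** Whether, in a set [B] of dual bonds, the bonds leaving [p] in the directions
    [i] and [j] are joined at [p].  For [B] a set of disagreement bonds, or a
    contour, there are 0, 2 or 4 bonds of [B] at [p]. *)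
Definition joined (B : set bond) (p : site) (i j : compass) : Prop :=
  [/\ i <> j, B (dual_bond p i), B (dual_bond p j) &
      (forall k, B (dual_bond p k)) -> rounded_pair i j].

Definition joined_bonds (B : set bond) (b b' : bond) : Prop :=
  exists p i j, [/\ joined B p i j, b = dual_bond p i & b' = dual_bond p j].

(** A contour is identified with the set of its dual bonds. *)
Definition is_contour (omega : spins) (gamma : set bond) : Prop :=
  exists2 b, disagreement omega b &
    gamma = [set b' | clos_refl_trans bond (joined_bonds (disagreement omega)) b b'].

Section geometry.
Variable R : realType.

Definition direction (i : compass) : R * R :=
  match i with
  | North => (0, 1)
  | East => (1, 0)
  | South => (0, -1)
  | West => (-1, 0)
  end.

Definition dual_point (p : site) : R * R :=
  (p.1%:~R + 2^-1, p.2%:~R + 2^-1).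

(** The curve followed by a contour around [p], between the midpoints of two
    joined dual bonds: the quadratic Bezier curve with control point [p].  It is
    a segment if the bonds are opposite, and otherwise a parabolic arc tangent
    to both bonds, which rounds the corner. *)
Definition arc (p : site) (i j : compass) : set (R * R) :=
  [set dual_point p + ((1 - t) ^+ 2 / 2) *: direction i
                    + (t ^+ 2 / 2) *: direction j | t in `[0, 1]].

(** The rounded closed curve in the plane drawn by the contour [gamma].  At a
    dual site where [gamma] has only two of four disagreement bonds, these two
    are already a rounded pair, so [gamma] alone determines the curve. *)
Definition curve (gamma : set bond) : set (R * R) :=
  [set z | exists p i j, joined gamma p i j /\ arc p i j z].

(** The bounded set [V(gamma)] enclosed by [gamma]. *)
Definition enclosed (gamma : set bond) : set (R * R) :=
  [set z | ~ curve gamma z /\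
           bounded_set (connected_component (~` curve gamma) z)].

Definition euclidean_dist (z w : R * R) : R :=
  Num.sqrt ((z.1 - w.1) ^+ 2 + (z.2 - w.2) ^+ 2).

Definition diam (gamma : set bond) : R :=
  sup [set d | exists z w,
    [/\ enclosed gamma z, enclosed gamma w & d = euclidean_dist z w]].

Definition surrounded (gamma gamma' : set bond) : Prop :=
  curve gamma `<=` enclosed gamma'.

Definition external_contour (omega : spins) (gamma : set bond) : Prop :=
  is_contour omega gamma /\
  forall gamma', is_contour omega gamma' -> gamma' <> gamma ->
    ~ surrounded gamma gamma'.

(** The event that some external contour is of intermediate size; [vL] is the
    value of [v] at [L]. *)
Definition intermediate (kappa s vL : R) (L : nat) : set {ffun box L -> bool} :=
  [set sigma | exists2 gamma, external_contour (plus_ext sigma) gamma &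
     s <= diam gamma <= kappa * Num.sqrt vL].

End geometry.

(* Main.v *)
(** A configuration is encoded by the finite set [A] of its minus sites, of weight
    [t ^+ dis], where [dis] counts the disagreement bonds and [t = expR (- 2 beta)];
    [beta > beta_c] means [t * (1 + sqrt 2) < 1].

    Exponential decay.  A fermionic observable on the dual lattice obeys a local linear
    relation whose transfer from one column to the next is bounded by
    [rho = t * (1 + sqrt 2)]; hence the partition function with a Dobrushin interface
    across a rectangle of width [n] is at most [C * rho ^+ n] times the plus one.  The
    probability that a minus cluster crosses the rectangle is bounded by this ratio
    (explore a plus cluster, flip it, and use that a uniform boundary condition maximizes
    the partition function), and the FKG inequality transfers the bound to all volumes.  Clusters are taken for the triangular adjacency [tadj] induced
    by the rounding rule.

    Conditioning on the magnetization.  Given all spins but those at sites with even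
    coordinates away from a box [B], the latter are independent, and those with the same
    neighbourhood form a binomial number of minus spins.  With [a] of order [v], the
    conditioning thus multiplies the probability of an event inside [B] by at most
    [expR (C * a * #|B| / L ^+ 2)], up to a probability [expR (- c * a ^+ 2 / L ^+ 2)];
    the same comparison and a second moment bound show that the conditioning event has
    probability at least [expR (- C * sqrt v)].  For a cluster of extent [n] one takes
    [B] of side [2 n + 1]: as [L ^+ 2] is of order [v `^ (3 / 2)], the correction is
    [expR (C * n ^+ 2 / sqrt v)], which is absorbed by [rho ^+ n] when
    [n <= kappa * sqrt v] with [kappa] small.

    Geometry.  The contour through the leftmost bond of a cluster encloses this cluster
    (parity of crossings), as well as every other contour that follows minus sites of the
    cluster; so an external contour is the outer boundary of a cluster, and its
    diameter is comparable to the extent of this cluster. *)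

From Stdlib Require Import Relations.
From mathcomp Require Import all_boot all_order all_algebra finmap zify ring lra.
From mathcomp Require Import all_classical all_reals all_analysis.
Require Import Defs.

Set Implicit Arguments.
Unset Strict Implicit.
Unset Printing Implicit Defensive.

Import Order.TTheory GRing.Theory Num.Theory.
Import numFieldNormedType.Exports.

Local Open Scope classical_set_scope.
Local Open Scope fset_scope.
Local Open Scope ring_scope.

(** * Sums over the subsets of a finite set *)

(** Decay is needed at every beta above [beta_c], where Peierls counting fails. The fermionic bound
    is sharp: its local matrix has norm 1 + sqrt 2, so [rho < 1] says exactly that beta exceeds
    [beta_c]. The main obstacle is that the conditioning event has probability of order exp (- C
    sqrt v), far below the bound L ^ (- c0) sought, so that an unconditioned estimate cannot just be
    divided by it. Resampling avoids the division: the spins of a box [B] shift the total by at most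
    #|B|, and each unit of shift changes a binomial weight by a factor exp (C a / L^2) only. Two
    facts dictate a of order v: the imposed number of minus spins is at distance of order v from its
    mean, and the discarded Gaussian probability exp (- c a^2 / L^2) must still be small after
    division by exp (- C sqrt v). Clusters replace contours because the event that a set contains a
    large cluster is increasing in this set, as FKG requires. Restricting to the clusters included
    in [B] makes it comparable with the plus state on [B], whatever happens outside. *)

Section PowersetSums.
Variables (K : choiceType) (R : realFieldType).
Implicit Types (D A B C : {fset K}) (F G w f g : {fset K} -> R).

Definition psum D F : R := \sum_(A <- fpowerset D) F A.

Lemma eq_psum D F G : (forall A, A `<=` D -> F A = G A) -> psum D F = psum D G.
Proof.
move=> FG; rewrite /psum [LHS]big_seq [RHS]big_seq; apply: eq_bigr => A.
by rewrite fpowersetE; exact: FG.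
Qed.

Lemma ler_psum D F G : (forall A, A `<=` D -> F A <= G A) -> psum D F <= psum D G.
Proof.
move=> FG; rewrite /psum [leLHS]big_seq [leRHS]big_seq; apply: ler_sum => A.
by rewrite fpowersetE; exact: FG.
Qed.

Lemma psum_ge0 D F : (forall A, A `<=` D -> 0 <= F A) -> 0 <= psum D F.
Proof.
move=> F0; rewrite /psum big_seq; apply: sumr_ge0 => A.
by rewrite fpowersetE; exact: F0.
Qed.

Lemma psumZ D (c : R) F : psum D (fun A => c * F A) = c * psum D F.
Proof. by rewrite /psum mulr_sumr. Qed.

Lemma psumZr D (c : R) F : psum D (fun A => F A * c) = psum D F * c.
Proof. by rewrite /psum mulr_suml. Qed.

Lemma psumD D F G : psum D (fun A => F A + G A) = psum D F + psum D G.
Proof. by rewrite /psum big_split. Qed.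

Lemma psum_sum (I : Type) (r : seq I) D (F : I -> {fset K} -> R) :
  psum D (fun A => \sum_(i <- r) F i A) = \sum_(i <- r) psum D (F i).
Proof. by rewrite /psum exchange_big. Qed.

Lemma psum_pick D A F : A `<=` D -> psum D (fun B => (B == A)%:R * F B) = F A.
Proof.
move=> AD; rewrite /psum (bigD1_seq A) ?fset_uniq ?fpowersetE //=.
rewrite eqxx mul1r big1 ?addr0 // => B /negPf ->; exact: mul0r.
Qed.

Lemma psum_gt0 D F : (forall A, A `<=` D -> 0 < F A) -> 0 < psum D F.
Proof.
move=> F0; apply: lt_le_trans (F0 fset0 (fsub0set _)) _.
rewrite -{1}(psum_pick F (fsub0set D)); apply: ler_psum => A AD.
by case: eqP => _; rewrite ?mul1r ?mul0r // ltW ?F0.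
Qed.

Lemma psum_fset0 F : psum fset0 F = F fset0.
Proof. by rewrite /psum fpowerset0 big_seq_fset1. Qed.

Lemma psum_subset D B F : B `<=` D ->
  psum B F = psum D (fun A => (A `<=` B)%:R * F A).
Proof.
move=> BD; rewrite /psum.
under [RHS]eq_bigr do rewrite mulr_natl mulrb.
rewrite -big_mkcond -big_filter; apply: perm_big; apply: uniq_perm.
- exact: fset_uniq.
- by rewrite filter_uniq ?fset_uniq.
move=> A; rewrite mem_filter !fpowersetE; case AB: (A `<=` B) => //=.
by rewrite (fsubset_trans AB BD).
Qed.

End PowersetSums.

Lemma psum_exchange (K K' : choiceType) (R : realFieldType) (D : {fset K})
    (D' : {fset K'}) (F : {fset K} -> {fset K'} -> R) :
  psum D (fun A => psum D' (F A)) = psum D' (fun B => psum D (F^~ B)).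
Proof. by rewrite /psum exchange_big. Qed.

Section Reindexing.
Variables (K K' : choiceType) (R : realFieldType).

Lemma psum_part (D : {fset K}) (D' : {fset K'}) (u : {fset K} -> {fset K'})
    (F : {fset K} -> R) :
  (forall A, A `<=` D -> u A `<=` D') ->
  psum D F = psum D' (fun B => psum D (fun A => (u A == B)%:R * F A)).
Proof.
move=> uD; rewrite psum_exchange; apply: eq_psum => A AD.
rewrite -[LHS](@psum_pick _ _ D' (u A) (fun=> F A)) ?uD //.
by apply: eq_psum => B _; rewrite eq_sym.
Qed.

Lemma psum_reindex (D : {fset K}) (D' : {fset K'}) (h : {fset K} -> {fset K'})
    (h' : {fset K'} -> {fset K}) (P : pred {fset K'}) (G : {fset K'} -> R) :
  (forall A, A `<=` D -> [/\ h A `<=` D', P (h A) & h' (h A) = A]) ->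
  (forall B, B `<=` D' -> P B -> h' B `<=` D /\ h (h' B) = B) ->
  psum D' (fun B => (P B)%:R * G B) = psum D (fun A => G (h A)).
Proof.
move=> hP h'P; rewrite /psum.
under eq_bigr do rewrite mulr_natl mulrb.
rewrite -big_mkcond -big_filter -(big_map h predT G); apply: perm_big.
apply: uniq_perm; first by rewrite filter_uniq ?fset_uniq.
  rewrite map_inj_in_uniq ?fset_uniq // => A B.
  rewrite !fpowersetE => /hP[_ _ {2}<-] /hP[_ _ {2}<-] -> //.
move=> B; rewrite mem_filter; apply/andP/mapP => [[PB]|[A]].
  by rewrite fpowersetE => /h'P /(_ PB)[h'D hB]; exists (h' B); rewrite ?fpowersetE.
by rewrite !fpowersetE => /hP[? ? ?] ->.
Qed.

Lemma psum_inj_le (D : {fset K}) (D' : {fset K'}) (h : {fset K} -> {fset K'})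
    (h' : {fset K'} -> {fset K}) (P : pred {fset K}) F (G : {fset K'} -> R) :
  (forall B, B `<=` D' -> 0 <= G B) ->
  (forall A, A `<=` D -> P A -> [/\ h A `<=` D', h' (h A) = A & F A <= G (h A)]) ->
  psum D (fun A => (P A)%:R * F A) <= psum D' G.
Proof.
move=> G0 hP.
apply: (@le_trans _ _ (psum D (fun A => psum D' (fun B => ((h A == B) && P A)%:R * G B)))).
  apply: ler_psum => A AD; case PA: (P A); last first.
    rewrite mul0r psum_ge0 // => B /G0 GB; by rewrite andbF mul0r.
  have [hD _ FG] := hP _ AD PA; rewrite mul1r -[leRHS]/(psum _ _); apply: le_trans FG _.
  rewrite -{1}(psum_pick G hD); apply: ler_psum => B _.
  by rewrite eq_sym andbT.
rewrite psum_exchange; apply: ler_psum => B BD; rewrite psumZr -[leRHS]mul1r.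
rewrite ler_wpM2r ?G0 //.
apply: (@le_trans _ _ (psum D (fun A => (A == h' B)%:R * 1))).
  apply: ler_psum => A AD; rewrite mulr1 ler_nat.
  by case: eqP => //= hAB; case PA: (P A) => //=; have [_ + _] := hP _ AD PA; rewrite hAB => ->; rewrite eqxx.
have [hD|hD] := boolP (h' B `<=` D); first by rewrite psum_pick.
rewrite /psum big1_seq ?ler01 // => A /=; rewrite fpowersetE => AD.
by case: eqP => E; rewrite ?mul0r //; rewrite -E AD in hD.
Qed.

End Reindexing.

(** * Disjoint unions and the FKG inequality *)

Section PowersetUnion.
Variables (K : choiceType) (R : realFieldType).
Implicit Types (D A B C : {fset K}) (F G w f g : {fset K} -> R).

Lemma psumU D D' F : [disjoint D & D']%fset ->
  psum (D `|` D') F = psum D (fun A => psum D' (fun B => F (A `|` B))).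
Proof.
move=> dis; rewrite (@psum_part _ _ _ _ D (fun A => A `&` D)); last first.
  by move=> A _; exact: fsubsetIr.
apply: eq_psum => A AD.
apply: (@psum_reindex _ _ _ _ _ (fun B => A `|` B) (fun B => B `&` D')).
- move=> B BD; split.
  + by rewrite fsetUSS.
  + rewrite fsetIUl (fsetIidPl AD); apply/eqP/fsetP => x; rewrite !inE.
    case: (x \in A) => //=; case xB: (x \in B) => //=.
    by apply/negbTE; move/fdisjointP_sym: dis; apply; exact: (fsubsetP BD).
  + rewrite fsetIUl (fsetIidPl BD); apply/fsetP => x; rewrite !inE.
    case xA: (x \in A) => //=; case: (x \in B); rewrite ?orbT ?orbF //.
    by apply/negbTE; move/fdisjointP: dis; apply; exact: (fsubsetP AD).
- move=> B BD /eqP AB; split; first exact: fsubsetIr.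
  by rewrite -AB -fsetIUr; apply/fsetIidPl.
Qed.

Lemma psumU1 x D F : x \notin D ->
  psum (x |` D) F = psum D F + psum D (fun A => F (x |` A)).
Proof.
move=> xD; rewrite psumU; last first.
  by apply/fdisjointP => y; rewrite inE => /eqP ->.
rewrite {1}/psum fpowerset1 big_fsetU1 /=; last first.
  by rewrite inE eq_sym -cardfs_eq0 cardfs1.
by rewrite big_seq_fset1; congr (_ + _); apply: eq_psum => A _; rewrite fset0U.
Qed.

Lemma fset_ind1 (P : {fset K} -> Prop) : P fset0 ->
  (forall x D, x \notin D -> P D -> P (x |` D)) -> forall D, P D.
Proof.
move=> P0 PS D; move: {2}#|`D| (erefl #|`D|) => n.
elim: n D => [|n IH] D; first by move/eqP; rewrite cardfs_eq0 => /eqP ->.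
case: (fset_0Vmem D) => [->//|[x xD]] cD.
have xN : x \notin D `\ x by rewrite !inE eqxx.
rewrite -(fsetD1K xD); apply: PS => //; apply: IH.
by move: cD; rewrite (cardfsD1 x) xD => -[].
Qed.

(** Induction on the ground set. Splitting on whether [x] belongs to the set, the covariance is an
    average of the two conditional covariances plus the covariance of the conditional means, and
    each term is nonnegative. *)
Lemma fkg D w f g :
  (forall A, A `<=` D -> 0 < w A) ->
  (forall A B, A `<=` D -> B `<=` D -> w A * w B <= w (A `|` B) * w (A `&` B)) ->
  (forall A B, A `<=` B -> B `<=` D -> f A <= f B) ->
  (forall A B, A `<=` B -> B `<=` D -> g A <= g B) ->
  psum D (fun A => f A * w A) * psum D (fun A => g A * w A) <=
  psum D (fun A => f A * g A * w A) * psum D w.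
Proof.
elim/fset_ind1: D w f g => [|x D xD IH] w f g w0 ww fm gm.
  by rewrite !psum_fset0 le_eqVlt; apply/orP; left; apply/eqP; ring.
have sD A : A `<=` D -> A `<=` x |` D.
  by move=> AD; apply: fsubset_trans AD (fsubsetU1 _ _).
have sxD A : A `<=` D -> x |` A `<=` x |` D by move=> AD; exact: fsetUS.
have xA A : A `<=` D -> x \notin A by move=> AD; apply: contra xD; exact: fsubsetP.
rewrite !psumU1 //.
have wI A : A `<=` D -> 0 < w (x |` A) by move=> AD; exact/w0/sxD.
have w0' A : A `<=` D -> 0 < w A by move=> AD; exact/w0/sD.
(* Tilting: the ratio of the weights with and without [x] is increasing by the lattice condition.
   The induction hypothesis for [h] and this ratio shows that the conditional mean of [h] grows when
   [x] is added. *)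
have mono h : (forall A B, A `<=` B -> B `<=` x |` D -> h A <= h B) ->
    psum D (fun A => h A * w A) * psum D (fun A => w (x |` A)) <=
    psum D (fun A => h (x |` A) * w (x |` A)) * psum D w.
  move=> hm.
  have := IH w h (fun A => w (x |` A) / w A) w0' _ _ _.
  have e1 : psum D (fun A => w (x |` A) / w A * w A) = psum D (fun A => w (x |` A)).
    by apply: eq_psum => A AD; rewrite mulfVK // gt_eqF ?w0'.
  have e2 : psum D (fun A => h A * (w (x |` A) / w A) * w A) =
            psum D (fun A => h A * w (x |` A)).
    by apply: eq_psum => A AD; rewrite -mulrA mulfVK // gt_eqF ?w0'.
  rewrite e1 e2 => IH1; apply: le_trans (IH1 _ _ _) _.
  - by move=> A B AD BD; apply: ww; exact: sD.
  - by move=> A B AB BD; apply: hm => //; exact: sD.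
  - move=> A B AB BD; have AD := fsubset_trans AB BD.
    rewrite ler_pdivrMr ?w0' // mulrAC ler_pdivlMr ?w0' //.
    have := ww (x |` A) B (sxD _ AD) (sD _ BD).
    rewrite -fsetUA (fsetUidPr _ _ AB).
    have -> : (x |` A) `&` B = A.
      rewrite fsetIUl (fsetIidPl AB); apply/fsetUidPr/fsubsetP => y.
      by rewrite !inE => /andP[/eqP->]; rewrite (negPf (xA _ BD)).
    by [].
  - rewrite ler_pM2r; last exact: psum_gt0.
    apply: ler_psum => A AD; rewrite ler_pM2r ?wI //.
    by apply: hm; [exact: fsubsetU1 | exact: sxD].
have IH0 : psum D (fun A => f A * w A) * psum D (fun A => g A * w A) <=
  psum D (fun A => f A * g A * w A) * psum D w.
  apply: IH => // [A B AD BD|A B AB BD|A B AB BD].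
  - by apply: ww; exact: sD.
  - by apply: fm => //; exact: sD.
  - by apply: gm => //; exact: sD.
have IH1 : psum D (fun A => f (x |` A) * w (x |` A)) *
    psum D (fun A => g (x |` A) * w (x |` A)) <=
  psum D (fun A => f (x |` A) * g (x |` A) * w (x |` A)) * psum D (fun A => w (x |` A)).
  apply: (IH (fun A => w (x |` A)) (fun A => f (x |` A)) (fun A => g (x |` A)))
    => // [A B AD BD|A B AB BD|A B AB BD].
  - rewrite fsetUUr fsetUIr; apply: ww; exact: sxD.
  - by apply: fm; [exact: fsetUS | exact: sxD].
  - by apply: gm; [exact: fsetUS | exact: sxD].
have mf := mono f fm; have mg := mono g gm.
have Z0 : 0 < psum D w by exact: psum_gt0.
have Z1 : 0 < psum D (fun A => w (x |` A)) by exact: psum_gt0.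
move: mf mg IH0 IH1 Z0 Z1.
set F0 := psum D (fun A => f A * w A); set F1 := psum D (fun A => f _ * w _).
set G0 := psum D (fun A => g A * w A); set G1 := psum D (fun A => g _ * w _).
set Z0 := psum D w; set Z1 := psum D (fun A => w _).
set H0 := psum D (fun A => f A * _ * w A); set H1 := psum D (fun A => f _ * _ * w _).
move=> mf mg IH0 IH1 Z0p Z1p.
have prod : 0 <= (F1 * Z0 - F0 * Z1) * (G1 * Z0 - G0 * Z1).
  by apply: mulr_ge0; rewrite subr_ge0.
have Zp : 0 < Z0 * Z1 by exact: mulr_gt0.
rewrite -(ler_pM2l Zp).
have h0 : 0 <= (H0 * Z0 - F0 * G0) * (Z1 * (Z0 + Z1)).
  by rewrite mulr_ge0 ?subr_ge0 // mulr_ge0 ?addr_ge0 // ltW.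
have h1 : 0 <= (H1 * Z1 - F1 * G1) * (Z0 * (Z0 + Z1)).
  by rewrite mulr_ge0 ?subr_ge0 // mulr_ge0 ?addr_ge0 // ltW.
rewrite -subr_ge0.
have -> : Z0 * Z1 * ((H0 + H1) * (Z0 + Z1)) - Z0 * Z1 * ((F0 + F1) * (G0 + G1)) =
  (H0 * Z0 - F0 * G0) * (Z1 * (Z0 + Z1)) + (H1 * Z1 - F1 * G1) * (Z0 * (Z0 + Z1)) +
  (F1 * Z0 - F0 * Z1) * (G1 * Z0 - G0 * Z1) by ring.
by rewrite !addr_ge0.
Qed.

End PowersetUnion.

(** * Exploration of clusters and the domain Markov property *)

Section Exploration.
Variables (K : choiceType) (e : rel K).
Implicit Types (A B U I xi : {fset K}).

(** The seeds [xi] need not belong to [X], so that they can be a boundary condition outside the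
    explored domain; only the later sites of a path must lie in [X]. *)
Inductive reach (X xi : {fset K}) : K -> Prop :=
| reach_seed x : x \in xi -> reach X xi x
| reach_step x y : reach X xi x -> e x y -> y \in X -> reach X xi y.

Lemma reach_mono X Y xi x : X `<=` Y -> reach X xi x -> reach Y xi x.
Proof.
move=> /fsubsetP XY; elim=> {x} [x|x y _ IH exy yX]; first exact: reach_seed.
by apply: reach_step IH exy _; exact: XY.
Qed.

Lemma reach_in X xi x : reach X xi x -> x \in X `|` xi.
Proof. by case=> [y yxi|y z _ _ zX]; rewrite inE ?yxi ?zX ?orbT. Qed.

Lemma reach_trans X xi x y : reach X xi x -> reach X [fset x] y -> reach X xi y.
Proof.
move=> rx; elim=> {y} [y|y z _ IH eyz zX]; first by rewrite inE => /eqP->.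
exact: reach_step IH eyz zX.
Qed.

Definition explored xi A := [fset x in A | `[< reach A xi x >]].

(** The part of [B] about which the exploration reveals nothing: a site next to [U] or [xi] that is
    not in [U] is known to be outside the random set. *)
Definition unexplored B xi U :=
  [fset x in B | (x \notin U) && all (fun y => ~~ e y x) (enum_fset (U `|` xi))].

Lemma exploredP xi A x : reflect (x \in A /\ reach A xi x) (x \in explored xi A).
Proof.
by apply: (iffP idP) => [|[xA rx]]; rewrite !inE /= ?xA; [case/andP=> ? /asboolP | apply/asboolP].
Qed.

Lemma unexploredP B xi U x :
  reflect [/\ x \in B, x \notin U & forall y, y \in U `|` xi -> ~~ e y x]
    (x \in unexplored B xi U).
Proof.
rewrite !inE /=; apply: (iffP and3P) => [[? ? /allP ?]|[? ? ?]]; split => //.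
exact/allP.
Qed.

Lemma explored_sub xi A : explored xi A `<=` A.
Proof. by apply/fsubsetP => x /exploredP[]. Qed.

Lemma unexplored_sub B xi U : unexplored B xi U `<=` B.
Proof. by apply/fsubsetP => x /unexploredP[]. Qed.

Lemma explored_idem xi A : explored xi (explored xi A) = explored xi A.
Proof.
apply/fsetP => x; apply/idP/idP; first by case/exploredP.
move=> xU; apply/exploredP; split => //; have /exploredP[_ rx] := xU.
elim: rx {xU} => {x} [x|x y rx IH exy yA]; first exact: reach_seed.
apply: (reach_step IH exy); apply/exploredP; split => //.
exact: reach_step rx exy yA.
Qed.

Lemma explored_compl B xi A : A `<=` B ->
  A `\` explored xi A `<=` unexplored B xi (explored xi A).
Proof.
move=> /fsubsetP AB; apply/fsubsetP => x; rewrite inE => /andP[xU xA].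
apply/unexploredP; split => //; first exact: AB.
move=> y yU; apply/negP => eyx; move/negP: xU; apply; apply/exploredP; split=> //.
move: yU; rewrite inE => /orP[/exploredP[yA ry]|yxi].
  exact: reach_step ry eyx xA.
exact: reach_step (reach_seed _ yxi) eyx xA.
Qed.

Lemma explored_union B xi U I : [disjoint B & xi] -> explored xi U = U ->
  I `<=` unexplored B xi U -> explored xi (U `|` I) = U.
Proof.
move=> dB UU /fsubsetP IU.
have rU x : reach (U `|` I) xi x -> x \in U `|` xi.
  elim=> {x} [x xxi|x y _ xU exy]; first by rewrite inE xxi orbT.
  rewrite inE => /orP[yU|/IU/unexploredP[_ _ /(_ x xU)]]; last by rewrite exy.
  by rewrite inE yU.
apply/fsetP => x; apply/exploredP/idP => [[]|xU].
  rewrite inE => /orP[//|/IU/unexploredP[xB _ _]] /rU.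
  by rewrite inE => /orP[//|]; move/fdisjointP: dB => /(_ x xB) /negPf->.
split; first by rewrite inE xU.
have : x \in explored xi U by rewrite UU.
by case/exploredP => _; apply: reach_mono; exact: fsubsetUl.
Qed.

(** Domain Markov property: once the explored part is known to be [U], its neighbours are determined
    and the rest is an arbitrary subset of the unexplored domain. The possible [U] are the fixed
    points of the exploration. *)
Lemma psum_explore (R : realFieldType) B xi (G : {fset K} -> R) :
  [disjoint B & xi] ->
  psum B G = psum B (fun U => (explored xi U == U)%:R *
                     psum (unexplored B xi U) (fun I => G (U `|` I))).
Proof.
move=> dB; rewrite (@psum_part _ _ _ _ B (explored xi)); last first.
  by move=> A AB; exact: fsubset_trans (explored_sub _ _) AB.
apply: eq_psum => U UB; case: eqP => UU; last first.
  rewrite mul0r /psum big1_seq // => A /= _; case: eqP => E; rewrite ?mul0r //.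
  by case: UU; rewrite -E explored_idem.
rewrite mul1r.
have disU I : I `<=` unexplored B xi U -> (U `|` I) `\` U = I.
  move=> /fsubsetP IU; apply/fsetP => x; rewrite !inE.
  by case xU: (x \in U) => //=; apply/esym/negbTE/negP => /IU/unexploredP[]; rewrite xU.
apply: (@psum_reindex _ _ _ _ _ (fun I => U `|` I) (fun A => A `\` U)
  (fun A => explored xi A == U)).
- move=> I IU; split.
  + by rewrite fsubUset UB (fsubset_trans IU (unexplored_sub _ _ _)).
  + by apply/eqP; exact: explored_union dB UU IU.
  + exact: disU.
- move=> A AB /eqP E; split; first by rewrite -E explored_compl.
  rewrite -{}E; apply/fsetP => x; rewrite in_fsetU in_fsetD.
  by case xU: (x \in explored _ _) => //=; rewrite (fsubsetP (explored_sub _ _) _ xU).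
Qed.

End Exploration.

(** * Expansion in characters with nonnegative coefficients *)

Section PositiveType.
Variables (K : choiceType) (R : realFieldType) (I : Type) (e1 e2 : I -> K).
Implicit Types (A D m : {fset K}).

Definition character (s : seq K) A : R := \prod_(x <- s) (if x \in A then -1 else 1).

Definition disagreements (r : seq I) A : nat :=
  \sum_(b <- r) ((e1 b \in A) != (e2 b \in A)).

Lemma character_le1 s A : character s A <= 1.
Proof.
suff: `|character s A| = 1 by move=> <-; exact: ler_norm.
rewrite /character; elim: s => [|x s IH]; first by rewrite big_nil normr1.
by rewrite big_cons normrM IH mulr1; case: ifP => _; rewrite ?normrN1 ?normr1.
Qed.

Lemma characterU s A D : [disjoint A & D] ->
  character s (A `|` D) = character s A * character s D.
Proof.
move=> /fdisjointP dAD; rewrite /character -big_split /=; apply: eq_bigr => x _.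
rewrite inE; case xA: (x \in A) => /=; last by rewrite mul1r.
by rewrite (negPf (dAD _ xA)) mulr1.
Qed.

Lemma psum_character_ge0 s D : 0 <= psum D (character s).
Proof.
elim/fset_ind1: D => [|x D xD IH].
  rewrite psum_fset0 /character big1 // => x _; by rewrite inE.
rewrite psumU1 //.
rewrite (@eq_psum _ _ D (fun A => _ (x |` A))
  (fun A => character s [fset x] * character s A)); last first.
  move=> A AD; rewrite characterU //; apply/fdisjointP => y; rewrite inE => /eqP ->.
  by apply: contra xD; exact: fsubsetP.
rewrite psumZ -{1}[psum D _]mul1r -mulrDl mulr_ge0 //.
suff n1 : `|character s [fset x]| = 1.
  by have := ler_norm (- character s [fset x]); rewrite normrN n1; lra.
rewrite /character; elim: s {IH} => [|y s IH]; first by rewrite big_nil normr1.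
by rewrite big_cons normrM IH mulr1; case: ifP => _; rewrite ?normrN1 ?normr1.
Qed.

(** With spins s = -1 on [A] and s = 1 elsewhere, a bond with ends a and b contributes (1 + t) / 2 +
    (1 - t) / 2 s_a s_b, and both coefficients are nonnegative; expand the product over the
    bonds. *)
Lemma disagreement_pos_type (t : R) (r : seq I) : 0 < t <= 1 ->
  exists2 q : seq (R * seq K), all (fun c => 0 <= c.1) q &
    forall A, t ^+ disagreements r A = \sum_(c <- q) c.1 * character c.2 A.
Proof.
move=> /andP[t0 t1]; rewrite /disagreements; elim: r => [|b r [q q0 qE]].
  exists [:: (1, [::])] => [|A]; first by rewrite /= ler01.
  by rewrite big_nil big_seq1 /character big_nil mulr1.
exists ([seq ((1 + t) / 2 * c.1, c.2) | c <- q] ++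
        [seq ((1 - t) / 2 * c.1, [:: e1 b, e2 b & c.2]) | c <- q]).
  rewrite all_cat !all_map; apply/andP; split; apply: sub_all q0 => c /= c0;
  by rewrite !mulr_ge0 ?invr_ge0 ?subr_ge0 // addr_ge0 // ltW.
move=> A; rewrite big_cons exprD qE big_cat !big_map /= -big_split /= mulr_sumr.
apply: eq_bigr => c _; rewrite /character !big_cons.
by case: (e1 b \in A); case: (e2 b \in A) => /=; rewrite ?expr0 ?expr1; field.
Qed.

(** After the expansion in characters every term is nonnegative, and the boundary condition [m] only
    multiplies it by a sign; the empty [m] makes all these signs 1. *)
Lemma uniform_boundary_max (t : R) (r : seq I) D m : 0 < t <= 1 ->
  [disjoint m & D] ->
  psum D (fun A => t ^+ disagreements r (m `|` A)) <=
  psum D (fun A => t ^+ disagreements r A).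
Proof.
move=> t01 dm; have [q /allP q0 qE] := disagreement_pos_type r t01.
rewrite (eq_psum (fun A _ => qE (m `|` A))) (eq_psum (fun A _ => qE A)) !psum_sum.
rewrite big_seq [leRHS]big_seq; apply: ler_sum => c /q0 c0.
rewrite !psumZ ler_wpM2l // (@eq_psum _ _ D _
  (fun A => character c.2 m * character c.2 A)); last first.
  move=> A AD; apply: characterU; exact: fdisjointWr AD dm.
rewrite psumZ -[leRHS]mul1r ler_wpM2r ?psum_character_ge0 //.
exact: character_le1.
Qed.

End PositiveType.

(** * Parity of dual bonds *)

Section DualEdges.
Implicit Types (E X : {fset bond}) (e b : bond) (u v : site).

Definition dual_fst e : site := if e.2 then (e.1.1, e.1.2 - 1) else (e.1.1 - 1, e.1.2).
Definition dual_snd e : site := e.1.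

Definition north_in E v := ((v.1, v.2 + 1), true) \in E.
Definition south_in E v := (v, true) \in E.
Definition east_in E v := ((v.1 + 1, v.2), false) \in E.
Definition west_in E v := (v, false) \in E.

Definition odd_degree E v :=
  north_in E v (+) east_in E v (+) south_in E v (+) west_in E v.

Lemma siteE (v w : site) : (v == w) = (v.1 == w.1) && (v.2 == w.2).
Proof. by case: v w => [? ?] [? ?]. Qed.

Lemma bondE (e b : bond) : (e == b) = [&& e.1.1 == b.1.1, e.1.2 == b.1.2 & e.2 == b.2].
Proof. by case: e b => [[? ?] ?] [[? ?] ?]; rewrite /eq_op /= /eq_op /= -andbA. Qed.

Lemma odd_degreeU1 e E v : e \notin E ->
  odd_degree (e |` E) v = odd_degree E v (+) (v == dual_fst e) (+) (v == dual_snd e).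
Proof.
move=> eE; rewrite /odd_degree /north_in /east_in /south_in /west_in !in_fset1U.
have addE b : (b == e) || (b \in E) = (b == e) (+) (b \in E).
  by case: eqP => [->|//]; rewrite (negPf eE).
rewrite !addE {addE}.
case: (_ \in E) (_ \in E) (_ \in E) (_ \in E) => [] [] [] [] /=;
case: e v {eE} => [[i j] []] [a b];
rewrite !bondE !siteE /dual_fst /dual_snd /= ?andbF ?andbT /=; lia.
Qed.

(** Parity of the vertical dual bonds of [E] met by the horizontal half-line going left from the
    site (x, y). For an even [E] this is the two-colouring of the faces; in the fermionic observable
    it carries the sign. *)
Definition row_parity E (x y : int) : bool :=
  odd (count (fun b : bond => [&& b.2, b.1.2 == y & b.1.1 < x]) (enum_fset E)).

Lemma row_parity_succ E (x y : int) :
  row_parity E (x + 1) y = row_parity E x y (+) (((x, y), true) \in E).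
Proof.
rewrite /row_parity -[_ \in E]oddb -count_uniq_mem ?fset_uniq // -oddD; congr odd.
rewrite -count_predUI [X in (_ + X)%N](_ : _ = 0%N) ?addn0; last first.
  apply/eqP; rewrite -leqn0 leqNgt -has_count; apply/negP => /hasP[[[i j] o] _] /=.
  by rewrite bondE /=; lia.
by apply: eq_count => -[[i j] o] /=; rewrite bondE /=; case: o; lia.
Qed.

Lemma fset_bond_bound E : exists m : int, forall b, b \in E ->
  [/\ - m < b.1.1, b.1.1 < m, - m < b.1.2 & b.1.2 < m].
Proof.
elim/fset_ind1: E => [|[[i j] o] E _ [m mP]]; first by exists 0.
exists (`|m| + `|i| + `|j| + 1) => b; rewrite in_fset1U => /orP[/eqP->|/mP] /=.
  by split; lia.
by case: b => [[k l] o'] /= [? ? ? ?]; split; lia.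
Qed.

Lemma row_parity_left E (x y : int) : (forall b, b \in E -> b.2 -> b.1.2 = y -> x <= b.1.1) ->
  row_parity E x y = false.
Proof.
move=> xE; rewrite /row_parity (_ : count _ _ = 0%N) //; apply/eqP.
rewrite -leqn0 leqNgt -has_count; apply/negP => /hasP[b bE] /and3P[b2 /eqP by_ bx].
by move: (xE b bE b2 by_) bx; lia.
Qed.

(** Sum the degrees of the dual sites between the two rows and to the left of [x]: horizontal bonds
    count twice except the last one. Odd vertices further right are allowed, as the observable
    requires. *)
Lemma row_parity_vert E (x y : int) : (forall k : int, k < x -> ~~ odd_degree E (k, y)) ->
  row_parity E x (y + 1) (+) row_parity E x y = (((x, y), false) \in E).
Proof.
move=> ev; have [m mP] := fset_bond_bound E.
have start (x' : int) : x' <= - m ->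
    row_parity E x' (y + 1) (+) row_parity E x' y = (((x', y), false) \in E).
  move=> x'm; rewrite !row_parity_left; try by move=> b /mP[]; lia.
  by symmetry; apply/negbTE/negP => /mP[] /=; lia.
have [/start//|xm] := leP x (- m).
have [n xn] : exists n : nat, x = - m + n%:Z by exists (absz (x + m)); lia.
move: ev xm; rewrite {}xn => {x}.
elim: n => [|n IH] ev xm; first by apply: start; lia.
have -> : - m + n.+1%:Z = - m + n%:Z + 1 by lia.
rewrite !row_parity_succ.
have IHn : row_parity E (- m + n%:Z) (y + 1) (+) row_parity E (- m + n%:Z) y =
    (((- m + n%:Z, y), false) \in E).
  by case: n IH ev xm => [|n] IH ev xm; [apply: start|apply: IH => [k kn|]; [apply: ev|]]; lia.
have /negPf := ev (- m + n%:Z) ltac:(lia).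
rewrite /odd_degree /north_in /east_in /south_in /west_in /=.
by move: IHn; do 2!case: (row_parity _ _ _); do 4!case: (_ \in E).
Qed.

End DualEdges.

(** * Decay of the fermionic observable *)

Lemma sum_shift_le (R : realFieldType) (V : {fset site}) (f : site -> R) (dx dy : int) :
  (forall x, 0 <= f x) ->
  (forall x, x \in V -> f x != 0 -> (x.1 - dx, x.2 - dy) \in V) ->
  \sum_(x <- V) f x <= \sum_(y <- V) f (y.1 + dx, y.2 + dy).
Proof.
move=> f0 fV; pose g (y : site) : site := (y.1 + dx, y.2 + dy).
pose h (x : site) : site := (x.1 - dx, x.2 - dy).
have gh x : g (h x) = x by rewrite /g /h /= !subrK -surjective_pairing.
have hg x : h (g x) = x by rewrite /g /h /= !addrK -surjective_pairing.
rewrite [leRHS](bigID (fun y => g y \in V)) /= -[leLHS]addr0 lerD ?sumr_ge0 //.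
rewrite (bigID (fun x => h x \in V)) /= [X in _ + X]big1_seq ?addr0; last first.
  by move=> x /andP[hx /fV]; case: (f x =P 0) => // _ /(_ isT); rewrite -/(h x) (negPf hx).
rewrite -big_filter -[leRHS]big_filter.
rewrite (_ : \sum_(y <- [seq y <- V | g y \in V]) f (g y) =
  \sum_(x <- [seq g y | y <- [seq y <- V | g y \in V]]) f x); last by rewrite big_map.
rewrite le_eqVlt; apply/orP; left; apply/eqP; apply: perm_big; apply: uniq_perm.
- by rewrite filter_uniq ?fset_uniq.
- by rewrite (map_inj_uniq (can_inj hg)) filter_uniq ?fset_uniq.
move=> x; rewrite mem_filter; apply/andP/mapP => [[hx xV]|[y]].
  by exists (h x); rewrite ?gh // mem_filter gh xV.
by rewrite mem_filter => /andP[gy yV] ->; rewrite hg.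
Qed.

Section Fermion.
Variables (R : realFieldType) (t r : R).
Hypotheses (t0 : 0 <= t) (r0 : 0 <= r) (r2 : r ^+ 2 = 2).
Variables (X : {fset bond}) (p : site).
Implicit Types (E : {fset bond}) (e b : bond) (u v : site).

Definition has_boundary E u := `[< forall v, odd_degree E v = (v == p) (+) (v == u) >].

(** For [u = p] the two conditions cancel and the sum runs over even subgraphs, that is over contour
    configurations; otherwise the subgraphs also contain an interface from [p] to [u]. *)
Definition corr u : R := psum X (fun E => (has_boundary E u)%:R * t ^+ #|` E|).

(* [p] and [u] are the two odd vertices of [E].  The sign replaces the winding of the
   path from [p] to [u]: it is the parity of the bonds of [E] that a horizontal
   half-line arriving at [u] crosses.  The letter is the bond at [u], used by [E] in
   [bN], ..., [bE] and unused in [aN], ..., [aE]. *)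
Let sg E u : R := (-1) ^+ row_parity E u.1 (u.2 + 1).
Let sgS E u : R := (-1) ^+ row_parity E u.1 u.2.
Let sgE E u : R := (-1) ^+ (row_parity E u.1 (u.2 + 1) (+) north_in E u).

Definition fermion (c : bool) (d : {fset bond} -> site -> bool)
    (s : {fset bond} -> site -> R) u : R :=
  psum X (fun E => (has_boundary E u)%:R * ((d E u == c)%:R * s E u * t ^+ #|` E|)).

Let bN := fermion true north_in sg.
Let bS := fermion true south_in sgS.
Let bW := fermion true west_in sg.
Let bE := fermion true east_in sgE.
Let aN := fermion false north_in sg.
Let aS := fermion false south_in sgS.
Let aW := fermion false west_in sg.
Let aE := fermion false east_in sgE.

Lemma has_boundaryP E u : reflect (forall v, odd_degree E v = (v == p) (+) (v == u))
  (has_boundary E u).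
Proof. exact: asboolP. Qed.

(** The hypothesis on [u.1] keeps both odd vertices off the columns to the left of [u], so that
    [row_parity_vert] applies. *)
Lemma local_signs E u : u.1 <= p.1 -> u != p -> has_boundary E u ->
  row_parity E u.1 u.2 = row_parity E u.1 (u.2 + 1) (+) west_in E u /\
  north_in E u (+) east_in E u (+) south_in E u (+) west_in E u.
Proof.
move=> up uNp /has_boundaryP bd; split; last first.
  by have := bd u; rewrite /odd_degree eqxx (negPf uNp).
have <- : row_parity E u.1 (u.2 + 1) (+) row_parity E u.1 u.2 = west_in E u.
  rewrite row_parity_vert; first by rewrite /west_in -surjective_pairing.
  by move=> k ku; rewrite bd !siteE /=; lia.
by rewrite addKb.
Qed.

(** The relations hold for each subgraph [E] separately: it uses one or three bonds at [u], and the
    signs are such that both sides agree in each of the eight cases. *)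
Lemma fermion_linear u : u.1 <= p.1 -> u != p ->
  [/\ aW u = bN u + bE u + bS u, aN u = bW u + bE u + bS u,
      aE u = bW u - bN u + bS u & aS u = - bW u + bN u + bE u].
Proof.
move=> up uNp.
rewrite /aW /aN /aE /aS /bW /bN /bE /bS /fermion.
have oppS F : - psum X F = psum X (fun E => - F E) by rewrite /psum sumrN.
rewrite !oppS -!psumD; split; apply: eq_psum => E EX;
case bd: (has_boundary E u); rewrite ?mul0r ?oppr0 ?addr0 // !mul1r;
have [rS] := local_signs up uNp bd; rewrite /sg /sgS /sgE rS;
case: (row_parity _ _ _); case: (north_in _ _); case: (east_in _ _);
case: (south_in _ _); case: (west_in _ _) => //= _;
rewrite ?expr0 ?expr1; ring.
Qed.

(** Here the critical point enters: [3 + 2 * r] is the square of 1 + sqrt 2, the operator norm of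
    the local matrix of [fermion_linear]. *)
Lemma kac_ward_norm u : u.1 <= p.1 -> u != p ->
  aN u ^+ 2 + aE u ^+ 2 + aS u ^+ 2 + aW u ^+ 2 <=
  (3 + 2 * r) * (bN u ^+ 2 + bE u ^+ 2 + bS u ^+ 2 + bW u ^+ 2).
Proof.
move=> up uNp; have [-> -> -> ->] := fermion_linear up uNp.
move: (bN u) (bE u) (bS u) (bW u) => n e s w.
have rp : 0 < r.
  by rewrite lt_neqAle r0 andbT; apply/eqP => r00; move: r2; rewrite -r00; lra.
(* Multiplied by [r], the difference is a sum of two squares. *)
rewrite -subr_ge0 -(pmulr_rge0 _ rp).
set d := _ * (_ - _).
have -> : d = 2 * ((r * e - (n + s)) ^+ 2 + (r * w - (s - n)) ^+ 2)
    + (r ^+ 2 - 2) * (2 * n ^+ 2 + 2 * s ^+ 2) by rewrite /d; ring.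
by rewrite r2 subrr mul0r addr0 mulr_ge0 // addr_ge0 // sqr_ge0.
Qed.

Lemma psum_flip e (H H' : {fset bond} -> R) :
  (forall E, E `<=` X -> e \notin E -> H (e |` E) = t * H' E) ->
  psum X (fun E => (e \in E)%:R * H E) =
  (e \in X)%:R * (t * psum X (fun E => (e \notin E)%:R * H' E)).
Proof.
move=> HH; case eX: (e \in X); last first.
  rewrite mul0r /psum big1_seq // => E /=; rewrite fpowersetE => /fsubsetP EX.
  by case eE: (e \in E); rewrite ?mul0r //; move/EX: eE; rewrite eX.
rewrite mul1r -psumZ -(fsetD1K eX).
have eN : e \notin X `\ e by rewrite !inE eqxx.
have eA A : A `<=` X `\ e -> e \notin A by move=> /fsubsetP AX; apply/negP => /AX; rewrite !inE eqxx.
rewrite !psumU1 // [X in X + _](_ : _ = 0) ?add0r; last first.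
  by rewrite /psum big1_seq // => E /=; rewrite fpowersetE => /eA /negPf->; rewrite mul0r.
rewrite [X in _ + X](_ : _ = 0) ?addr0; last first.
  by rewrite /psum big1_seq // => E _; rewrite fset1U1 mul0r mulr0.
apply: eq_psum => E EX; rewrite fset1U1 eA // !mul1r; apply: HH; last exact: eA.
by apply: fsubset_trans EX _; exact: fsubD1set.
Qed.

Lemma has_boundaryU1 e E u v : e \notin E -> dual_fst e = u -> dual_snd e = v ->
  has_boundary (e |` E) u = has_boundary E v.
Proof.
move=> eE eu ev; apply: asbool_equiv_eq; split=> bd w; move: (bd w);
by rewrite odd_degreeU1 // eu ev; 
   case: (w == u) (w == v) (w == p) (odd_degree E w) => [] [] [] [].
Qed.

Lemma has_boundaryU1' e E u v : e \notin E -> dual_fst e = u -> dual_snd e = v ->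
  has_boundary (e |` E) v = has_boundary E u.
Proof.
move=> eE eu ev; apply: asbool_equiv_eq; split=> bd w; move: (bd w);
by rewrite odd_degreeU1 // eu ev; 
   case: (w == u) (w == v) (w == p) (odd_degree E w) => [] [] [] [].
Qed.

Lemma row_parityU1 e E (x y : int) : e \notin E ->
  row_parity (e |` E) x y = row_parity E x y (+) [&& e.2, e.1.2 == y & e.1.1 < x].
Proof.
move=> eE; rewrite /row_parity -(permP (_ : perm_eq (e :: enum_fset E) _)) /=.
  by rewrite oddD oddb addbC.
apply: uniq_perm => /=; rewrite ?eE ?fset_uniq // => b.
by rewrite in_fset1U inE.
Qed.

Let weight_flip E e : e \notin E -> t ^+ #|` e |` E| = t * t ^+ #|` E|.
Proof. by move=> eE; rewrite cardfsU1 eE exprS. Qed.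

(** Removing the bond between [u] and a neighbour moves the odd vertex along it at the price of a
    factor [t]. The signs attached to the four directions are chosen so that this move leaves them
    unchanged. *)
Lemma fermion_step u :
  [/\ bS (u.1, u.2 + 1) = (((u.1, u.2 + 1), true) \in X)%:R * (t * aN u),
      bN (u.1, u.2 - 1) = ((u, true) \in X)%:R * (t * aS u),
      bE (u.1 - 1, u.2) = ((u, false) \in X)%:R * (t * aW u) &
      bW (u.1 + 1, u.2) = (((u.1 + 1, u.2), false) \in X)%:R * (t * aE u)].
Proof.
split.
- rewrite /bS /aN /fermion.
  transitivity (psum X (fun E => (((u.1, u.2 + 1), true) \in E)%:R *
     ((has_boundary E (u.1, u.2 + 1))%:R * (sgS E (u.1, u.2 + 1) * t ^+ #|` E|)))).
    by apply: eq_psum => E _; rewrite /south_in; case: (_ \in E); rewrite /= ?mul1r ?mul0r ?mulr0 ?mulr1.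
  rewrite (@psum_flip _ _ (fun E => (has_boundary E u)%:R * (sg E u * t ^+ #|` E|))).
    by congr (_ * (_ * _)); apply: eq_psum => E _; rewrite /north_in; case: (_ \in E);
       rewrite /= ?mul1r ?mul0r ?mulr0 ?mulr1.
  move=> E _ eE; rewrite weight_flip // (@has_boundaryU1' _ _ u) //; last first.
    by rewrite /dual_fst /= addrK -surjective_pairing.
  by rewrite /sgS /sg row_parityU1 //= ltxx !andbF addbF; ring.
- rewrite /bN /aS /fermion.
  transitivity (psum X (fun E => ((u, true) \in E)%:R *
     ((has_boundary E (u.1, u.2 - 1))%:R * (sg E (u.1, u.2 - 1) * t ^+ #|` E|)))).
    by apply: eq_psum => E _; rewrite /north_in /= subrK -surjective_pairing;
       case: (_ \in E); rewrite /= ?mul1r ?mul0r ?mulr0 ?mulr1.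
  rewrite (@psum_flip _ _ (fun E => (has_boundary E u)%:R * (sgS E u * t ^+ #|` E|))).
    by congr (_ * (_ * _)); apply: eq_psum => E _; rewrite /south_in; case: (_ \in E);
       rewrite /= ?mul1r ?mul0r ?mulr0 ?mulr1.
  move=> E _ eE; rewrite weight_flip // (@has_boundaryU1 _ _ _ u) //.
  by rewrite /sgS /sg /= subrK row_parityU1 //= ltxx !andbF addbF; ring.
- rewrite /bE /aW /fermion.
  transitivity (psum X (fun E => ((u, false) \in E)%:R *
     ((has_boundary E (u.1 - 1, u.2))%:R * (sgE E (u.1 - 1, u.2) * t ^+ #|` E|)))).
    by apply: eq_psum => E _; rewrite /east_in /= subrK -surjective_pairing;
       case: (_ \in E); rewrite /= ?mul1r ?mul0r ?mulr0 ?mulr1.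
  rewrite (@psum_flip _ _ (fun E => (has_boundary E u)%:R * (sg E u * t ^+ #|` E|))).
    by congr (_ * (_ * _)); apply: eq_psum => E _; rewrite /west_in; case: (_ \in E);
       rewrite /= ?mul1r ?mul0r ?mulr0 ?mulr1.
  move=> E _ eE; rewrite weight_flip // (@has_boundaryU1 _ _ _ u) //.
  by rewrite /sgE /sg /north_in /= -row_parity_succ subrK row_parityU1 //= addbF; ring.
- rewrite /bW /aE /fermion.
  transitivity (psum X (fun E => (((u.1 + 1, u.2), false) \in E)%:R *
     ((has_boundary E (u.1 + 1, u.2))%:R * (sg E (u.1 + 1, u.2) * t ^+ #|` E|)))).
    by apply: eq_psum => E _; rewrite /west_in; case: (_ \in E); rewrite /= ?mul1r ?mul0r ?mulr0 ?mulr1.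
  rewrite (@psum_flip _ _ (fun E => (has_boundary E u)%:R * (sgE E u * t ^+ #|` E|))).
    by congr (_ * (_ * _)); apply: eq_psum => E _; rewrite /east_in; case: (_ \in E);
       rewrite /= ?mul1r ?mul0r ?mulr0 ?mulr1.
  move=> E _ eE; rewrite weight_flip // (@has_boundaryU1' _ _ u) //; last first.
    by rewrite /dual_fst /= addrK -surjective_pairing.
  by rewrite /sgE /sg /north_in /= -row_parity_succ row_parityU1 //= addbF; ring.
Qed.

Let bb u := bN u ^+ 2 + bE u ^+ 2 + bS u ^+ 2 + bW u ^+ 2.
(** The squares of the components that [fermion_step] derives from [u]: at each neighbour, the
    component of the bond leading back to [u]. *)
Let out u := bS (u.1, u.2 + 1) ^+ 2 + bN (u.1, u.2 + - 1) ^+ 2 +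
  bE (u.1 + - 1, u.2) ^+ 2 + bW (u.1 + 1, u.2) ^+ 2.
Let rho2 := t ^+ 2 * (3 + 2 * r).

Let out_le u : out u <= t ^+ 2 * (aN u ^+ 2 + aE u ^+ 2 + aS u ^+ 2 + aW u ^+ 2).
Proof.
have [bS' bN' bE' bW'] := fermion_step u; rewrite /out bS' bN' bE' bW'.
have le (b : bool) (x : R) : (b%:R * (t * x)) ^+ 2 <= t ^+ 2 * x ^+ 2.
  by case: b; rewrite ?mul1r ?mul0r ?expr0n /= -exprMn // sqr_ge0.
apply: le_trans (lerD (lerD (lerD (le _ _) (le _ _)) (le _ _)) (le _ _)) _.
by rewrite -!mulrDr ler_wpM2l ?sqr_ge0 //; lra.
Qed.

Let out_step u : u.1 <= p.1 -> u != p -> out u <= rho2 * bb u.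
Proof.
move=> up uNp; apply: le_trans (out_le u) _.
by rewrite /rho2 -mulrA ler_wpM2l ?sqr_ge0 // kac_ward_norm.
Qed.

(** At the source the linear relations fail, and this trivial bound replaces them. *)
Let bound_source c d s : (forall E u, `|s E u| <= 1) -> fermion c d s p ^+ 2 <= corr p ^+ 2.
Proof.
move=> s1; rewrite -real_normK ?num_real // ler_sqr ?nnegrE //; last first.
  by rewrite /corr psum_ge0 // => E _; rewrite mulr_ge0 ?exprn_ge0.
apply: le_trans (ler_norm_sum _ _ _) _; rewrite /corr /psum; apply: ler_sum => E _.
rewrite !normrM (ger0_norm (exprn_ge0 _ t0)) !normr_nat ler_wpM2l //.
rewrite -[leRHS]mul1r ler_wpM2r ?exprn_ge0 //.
by case: (_ == _); rewrite ?mul0r ?mul1r.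
Qed.

Let out_source : out p <= 4 * t ^+ 2 * corr p ^+ 2.
Proof.
apply: le_trans (out_le p) _; rewrite (mulrC 4) -(mulrA (t ^+ 2)) ler_wpM2l ?sqr_ge0 //.
have sg1 (b : bool) : `|(-1) ^+ b : R| <= 1 by rewrite normrX normrN1 expr1n.
have aN1 : aN p ^+ 2 <= corr p ^+ 2 by apply: bound_source => *; exact: sg1.
have aE1 : aE p ^+ 2 <= corr p ^+ 2 by apply: bound_source => *; exact: sg1.
have aS1 : aS p ^+ 2 <= corr p ^+ 2 by apply: bound_source => *; exact: sg1.
have aW1 : aW p ^+ 2 <= corr p ^+ 2 by apply: bound_source => *; exact: sg1.
lra.
Qed.

Let fermion_supp d s u : (forall E, E `<=` X -> d E u = false) -> fermion true d s u = 0.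
Proof.
move=> dX; rewrite /fermion /psum big1_seq // => E /=; rewrite fpowersetE => /dX ->.
by rewrite !mul0r mulr0.
Qed.

Let V : {fset site} := [fset dual_fst e | e in X] `|` [fset dual_snd e | e in X].

Let in_V e : e \in X -> dual_fst e \in V /\ dual_snd e \in V.
Proof. by move=> eX; rewrite !inE; split; rewrite in_imfset ?orbT. Qed.

Let energy (n : int) := \sum_(x <- V) (x.1 <= n)%R%:R * bb x.

Let bb_ge0 u : 0 <= bb u. Proof. by rewrite !addr_ge0 ?sqr_ge0. Qed.

Let out_ge0 u : 0 <= out u. Proof. by rewrite !addr_ge0 ?sqr_ge0. Qed.

(** Every nonzero component comes from a neighbour, which is at most one column further to the
    right. *)
Let energy_le n : energy n <= \sum_(y <- V) (y.1 <= n + 1)%R%:R * out y.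
Proof.
rewrite /energy; under eq_bigr do rewrite /bb !mulrDr; rewrite !big_split /=.
under [leRHS]eq_bigr do rewrite /out !mulrDr; rewrite !big_split /=.
have sub E b : E `<=` X -> b \notin X -> b \in E = false.
  by move=> /fsubsetP EX bX; apply/negbTE; apply: contra bX => /EX.
have shift (f : site -> R) dx dy : (dx <= 1)%R -> (- 1 <= dx)%R ->
    (forall x, x \in V -> f x != 0 -> (x.1 - dx, x.2 - dy) \in V) ->
    \sum_(x <- V) (x.1 <= n)%R%:R * f x ^+ 2 <=
    \sum_(y <- V) (y.1 <= n + 1)%R%:R * f (y.1 + dx, y.2 + dy) ^+ 2.
  move=> dx1 dxN1 fV.
  apply: le_trans (@sum_shift_le _ V (fun x => (x.1 <= n)%R%:R * f x ^+ 2) dx dy _ _) _.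
  - by move=> x; rewrite mulr_ge0 ?sqr_ge0.
  - move=> x xV; rewrite mulf_eq0 expf_eq0 /= negb_or => /andP[_]; exact: fV.
  - apply: ler_sum => y _; rewrite ler_wpM2r ?sqr_ge0 // ler_nat /=.
    by case: (leP (y.1 + dx) n) => //=; case: leP => //=; lia.
rewrite [leLHS](_ : _ = \sum_(x <- V) (x.1 <= n)%R%:R * bS x ^+ 2 +
    \sum_(x <- V) (x.1 <= n)%R%:R * bN x ^+ 2 +
    \sum_(x <- V) (x.1 <= n)%R%:R * bE x ^+ 2 +
    \sum_(x <- V) (x.1 <= n)%R%:R * bW x ^+ 2); last by ring.
have shiftS := shift bS 0 1; have shiftN := shift bN 0 (-1).
have shiftE := shift bE (-1) 0; have shiftW := shift bW 1 0.
apply: lerD; [apply: lerD; [apply: lerD|]|].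
- rewrite [leRHS](eq_bigr (fun y => (y.1 <= n + 1)%R%:R * bS (y.1 + 0, y.2 + 1) ^+ 2)).
    apply: shiftS => // x xV; case xX: ((x, true) \in X).
      by have [] := in_V xX; rewrite subr0.
    by rewrite /bS fermion_supp ?eqxx // => E EX; rewrite /south_in sub ?xX.
  by move=> y _; rewrite addr0.
- rewrite [leRHS](eq_bigr (fun y => (y.1 <= n + 1)%R%:R * bN (y.1 + 0, y.2 + -1) ^+ 2)).
    apply: shiftN => // x xV; case xX: (((x.1, x.2 + 1), true) \in X).
      by have [] := in_V xX; rewrite subr0 opprK.
    by rewrite /bN fermion_supp ?eqxx // => E EX; rewrite /north_in sub ?xX.
  by move=> y _; rewrite addr0.
- rewrite [leRHS](eq_bigr (fun y => (y.1 <= n + 1)%R%:R * bE (y.1 + -1, y.2 + 0) ^+ 2)).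
    apply: shiftE => // x xV; case xX: (((x.1 + 1, x.2), false) \in X).
      by have [] := in_V xX; rewrite subr0 opprK.
    by rewrite /bE fermion_supp ?eqxx // => E EX; rewrite /east_in sub ?xX.
  by move=> y _; rewrite addr0.
- rewrite [leRHS](eq_bigr (fun y => (y.1 <= n + 1)%R%:R * bW (y.1 + 1, y.2 + 0) ^+ 2)).
    apply: shiftW => // x xV; case xX: ((x, false) \in X).
      by have [] := in_V xX; rewrite subr0.
    by rewrite /bW fermion_supp ?eqxx // => E EX; rewrite /west_in sub ?xX.
  by move=> y _; rewrite addr0.
Qed.

Hypothesis rho2_lt1 : rho2 < 1.
Variable q : site.
Hypothesis qp : q.1 < p.1.
Hypothesis X_range : forall e, e \in X ->
  [/\ q.1 <= (dual_fst e).1, (dual_fst e).1 <= p.1,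
      q.1 <= (dual_snd e).1 & (dual_snd e).1 <= p.1].

Let V_range x : x \in V -> q.1 <= x.1 /\ x.1 <= p.1.
Proof. by rewrite inE => /orP[] /imfsetP[e /= /X_range[? ? ? ?] ->]. Qed.

Let rho2_ge0 : 0 <= rho2.
Proof. by rewrite mulr_ge0 ?sqr_ge0 // addr_ge0 ?mulr_ge0. Qed.

Let energy_step (n : int) : n + 1 < p.1 -> energy n <= rho2 * energy (n + 1).
Proof.
move=> np; apply: le_trans (energy_le n) _; rewrite /energy mulr_sumr.
apply: ler_sum => y _; case: (leP y.1 (n + 1)) => yn; last by rewrite !mul0r mulr0.
rewrite !mul1r.
apply: out_step; first by apply: ltW; exact: le_lt_trans yn np.
by apply/eqP => yp; move: yn; rewrite yp leNgt np.
Qed.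

(** All columns being counted, the total energy is at most the contribution of the source plus
    [rho2] times itself; solve for it. *)
Let energy_total : energy p.1 <= 4 * t ^+ 2 * corr p ^+ 2 / (1 - rho2).
Proof.
rewrite ler_pdivlMr ?subr_gt0 // mulrBr mulr1 lerBlDr [_ * rho2]mulrC.
apply: le_trans (energy_le _) _; rewrite /energy mulr_sumr.
rewrite [leLHS](_ : _ = \sum_(y <- V) out y); last first.
  rewrite !big_seq; apply: eq_bigr => y /V_range[_ yp].
  have -> : (y.1 <= p.1 + 1)%R by apply: le_trans yp _; rewrite lerDl.
  by rewrite mul1r.
rewrite (bigID (fun y => y == p)) /=.
apply: lerD.
  have pos : 0 <= 4 * t ^+ 2 * corr p ^+ 2 by rewrite mulr_ge0 ?sqr_ge0 // mulr_ge0 ?sqr_ge0.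
  case pV: (p \in V); last first.
    rewrite big1_seq // => y /andP[/eqP-> pV'].
    by have := pV' : p \in V; rewrite pV.
  by rewrite -big_filter filter_pred1_uniq ?fset_uniq // big_seq1 out_source.
rewrite big_mkcond /= [leLHS]big_seq [leRHS]big_seq; apply: ler_sum => y /V_range[_ yp].
rewrite yp mul1r; case: ifP => yNp; last by rewrite mulr_ge0.
exact: out_step.
Qed.

Let energy_decay (k : nat) : energy (p.1 - 1 - k%:Z) <=
  rho2 ^+ k * (4 * t ^+ 2 * corr p ^+ 2 / (1 - rho2)).
Proof.
elim: k => [|k IH].
  rewrite mul1r; apply: le_trans energy_total; apply: ler_sum => x _.
  rewrite ler_wpM2r ?bb_ge0 // ler_nat.
  by case: (leP x.1 p.1) => //=; case: leP => //=; lia.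
rewrite exprS -mulrA; apply: le_trans (energy_step _) _; first by lia.
by rewrite ler_wpM2l // (_ : _ + 1 = p.1 - 1 - k%:Z) //; lia.
Qed.

Theorem corr_decay (k : nat) : p.1 = q.1 + 1 + k%:Z ->
  corr q ^+ 2 <= 12 * t ^+ 2 / (1 - rho2) * rho2 ^+ k * corr p ^+ 2.
Proof.
move=> pqk; have qNp : q != p by rewrite siteE; lia.
have -> : corr q = aW q.
  apply: eq_psum => E /fsubsetP EX; rewrite /sg row_parity_left ?expr0 ?mulr1; last first.
    by move=> b /EX/X_range[].
  have -> : west_in E q = false.
    by apply/negbTE/negP => /EX/X_range[]; rewrite /dual_fst /=; lia.
  by rewrite eqxx mul1r.
have [-> _ _ _] := fermion_linear (ltW qp) qNp.
apply: (@le_trans _ _ (3 * bb q)).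
  have := sqr_ge0 (bN q - bE q); have := sqr_ge0 (bN q - bS q).
  have := sqr_ge0 (bE q - bS q); have := sqr_ge0 (bW q).
  rewrite /bb; move: (bN q) (bE q) (bS q) (bW q) => n e s w; nra.
have bbq : bb q <= energy q.1.
  case qV: (q \in V); last first.
    have nX e : (dual_fst e == q) || (dual_snd e == q) -> e \notin X.
      by apply: contraL => /in_V[h1 h2]; apply/negP => /orP[] /eqP E; rewrite ?E in h1 h2;
         rewrite ?h1 ?h2 in qV.
    have sub E b : E `<=` X -> (dual_fst b == q) || (dual_snd b == q) -> b \in E = false.
      by move=> /fsubsetP EX /nX bX; apply/negbTE; apply: contra bX => /EX.
    rewrite /bb /bN /bE /bS /bW !fermion_supp ?expr0n /= ?addr0.
    - by rewrite sumr_ge0 // => x _; rewrite mulr_ge0.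
    - by move=> E EX; rewrite /west_in sub // /dual_snd eqxx orbT.
    - by move=> E EX; rewrite /south_in sub // /dual_snd eqxx orbT.
    - by move=> E EX; rewrite /east_in sub // /dual_fst /= addrK -surjective_pairing eqxx.
    - by move=> E EX; rewrite /north_in sub // /dual_fst /= addrK -surjective_pairing eqxx.
  rewrite /energy (bigD1_seq q) ?fset_uniq //= lexx mul1r lerDl sumr_ge0 // => x _.
  by rewrite mulr_ge0.
have := energy_decay k; rewrite pqk (_ : _ - 1 - _ = q.1); last by lia.
move=> /(le_trans bbq) bbq'.
apply: le_trans (_ : 3 * (rho2 ^+ k * (4 * t ^+ 2 * corr p ^+ 2 / (1 - rho2))) <= _).
  by rewrite ler_wpM2l.
by rewrite le_eqVlt; apply/orP; left; apply/eqP; ring.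
Qed.

End Fermion.

(** * Minus sets and their weights *)

Lemma in_fsetsep (K : choiceType) (A : {fset K}) (P : pred K) x :
  (x \in [fset y in A | P y]) = (x \in A) && P x.
Proof. by rewrite !inE. Qed.

Section Lattice.
Implicit Types (A B D S X : {fset site}) (x y : site) (b : bond).

Definition nnadj x y : bool := `|x.1 - y.1| + `|x.2 - y.2| == 1 :> int.
(** Where four disagreement bonds meet, the rounded arcs cut off the south-east and north-west
    sites; the two other sites, which differ by (1, 1), remain connected. *)
Definition tadj x y : bool :=
  nnadj x y || ((y.1 - x.1 == y.2 - x.2) && (`|y.1 - x.1| == 1 :> int)).

Definition rect (x0 x1 y0 y1 : int) : {fset site} :=
  [fset ((x0 + i%:Z, y0 + j%:Z) : site) | i in iota 0 (absz (Num.max 0 (x1 - x0 + 1))),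
     j in iota 0 (absz (Num.max 0 (y1 - y0 + 1)))].

Lemma in_rect (x0 x1 y0 y1 : int) x :
  (x \in rect x0 x1 y0 y1) = [&& x0 <= x.1, x.1 <= x1, y0 <= x.2 & x.2 <= y1].
Proof.
apply/imfset2P/and4P => [[i /= ilt [j /= jlt ->]]|[h1 h2 h3 h4]] /=.
  by move: ilt jlt; rewrite !mem_iota; split; lia.
exists (absz (x.1 - x0)); first by rewrite /= mem_iota; lia.
exists (absz (x.2 - y0)); first by rewrite /= mem_iota; lia.
by apply/eqP; rewrite siteE /=; lia.
Qed.

Definition touching D : {fset bond} :=
  [fset (x, true) | x in D] `|` [fset (x, false) | x in D] `|`
  ([fset ((x.1 - 1, x.2), true) | x in D] `|` [fset ((x.1, x.2 - 1), false) | x in D]).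

Lemma touchingE b D : (b \in touching D) = (bond_fst b \in D) || (bond_snd b \in D).
Proof.
rewrite !inE; apply/orP/orP.
  case=> /orP[] /imfsetP[x /= xD ->]; rewrite /bond_fst /bond_snd /= ?subrK -?surjective_pairing;
  by [left|right].
case: b => [[i j] []]; rewrite /bond_fst /bond_snd /= => -[] bD.
- by left; apply/orP; left; apply/imfsetP; exists (i, j).
- by right; apply/orP; left; apply/imfsetP; exists (i + 1, j); rewrite //= addrK.
- by left; apply/orP; right; apply/imfsetP; exists (i, j).
- by right; apply/orP; right; apply/imfsetP; exists (i, j + 1); rewrite //= addrK.
Qed.

Lemma nnadj_bond b : nnadj (bond_fst b) (bond_snd b).
Proof. by case: b => [[i j] []]; rewrite /nnadj /bond_fst /bond_snd /=; lia. Qed.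

Lemma nnadj_sym x y : nnadj x y = nnadj y x.
Proof. rewrite /nnadj; lia. Qed.

Lemma tadj_sym x y : tadj x y = tadj y x.
Proof. rewrite /tadj /nnadj; lia. Qed.

Definition differ A b : bool := (bond_fst b \in A) != (bond_snd b \in A).

Definition dis (r : seq bond) A : nat := disagreements bond_fst bond_snd r A.

Lemma dis_filter (P : pred bond) r A :
  dis r A = (dis (seq.filter P r) A + dis (seq.filter (predC P) r) A)%N.
Proof. by rewrite /dis /disagreements !big_filter (bigID P). Qed.

Lemma eq_dis r A B : (forall b, b \in r -> differ A b = differ B b) -> dis r A = dis r B.
Proof.
move=> AB; rewrite /dis /disagreements big_seq [RHS]big_seq; apply: eq_bigr => b /AB.
by rewrite /differ => ->.
Qed.

Lemma dis_card (X : {fset bond}) A : dis X A = #|` [fset b in X | differ A b]|.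
Proof.
have -> : #|` [fset b in X | differ A b]| = size (seq.filter (differ A) X).
  apply: perm_size; apply: uniq_perm; rewrite ?fset_uniq ?filter_uniq ?fset_uniq //.
  by move=> b; rewrite !inE /= mem_filter andbC.
rewrite size_filter -sum1_count big_mkcond /=; apply: eq_bigr => b _.
by rewrite /differ; case: (_ != _).
Qed.

Section Weight.
Variables (R : realFieldType) (t : R).

(** A bond that does not touch [A] is not a disagreement, so the weight does not depend on the
    volume. *)
Definition wt A : R := t ^+ dis (touching A) A.

Lemma wt_dis A (X : {fset bond}) : touching A `<=` X -> wt A = t ^+ dis X A.
Proof.
move=> /fsubsetP AX; rewrite /wt !dis_card; congr (_ ^+ #|` _|); apply/fsetP => b.
rewrite !in_fsetsep; case db: (differ A b); rewrite ?andbF // !andbT; apply/idP/idP; first exact: AX.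
move=> _; rewrite touchingE; move: db; rewrite /differ.
by case: (_ \in A) (_ \in A) => [] [].
Qed.

Lemma touchingS A B : A `<=` B -> touching A `<=` touching B.
Proof. by move=> /fsubsetP AB; apply/fsubsetP => b; rewrite !touchingE => /orP[] /AB ->; rewrite ?orbT. Qed.

Lemma wt_union A B :
  (forall x y, x \in A -> y \in B -> (x != y) && ~~ nnadj x y) ->
  wt (A `|` B) = wt A * wt B.
Proof.
move=> sep; rewrite (@wt_dis A (touching (A `|` B))) ?touchingS ?fsubsetUl //.
rewrite (@wt_dis B (touching (A `|` B))) ?touchingS ?fsubsetUr // /wt -exprD; congr (_ ^+ _).
rewrite /dis /disagreements -big_split /=; apply: eq_bigr => b _; rewrite !inE.
have nb := nnadj_bond b; have nb' := nb; rewrite nnadj_sym in nb'.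
case a1: (bond_fst b \in A); case a2: (bond_snd b \in A);
case b1: (bond_fst b \in B); case b2: (bond_snd b \in B) => //=.
all: try by have := sep _ _ a1 b1; rewrite eqxx.
all: try by have := sep _ _ a2 b2; rewrite eqxx.
all: try by have := sep _ _ a1 b2; rewrite nb andbF.
all: by have := sep _ _ a2 b1; rewrite nb' andbF.
Qed.

Hypothesis t01 : 0 < t <= 1.

Lemma wt_gt0 A : 0 < wt A.
Proof. by rewrite exprn_gt0 //; case/andP: t01. Qed.

(** Submodularity of the number of boundary bonds, checked bond by bond. *)
Lemma wt_lattice A B : wt A * wt B <= wt (A `|` B) * wt (A `&` B).
Proof.
have AU := touchingS (fsubsetUl A B); have BU := touchingS (fsubsetUr A B).
have IU : touching (A `&` B) `<=` touching (A `|` B).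
  by apply: touchingS; apply: fsubset_trans (fsubsetIl A B) (fsubsetUl A B).
rewrite (wt_dis AU) (wt_dis BU) (wt_dis IU) /wt -!exprD.
case/andP: t01 => t0 t1; apply: ler_wiXn2l => //; first exact: ltW.
rewrite /dis /disagreements -!big_split /=; apply: leq_sum => b _; rewrite !inE.
by case: (_ \in A) (_ \in A) (_ \in B) (_ \in B) => [] [] [] [].
Qed.

Definition Z D : R := psum D wt.

Lemma Z_gt0 D : 0 < Z D.
Proof. by apply: psum_gt0 => A _; exact: wt_gt0. Qed.

(** The plus state on [D] is the plus state on [S] conditioned on the decreasing event that the
    minus set is included in [D]; apply FKG to minus its indicator. *)
Lemma expectation_mono D S (F : {fset site} -> R) : D `<=` S ->
  (forall A B, A `<=` B -> B `<=` S -> F A <= F B) ->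
  psum D (fun A => F A * wt A) * Z S <= psum S (fun A => F A * wt A) * Z D.
Proof.
move=> DS Fm.
have := @fkg _ _ S wt F (fun A => - (A `<=` D)%:R) _ _ Fm _.
have e1 : psum S (fun A => - (A `<=` D)%:R * wt A) = - Z D.
  by rewrite /Z (psum_subset wt DS) /psum -sumrN; apply: eq_bigr => A _; rewrite mulNr.
have e2 : psum S (fun A => F A * - (A `<=` D)%:R * wt A) = - psum D (fun A => F A * wt A).
  by rewrite (psum_subset _ DS) /psum -sumrN; apply: eq_bigr => A _; ring.
rewrite e1 e2 mulrN mulNr lerN2; apply.
- by move=> A _; exact: wt_gt0.
- by move=> A B _ _; exact: wt_lattice.
- move=> A B AB _; rewrite lerN2 ler_nat; case BD: (B `<=` D) => //.
  by rewrite (fsubset_trans AB BD).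
Qed.

(* Revealing from outside the clusters of [al `|` xi] that meet [xi] leaves a domain
   with plus boundary condition, included in [B]. *)
Lemma explored_le B xi (F : {fset site} -> R) : [disjoint B & xi] ->
  (forall A, 0 <= F A) -> (forall A D, A `<=` D -> D `<=` B -> F A <= F D) ->
  psum B (fun al => F (al `\` explored tadj xi al) * wt (al `|` xi)) * Z B <=
  psum B (fun A => F A * wt A) * psum B (fun al => wt (al `|` xi)).
Proof.
move=> dB F0 Fm.
rewrite (psum_explore tadj (fun al => F (al `\` explored tadj xi al) * wt (al `|` xi)) dB).
rewrite (psum_explore tadj (fun al => wt (al `|` xi)) dB).
rewrite -psumZr -psumZ; apply: ler_psum => U UB.
case: eqP => UU; last by rewrite !mul0r mulr0.
rewrite !mul1r; set D := unexplored tadj B xi U.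
have fac I : I `<=` D -> wt (U `|` I `|` xi) = wt (U `|` xi) * wt I.
  move=> /fsubsetP ID; rewrite fsetUAC wt_union // => x y xU /ID/unexploredP[yB yU ysep].
  have := ysep _ xU; rewrite /tadj negb_or => /andP[-> _]; rewrite andbT.
  apply/eqP => xy; move: xU; rewrite xy inE (negPf yU) /=.
  by move/fdisjointP: dB => /(_ _ yB) /negPf ->.
rewrite (@eq_psum _ _ D _ (fun I => wt (U `|` xi) * (F I * wt I))); last first.
  move=> I ID; rewrite fac // (explored_union dB UU ID) mulrCA; congr (_ * (F _ * _)).
  apply/fsetP => x; rewrite !inE; case xU: (x \in U) => //=.
  by apply/esym/negbTE/negP => /(fsubsetP ID)/unexploredP[]; rewrite xU.
rewrite [X in _ <= _ * X](@eq_psum _ _ D _ (fun I => wt (U `|` xi) * wt I)); last exact: fac.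
rewrite !psumZ -mulrA [leRHS]mulrCA; apply: ler_wpM2l; first by rewrite ltW ?wt_gt0.
by apply: (@expectation_mono D B F) => //; exact: unexplored_sub.
Qed.

End Weight.
End Lattice.

(** * Minus clusters crossing a rectangle *)

Lemma reach_path (K : choiceType) (e : rel K) (A : {fset K}) a b :
  reach e A [fset a] b -> exists s, [/\ path e a s, last a s = b & {subset s <= A}].
Proof.
elim=> {b} [b|x y _ [s [ps ls sA]] exy yA].
  by rewrite inE => /eqP->; exists [::].
exists (rcons s y); rewrite rcons_path ps ls last_rcons; split => // z.
by rewrite mem_rcons inE => /orP[/eqP->|/sA].
Qed.

(** * A discrete Jordan argument by parity of crossings *)

Section Crossing.
Implicit Types (u v x y z : site) (s : seq site).

(* Whether the step from [u] to [v] crosses the vertical half-line above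
   [x + (1/2, 0)]. *)
Definition crosses x u v : bool :=
  ((u.1 == x.1) && (v.1 == x.1 + 1) && (x.2 < u.2)) ||
  ((v.1 == x.1) && (u.1 == x.1 + 1) && (x.2 < v.2)).

Lemma tadj_cases u v : tadj u v -> exists2 d : site,
  d \in [:: (1, 0); (-1, 0); (0, 1); (0, -1); (1, 1); (-1, -1)] &
  v = (u.1 + d.1, u.2 + d.2).
Proof.
rewrite /tadj /nnadj => uv; exists (v.1 - u.1, v.2 - u.2); last first.
  by apply/eqP; rewrite siteE /=; lia.
by rewrite !inE !siteE /=; lia.
Qed.

Fixpoint crossings x u s : bool :=
  if s is v :: s' then crosses x u v (+) crossings x v s' else false.

Lemma crossings_up x u s : path tadj u s -> (x.1, x.2 + 1) \notin u :: s ->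
  crossings (x.1, x.2 + 1) u s = crossings x u s.
Proof.
elim: s u => [//|v s IH] u /= /andP[uv vs]; rewrite inE negb_or => /andP[ux vx].
rewrite IH //; congr (_ (+) _); move: vx; rewrite inE negb_or => /andP[vx _].
by move: uv ux vx; rewrite /tadj /nnadj !siteE /crosses /=; lia.
Qed.

(** For one step, the two crossing indicators differ exactly when the step enters or leaves the
    column [x.1 + 1] above [x]; along the path this telescopes to its ends. *)
Lemma crossings_right x u s (f := fun z : site => (z.1 == x.1 + 1) && (x.2 < z.2)) :
  path tadj u s -> x \notin u :: s -> (x.1 + 1, x.2) \notin u :: s ->
  crossings x u s (+) crossings (x.1 + 1, x.2) u s = f u (+) f (last u s).
Proof.
elim: s u => [|v s IH] u /=; first by rewrite addbb.
move=> /andP[uv vs]; rewrite in_cons negb_or => /andP[ux xs].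
rewrite in_cons negb_or => /andP[ux' xs'].
have := IH v vs xs xs'.
have : crosses x u v (+) crosses (x.1 + 1, x.2) u v = f u (+) f v.
{ move: xs xs'; rewrite !inE !negb_or => /andP[vx _] /andP[vx' _].
  case/tadj_cases: uv ux vx ux' vx' => d dd ->; rewrite /f !siteE /crosses /= => {IH vs f}.
  case: u x => [u1 u2] [x1 x2] /=.
  move: dd; rewrite !inE => /or4P[/eqP->|/eqP->|/eqP->|/or3P[/eqP->|/eqP->|/eqP->]] /=.
  all: case: (u1 =P x1) => h1; case: (u1 =P x1 + 1) => h2; try (exfalso; lia).
  all: rewrite ?h1 ?h2 /= ?(addrK, addr0, subrK) ?eqxx /=.
  all: lia. }
by do 2!case: (crosses _ _ _); do 2!case: (crossings _ _ _); do 3!case: (f _).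
Qed.

Lemma crossings_below x u s : (forall z, z \in u :: s -> z.1 = x.1 -> z.2 <= x.2) ->
  crossings x u s = false.
Proof.
elim: s u => [//|v s IH] u below /=; rewrite IH ?addbF => [|z zs]; last first.
  by apply: below; rewrite inE zs orbT.
have := below u (mem_head _ _); have := below v; rewrite !inE eqxx orbT => /(_ isT).
by rewrite /crosses; lia.
Qed.

Lemma crossings_right_of x u s : (forall z, z \in u :: s -> z.1 <= x.1) ->
  crossings x u s = false.
Proof.
elim: s u => [//|v s IH] u left /=; rewrite IH ?addbF => [|z zs]; last first.
  by apply: left; rewrite inE zs orbT.
have := left u (mem_head _ _); have := left v; rewrite !inE eqxx orbT => /(_ isT).
by rewrite /crosses; lia.
Qed.

End Crossing.

Section Blocking.
Variables (i0 i1 y0 y1 ay bY : int).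
Hypotheses (ay_ge : y0 <= ay) (ay_le : ay <= y1) (by_ge : y0 <= bY) (by_le : bY <= y1).
Hypothesis i01 : i0 <= i1.
Let S := rect i0 i1 y0 y1.

(** The part of the surrounding ring that is minus under the Dobrushin condition: the interface
    starts between the heights [ay] and [ay + 1] on the left and ends between [bY] and [bY + 1] on
    the right. *)
Definition top_arc : {fset site} :=
  [fset x in rect (i0 - 1) (i1 + 1) (y0 - 1) (y1 + 1) |
    (x \notin S) && [|| y1 < x.2, (x.1 < i0) && (ay < x.2) | (i1 < x.1) && (bY < x.2)]].

Lemma in_top_arc x : (x \in top_arc) = [&& x \in rect (i0 - 1) (i1 + 1) (y0 - 1) (y1 + 1),
  x \notin S & [|| y1 < x.2, (x.1 < i0) && (ay < x.2) | (i1 < x.1) && (bY < x.2)]].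
Proof. by rewrite in_fsetsep. Qed.

(** Extend the crossing by one site on either side and let [P] be its crossing parity. A
    nearest-neighbour path cannot traverse a triangular one, so [P] is constant along the
    exploration of [U]; it is false next to the top arc and true next to the rest of the ring. *)
Lemma blocking (A U : {fset site}) : A `<=` S -> U `<=` S -> [disjoint A & U] ->
  explored nnadj top_arc U = U ->
  (i0, ay) \in A -> reach tadj A [fset (i0, ay)] (i1, bY) ->
  forall x y, x \in U -> y \notin S -> nnadj x y -> y \in top_arc.
Proof.
move=> /fsubsetP AS /fsubsetP US /fdisjointP dAU UU aA /reach_path[s [ps ls sA]].
pose a' : site := (i0 - 1, ay); pose b' : site := (i1 + 1, bY).
pose s' := rcons ((i0, ay) :: s) b'.
have ps' : path tadj a' s'.
  rewrite /s' rcons_path last_cons ls /= ps.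
  by rewrite /tadj /nnadj /=; apply/andP; split; [apply/andP; split|]; lia.
have lasts' : last a' s' = b' by rewrite last_rcons.
have memS z : z \in a' :: s' -> [\/ z = a', z = b' | z \in A].
  rewrite inE mem_rcons !inE => /or4P[/eqP->|/eqP->|/eqP->|/sA zA];
  by [constructor 1|constructor 2|constructor 3].
have colS z : z \in A -> [/\ i0 <= z.1, z.1 <= i1, y0 <= z.2 & z.2 <= y1].
  by move/AS; rewrite in_rect => /and4P.
pose P x := crossings x a' s'.
have notin x : x \notin A -> x != a' -> x != b' -> x \notin a' :: s'.
  by move=> xA xa xb; apply/negP => /memS[] E; move: xA xa xb; rewrite E ?eqxx.
have right x : i0 - 1 <= x.1 -> x.1 < i1 ->
    x \notin a' :: s' -> (x.1 + 1, x.2) \notin a' :: s' -> P (x.1 + 1, x.2) = P x.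
  move=> x1 x2 h1 h2; have := crossings_right ps' h1 h2; rewrite lasts' => E.
  have {E} : P x (+) P (x.1 + 1, x.2) =
    (i0 - 1 == x.1 + 1) && (x.2 < ay) (+) (i1 + 1 == x.1 + 1) && (x.2 < bY) := E.
  have -> : (i0 - 1 == x.1 + 1) && (x.2 < ay) = false by clear -x1; lia.
  have -> : (i1 + 1 == x.1 + 1) && (x.2 < bY) = false by clear -x2; lia.
  by case: (P x); case: (P _).
have right_end y : (i1, y) \notin a' :: s' -> (i1 + 1, y) \notin a' :: s' ->
    P (i1, y) (+) P (i1 + 1, y) = (y < bY).
  move=> h1 h2; have := crossings_right ps' h1 h2; rewrite lasts' => E.
  have {E} -> : P (i1, y) (+) P (i1 + 1, y) =
    (i0 - 1 == i1 + 1) && (y < ay) (+) (i1 + 1 == i1 + 1) && (y < bY) := E.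
  have -> : (i0 - 1 == i1 + 1) && (y < ay) = false by clear -i01; lia.
  by rewrite eqxx.
have up x : (x.1, x.2 + 1) \notin a' :: s' -> P (x.1, x.2 + 1) = P x.
  by move=> h; rewrite /P crossings_up.
have UA x : x \in U -> x \notin A by move=> xU; apply/negP => /dAU; rewrite xU.
have Uout x : x \in U -> x \notin a' :: s'.
  move=> xU; apply: notin; first exact: UA.
    by have := US _ xU; rewrite in_rect siteE /=; lia.
  by have := US _ xU; rewrite in_rect siteE /=; lia.
have colU x : x \in U -> [/\ i0 <= x.1, x.1 <= i1, y0 <= x.2 & x.2 <= y1].
  by move/US; rewrite in_rect => /and4P.
have Uends x : x \in U -> x != (i0, ay) /\ x != (i1, bY).
  move=> xU; split; apply/eqP => E; have := UA _ xU; rewrite E ?aA //.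
  have : last (i0, ay) s \in (i0, ay) :: s by exact: mem_last.
  by rewrite ls inE => /orP[/eqP->|/sA ->] //; rewrite aA.
have Pleft y : (i0, y) \in U -> P (i0, y) = (y < ay).
  move=> yU; have [] := Uends _ yU; rewrite siteE /= eqxx /= => ya _.
  have h1 : (i0 - 1, y) \notin a' :: s'.
    apply: notin; rewrite ?siteE /=; try lia.
    by apply/negP => /colS[] /=; lia.
  have -> : P (i0, y) = P (i0 - 1, y).
    rewrite -(right (i0 - 1, y)) /= ?subrK //; last exact: Uout.
    by clear -i01; lia.
  rewrite /P /s' /= {1}/crosses /= subrK !eqxx /=.
  have -> : ((i0 == i0 - 1) && (i0 - 1 == i0) && (y < ay)) = false by lia.
  rewrite orbF crossings_below ?addbF // => z zs /= z1.
  have : z \in a' :: s' by rewrite inE zs orbT.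
  case/memS=> [E|E|/colS[]]; rewrite ?E /= in z1 *; try lia.
  move: zs; rewrite E -rcons_cons mem_rcons inE => /orP[/eqP[]|]; first by lia.
  rewrite inE => /orP[/eqP[]|/sA/colS[] /=]; lia.
have Pright y : (i1, y) \in U -> P (i1, y) = (y < bY).
  move=> yU; have [_] := Uends _ yU; rewrite siteE /= eqxx /= => yb.
  have h1 : (i1 + 1, y) \notin a' :: s'.
    apply: notin; rewrite ?siteE /=; try lia.
    by apply/negP => /colS[] /=; lia.
  have <- := right_end y (Uout _ yU) h1; suff -> : P (i1 + 1, y) = false by rewrite addbF.
  apply: crossings_right_of => z /memS[->|->|/colS[]] /=; clear -i01; lia.
have Ptop x : x \in U -> x.2 = y1 -> P x = false.
  move=> xU x2; apply: crossings_below; rewrite x2 => z.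
  by case/memS=> [->|->|/colS[]] //= *; clear -ay_le by_le; lia.
have Pbot x : x \in U -> x.2 = y0 -> P x = true.
  move=> xU x2; have [h1 h2 _ _] := colU _ xU.
  have low k : (k, y0 - 1) \notin a' :: s'.
    by apply: notin; rewrite ?siteE /=; try lia; apply/negP => /colS[] /=; lia.
  have -> : x = ((x.1, y0 - 1).1, (x.1, y0 - 1).2 + 1).
    by apply/eqP; rewrite siteE /= x2 subrK !eqxx.
  rewrite up /=; last by rewrite subrK -x2 -surjective_pairing Uout.
  have -> : x.1 = i0 - 1 + (absz (x.1 - i0 + 1))%:Z by lia.
  have : (absz (x.1 - i0 + 1))%:Z <= i1 - i0 + 1 by lia.
  elim: (absz _) => [|n IH] nle.
    rewrite addr0 /P /s' /= {1}/crosses /= subrK !eqxx /=.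
    have -> : ((i0 == i0 - 1) && (i0 - 1 == i0) && (y0 - 1 < ay)) = false by lia.
    have -> : (y0 - 1 < ay) = true by lia.
    rewrite orbF crossings_below // => z zs /= z1.
    have : z \in a' :: s' by rewrite inE zs orbT.
    case/memS=> [E|E|/colS[]]; rewrite ?E /= in z1 *; try lia.
    move: zs; rewrite E -rcons_cons mem_rcons inE => /orP[/eqP[]|]; first by lia.
    rewrite inE => /orP[/eqP[]|/sA/colS[] /=]; lia.
  have -> : i0 - 1 + n.+1%:Z = i0 - 1 + n%:Z + 1 by clear; lia.
  rewrite (right (i0 - 1 + n%:Z, y0 - 1)) ?low //= ?IH //; clear -nle i01; lia.
have Pfalse x : x \in U -> P x = false.
  move=> xU; have : x \in explored nnadj top_arc U by rewrite UU.
  case/exploredP=> _ rx.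
  have : x \notin top_arc -> P x = false.
    elim: rx {xU} => {x} [x -> //|x y rx IH xy yU] _.
    have := reach_in rx; rewrite inE => /orP[xU|xQ].
      rewrite -IH; last first.
        by rewrite in_top_arc (US _ xU) andbF.
      have [x1 x2] : x.1 = x.1 /\ x.2 = x.2 by [].
      have := Uout _ xU; have := Uout _ yU; have := colU _ yU; have := colU _ xU; move: xy.
      clear IH rx xU yU.
      case: x y {x1 x2} => [x1 x2] [z1 z2]; rewrite /nnadj /= => xz [? ? ? ?] [? ? ? ?].
      have : [\/ z1 = x1 + 1 /\ z2 = x2, x1 = z1 + 1 /\ z2 = x2,
        z1 = x1 /\ z2 = x2 + 1 | z1 = x1 /\ x2 = z2 + 1].
        have : [|| (z1 == x1 + 1) && (z2 == x2), (x1 == z1 + 1) && (z2 == x2),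
           (z1 == x1) && (z2 == x2 + 1) | (z1 == x1) && (x2 == z2 + 1)] by lia.
        by case/or4P=> /andP[/eqP-> /eqP->]; [constructor 1|constructor 2|constructor 3|constructor 4].
      case=> [[? ?]|[? ?]|[? ?]|[? ?]]; subst => h1 h2.
      - by apply: (right (x1, x2)) => //=; lia.
      - by symmetry; apply: (right (z1, x2)) => //=; lia.
      - exact: (up (x1, x2)).
      - by symmetry; exact: (up (x1, z2)).
    move: xQ xy; rewrite in_top_arc !in_rect => /and3P[xr xS xt] xy.
    have [y1' y2' y3' y4'] := colU _ yU.
    have : [|| y.2 == y1, (y.1 == i0) && (ay < y.2) | (y.1 == i1) && (bY < y.2)].
      move: xr xS xt xy y1' y2' y3' y4'; rewrite /nnadj; case: x y {rx IH yU} => [? ?] [? ?] /=; lia.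
    case/or3P=> [/eqP|/andP[/eqP E lt]|/andP[/eqP E lt]]; first exact: Ptop.
      by rewrite (surjective_pairing y) E Pleft -?E -?surjective_pairing //; lia.
    by rewrite (surjective_pairing y) E Pright -?E -?surjective_pairing //; lia.
  by apply; rewrite in_top_arc (US _ xU) andbF.
move=> x y xU yS xy; apply/negPn/negP => yQ.
have : P x = true; last by rewrite Pfalse.
have [x1 x2 x3 x4] := colU _ xU; have [] := Uends _ xU; rewrite !siteE /= => xa xb.
have : [|| x.2 == y0, (x.1 == i0) && (x.2 < ay) | (x.1 == i1) && (x.2 < bY)].
  move: yQ yS xy; rewrite in_top_arc !in_rect /nnadj.
  by move: x1 x2 x3 x4 xa xb; case: x y {xU} => [? ?] [? ?] /=; lia.
case/or3P=> [/eqP|/andP[/eqP E lt]|/andP[/eqP E lt]]; first exact: Pbot.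
  by rewrite (surjective_pairing x) E Pleft -?E -?surjective_pairing //; lia.
by rewrite (surjective_pairing x) E Pright -?E -?surjective_pairing //; lia.
Qed.

End Blocking.

Section EvenSets.
Implicit Types (E : {fset bond}).

Lemma row_parity_differ E (x : int) (y : int) :
  (forall v, ~~ odd_degree E v) ->
  (row_parity E x (y + 1) != row_parity E x y) = (((x, y), false) \in E).
Proof.
move=> ev; rewrite -(@row_parity_vert E x y) //.
by case: (row_parity _ _ _) (row_parity _ _ _) => [] [].
Qed.

Lemma color_differ E (D : {fset site}) b : (forall v, ~~ odd_degree E v) ->
  (forall x, (x \in D) = row_parity E x.1 x.2) -> differ D b = (b \in E).
Proof.
move=> ev DE; rewrite /differ !DE; case: b => [[i j] []]; rewrite /bond_fst /bond_snd /=.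
  by rewrite row_parity_succ; case: (row_parity _ _ _) (_ \in E) => [] [].
by rewrite -row_parity_differ // eq_sym.
Qed.

End EvenSets.

(** * Contour expansions for the plus and the Dobrushin boundary conditions *)

Section Rectangle.
Variables (R : realFieldType) (t : R).
Hypothesis t01 : 0 < t <= 1.
Variables (i0 i1 y0 y1 ay bY : int).
Hypotheses (ay_ge : y0 <= ay) (ay_le : ay <= y1) (by_ge : y0 <= bY) (by_le : bY <= y1).
Hypothesis i01 : i0 <= i1.
Let S := rect i0 i1 y0 y1.
Let X := touching S.
Let p : site := (i1, bY).
Let q : site := (i0 - 1, ay).
Let Q := top_arc i0 i1 y0 y1 ay bY.

Let in_X b : (b \in X) = if b.2 then [&& i0 - 1 <= b.1.1, b.1.1 <= i1, y0 <= b.1.2 & b.1.2 <= y1]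
  else [&& i0 <= b.1.1, b.1.1 <= i1, y0 - 1 <= b.1.2 & b.1.2 <= y1].
Proof.
rewrite /X touchingE /bond_fst /bond_snd /S !in_rect.
by case: b => [[i j] []] /=; lia.
Qed.

(** An even subgraph is the boundary of the set of sites of odd row parity, and this set stays in
    [S] because every bond of [X] touches [S]. *)
Lemma even_le : corr t X p p <= psum S (fun A => t ^+ dis X A).
Proof.
have t0 : 0 <= t by case/andP: t01 => /ltW.
apply: (@psum_inj_le _ _ _ X S (fun E => [fset x in S | row_parity E x.1 x.2])
  (fun A => [fset b in X | differ A b])) => [A _|E /fsubsetP EX /has_boundaryP bd].
  by rewrite exprn_ge0.
have ev v : ~~ odd_degree E v by rewrite bd addbb.
set D := [fset x in S | _].
have DE (x : site) : (x \in D) = row_parity E x.1 x.2.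
  rewrite in_fsetsep /S in_rect; case rp: row_parity; rewrite ?andbF // andbT.
  apply/negPn/negP => xS; move: rp; apply/negP.
  have outrow (x1 y : int) : (y < y0) || (y1 < y) -> row_parity E x1 y = false.
    by move=> yo; apply: row_parity_left => -[[i j] []] // /EX; rewrite in_X /= => ij _ jy; lia.
  have [/outrow->//|yin] := boolP ((x.2 < y0) || (y1 < x.2)).
  have [xl|xl] := ltP x.1 i0.
    by rewrite row_parity_left // => -[[i j] []] // /EX; rewrite in_X /= => ij _ jy; lia.
  have xr : i1 < x.1 by move: xS yin; lia.
  have step (y : int) : row_parity E x.1 (y + 1) = row_parity E x.1 y.
    have := @row_parity_differ E x.1 y ev.
    rewrite (_ : (_ \in E) = false) => [/negbFE/eqP//|].
    by apply/negbTE/negP => /EX; rewrite in_X /=; lia.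
  have gen (n : nat) : row_parity E x.1 (y1 + 1 - n%:Z) = false.
    elim: n => [|n IH]; first by rewrite subr0 outrow //; lia.
    by rewrite -step (_ : _ + 1 = y1 + 1 - n%:Z) //; lia.
  have := gen (absz (y1 + 1 - x.2)%R); rewrite (_ : _ - _ = x.2) => [->//|].
  by move: yin; lia.
have dE b : differ D b = (b \in E) by exact: color_differ.
have XE : [fset b in X | differ D b] = E.
  by apply/fsetP => b; rewrite in_fsetsep dE; case bE: (b \in E); rewrite ?andbF ?EX.
split => //; first by apply/fsubsetP => x; rewrite in_fsetsep => /andP[].
by rewrite dis_card XE.
Qed.

(** Bonds between two sites of the ring are not in [X], so the disagreement bonds have odd degree
    exactly where the ring changes sign, at [p] and [q]. Row parity recovers [A] after correction by
    the boundary spin at the left end of the row. *)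
Lemma dobrushin_le : psum S (fun A => t ^+ dis X (A `|` Q)) <= corr t X p q.
Proof.
have t0 : 0 <= t by case/andP: t01 => /ltW.
rewrite [leLHS](@eq_psum _ _ S _ (fun A => (true)%:R * t ^+ dis X (A `|` Q))); last first.
  by move=> A _; rewrite mul1r.
apply: (@psum_inj_le _ _ _ S X (fun A => [fset b in X | differ (A `|` Q) b])
  (fun E => [fset x in S | row_parity E x.1 x.2 (+) (ay < x.2)]) xpredT) => [E _|A AS _].
  by rewrite mulr_ge0 ?exprn_ge0.
have inAQ (x : site) : x \notin S -> (x \in A `|` Q) = (x \in Q).
  by move=> xS; rewrite inE; case xA: (x \in A) => //; rewrite (fsubsetP AS) in xS.
have inQ (x : site) : x \in S -> (x \in A `|` Q) = (x \in A).
  by move=> xS; rewrite inE in_top_arc xS !andbF orbF.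
have mem (x : site) : (x \in A `|` Q) = if [&& i0 <= x.1, x.1 <= i1, y0 <= x.2 & x.2 <= y1] then x \in A
   else [&& i0 - 1 <= x.1, x.1 <= i1 + 1, y0 - 1 <= x.2, x.2 <= y1 + 1 &
     [|| y1 < x.2, (x.1 < i0) && (ay < x.2) | (i1 < x.1) && (bY < x.2)]].
  case: ifP => xS; first by rewrite inQ // in_rect.
  by rewrite inAQ ?in_rect ?xS // in_top_arc !in_rect xS -!andbA.
set E := [fset b in X | _].
have inE' b : (b \in E) = (b \in X) && differ (A `|` Q) b by rewrite in_fsetsep.
have rowE (n : nat) (y : int) : y0 <= y -> y <= y1 -> i0 + n%:Z <= i1 ->
    row_parity E (i0 + n%:Z) y (+) (ay < y) = ((i0 + n%:Z, y) \in A).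
  move=> h1 h2; elim: n => [|n IH] h3.
    rewrite addr0 -[i0 in row_parity E i0 _](subrK 1) row_parity_succ.
    rewrite row_parity_left; last by move=> [[i j] []] //; rewrite inE' in_X /= => ij _ jy; lia.
    rewrite inE' in_X /= /differ /bond_fst /bond_snd /= subrK !mem /=.
    have -> : [&& i0 <= i0, i0 <= i1, y0 <= y & y <= y1] by lia.
    have -> : [&& i0 <= i0 - 1, i0 - 1 <= i1, y0 <= y & y <= y1] = false by clear; lia.
    have -> : [&& i0 - 1 <= i0 - 1, i0 - 1 <= i1, y0 <= y & y <= y1] by lia.
    have -> : [&& i0 - 1 <= i0 - 1, i0 - 1 <= i1 + 1, y0 - 1 <= y, y <= y1 + 1
       & [|| y1 < y, (i0 - 1 < i0) && (ay < y) | (i1 < i0 - 1) && (bY < y)]] = (ay < y) by lia.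
    by case: ((i0, y) \in A); case: (ay < y).
  rewrite (_ : i0 + n.+1%:Z = i0 + n%:Z + 1) in h3 *; last by clear; lia.
  rewrite row_parity_succ addbAC IH; last by lia.
  rewrite inE' in_X /= /differ /bond_fst /bond_snd /= !mem /=.
  have -> : [&& i0 <= i0 + n%:Z, i0 + n%:Z <= i1, y0 <= y & y <= y1] by lia.
  have -> : [&& i0 <= i0 + n%:Z + 1, i0 + n%:Z + 1 <= i1, y0 <= y & y <= y1] by lia.
  have -> : [&& i0 - 1 <= i0 + n%:Z, i0 + n%:Z <= i1, y0 <= y & y <= y1] by lia.
  by case: (_ \in A) (_ \in A) => [] [].
split.
- by apply/fsubsetP => b; rewrite inE' => /andP[].
- apply/fsetP => -[x1 x2]; rewrite in_fsetsep; case xS: ((x1, x2) \in S); last first.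
    by symmetry; apply/negbTE/negP => /(fsubsetP AS); rewrite xS.
  move: xS; rewrite in_rect /= => /and4P[h1 h2 h3 h4].
  have e : x1 = i0 + (absz (x1 - i0)%R)%:Z by clear -h1; lia.
  by rewrite e rowE -?e.
have out (x : site) : ~~ [&& i0 <= x.1, x.1 <= i1, y0 <= x.2 & x.2 <= y1] ->
    (x \in A `|` Q) = [&& i0 - 1 <= x.1, x.1 <= i1 + 1, y0 - 1 <= x.2, x.2 <= y1 + 1 &
     [|| y1 < x.2, (x.1 < i0) && (ay < x.2) | (i1 < x.1) && (bY < x.2)]].
  by move=> xS; rewrite mem (negPf xS).
have -> : has_boundary p E q.
  apply/has_boundaryP => -[i j].
  have [/and4P[iL iR jL jR]|off] :=
    boolP [&& i0 - 1 <= i, i <= i1, y0 - 1 <= j & j <= y1]; last first.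
    rewrite /odd_degree /north_in /east_in /south_in /west_in !inE' !in_X /=.
    have -> : [&& i0 - 1 <= i, i <= i1, y0 <= j + 1 & j + 1 <= y1] = false by clear -off; lia.
    have -> : [&& i0 <= i + 1, i + 1 <= i1, y0 - 1 <= j & j <= y1] = false by clear -off; lia.
    have -> : [&& i0 - 1 <= i, i <= i1, y0 <= j & j <= y1] = false by clear -off; lia.
    have -> : [&& i0 <= i, i <= i1, y0 - 1 <= j & j <= y1] = false by clear -off; lia.
    by rewrite !siteE /=; move: off; clear -ay_ge ay_le by_ge by_le i01; lia.
  have EN : north_in E (i, j) = differ (A `|` Q) ((i, j + 1), true).
    rewrite /north_in inE' in_X /=.
    have [jlt|jge] := ltP j y1; first by rewrite (_ : [&& _, _, _ & _]) //; clear -iL iR jL jlt; lia.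
    have -> : j = y1 by clear -jR jge; lia.
    rewrite (_ : [&& _, _, _ & _] = false); last by clear; lia.
    rewrite /differ /bond_fst /bond_snd /= !out /=; try (clear; lia).
    have -> : [&& i0 - 1 <= i, i <= i1 + 1, y0 - 1 <= y1 + 1, y1 + 1 <= y1 + 1 &
      [|| y1 < y1 + 1, (i < i0) && (ay < y1 + 1) | (i1 < i) && (bY < y1 + 1)]].
      by clear -iL iR ay_ge ay_le; lia.
    by symmetry; apply/negbTE/negPn; clear -iL iR ay_ge ay_le; lia.
  have ES : south_in E (i, j) = differ (A `|` Q) ((i, j), true).
    rewrite /south_in inE' in_X /=.
    have [jlt|jge] := leP y0 j; first by rewrite (_ : [&& _, _, _ & _]) //; clear -iL iR jlt jR; lia.
    have -> : j = y0 - 1 by clear -jL jge; lia.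
    rewrite (_ : [&& _, _, _ & _] = false); last by clear; lia.
    rewrite /differ /bond_fst /bond_snd /= !out /=; try (clear; lia).
    rewrite (_ : [|| _, _ | _] = false); last by clear -ay_ge by_ge ay_le; lia.
    rewrite (_ : [|| _, _ | _] = false); last by clear -ay_ge by_ge ay_le; lia.
    by rewrite !andbF.
  have EW : west_in E (i, j) = differ (A `|` Q) ((i, j), false) (+) ((i, j) == q).
    rewrite /west_in inE' in_X siteE /=.
    have [ilt|ige] := leP i0 i.
      rewrite (_ : [&& _, _, _ & _]); last by clear -ilt iR jL jR; lia.
      by rewrite (_ : (i == _) = false) ?addbF //; clear -ilt; lia.
    have -> : i = i0 - 1 by clear -iL ige; lia.
    rewrite (_ : [&& _, _, _ & _] = false); last by clear; lia.
    rewrite eqxx /differ /bond_fst /bond_snd /= !out /=; try (clear; lia).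
    have -> : [&& i0 - 1 <= i0 - 1, i0 - 1 <= i1 + 1, y0 - 1 <= j, j <= y1 + 1 &
      [|| y1 < j, (i0 - 1 < i0) && (ay < j) | (i1 < i0 - 1) && (bY < j)]] = (ay < j).
      by clear -jL jR ay_le i01; lia.
    have -> : [&& i0 - 1 <= i0 - 1, i0 - 1 <= i1 + 1, y0 - 1 <= j + 1, j + 1 <= y1 + 1 &
      [|| y1 < j + 1, (i0 - 1 < i0) && (ay < j + 1) | (i1 < i0 - 1) && (bY < j + 1)]] = (ay < j + 1).
      by clear -jL jR ay_le i01; lia.
    by clear; lia.
  have EE : east_in E (i, j) = differ (A `|` Q) ((i + 1, j), false) (+) ((i, j) == p).
    rewrite /east_in inE' in_X siteE /=.
    have [ilt|ige] := ltP i i1.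
      rewrite (_ : [&& _, _, _ & _]); last by clear -ilt iL jL jR; lia.
      by rewrite (_ : (i == _) = false) ?addbF //; clear -ilt; lia.
    have -> : i = i1 by clear -iR ige; lia.
    rewrite (_ : [&& _, _, _ & _] = false); last by clear; lia.
    rewrite eqxx /differ /bond_fst /bond_snd /= !out /=; try (clear; lia).
    have -> : [&& i0 - 1 <= i1 + 1, i1 + 1 <= i1 + 1, y0 - 1 <= j, j <= y1 + 1 &
      [|| y1 < j, (i1 + 1 < i0) && (ay < j) | (i1 < i1 + 1) && (bY < j)]] = (bY < j).
      by clear -jL jR by_le i01; lia.
    have -> : [&& i0 - 1 <= i1 + 1, i1 + 1 <= i1 + 1, y0 - 1 <= j + 1, j + 1 <= y1 + 1 &
      [|| y1 < j + 1, (i1 + 1 < i0) && (ay < j + 1) | (i1 < i1 + 1) && (bY < j + 1)]] = (bY < j + 1).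
      by clear -jL jR by_le i01; lia.
    by clear; lia.
  rewrite /odd_degree EN EE ES EW /differ /bond_fst /bond_snd /=.
  by do 4!case: (_ \in A `|` Q); case: (_ == p); case: (_ == q).
by rewrite mul1r dis_card.
Qed.

End Rectangle.

Lemma psum_compl (K : choiceType) (R : realFieldType) (D : {fset K}) (F : {fset K} -> R) :
  psum D F = psum D (fun A => F (D `\` A)).
Proof.
rewrite -(@psum_reindex _ _ _ D D (fun A => D `\` A) (fun A => D `\` A) xpredT).
- by apply: eq_psum => A _; rewrite mul1r.
- by move=> A AD; split=> //; [exact: fsubsetDl | rewrite fsetDK].
- by move=> A AD _; split; [exact: fsubsetDl | rewrite fsetDK].
Qed.

Section Reach.
Variables (K : choiceType) (e : rel K).
Hypothesis e_sym : symmetric e.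
Implicit Types (X Y xi : {fset K}).

Lemma reach_seed1 X xi x : reach e X xi x -> exists2 s, s \in xi & reach e X [fset s] x.
Proof.
elim=> {x} [x xxi|x y _ [s sxi rs] exy yX].
  by exists x => //; apply: reach_seed; rewrite inE.
by exists s => //; exact: reach_step rs exy yX.
Qed.

Lemma reach_seedS X xi xi' x : xi `<=` xi' -> reach e X xi x -> reach e X xi' x.
Proof.
move=> /fsubsetP xx'; elim=> {x} [x /xx'|x y _ IH exy yX]; first exact: reach_seed.
exact: reach_step IH exy yX.
Qed.

Lemma reach_sym X x y : x \in X -> reach e X [fset x] y -> reach e X [fset y] x.
Proof.
move=> xX; elim=> {y} [y|y z ry IH eyz zX].
  by rewrite inE => /eqP->; apply: reach_seed; rewrite inE.
apply: reach_trans IH; apply: reach_step (_ : e z y) _.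
- by apply: reach_seed; rewrite inE.
- by rewrite e_sym.
- by have := reach_in ry; rewrite !inE => /orP[//|/eqP->].
Qed.

End Reach.

(** * From an interface to a minus crossing *)

Section Crossing.
Variables (R : realFieldType) (t r : R).
Hypotheses (t01 : 0 < t <= 1) (r0 : 0 <= r) (r2 : r ^+ 2 = 2).
Hypothesis subcritical : t ^+ 2 * (3 + 2 * r) < 1.
Variables (i0 i1 y0 y1 ay bY : int).
Hypotheses (ay_ge : y0 <= ay) (ay_le : ay <= y1) (by_ge : y0 <= bY) (by_le : bY <= y1).
Hypothesis i01 : i0 <= i1.
Let S := rect i0 i1 y0 y1.
Let X := touching S.
Let Q := top_arc i0 i1 y0 y1 ay bY.

Definition linked (A : {fset site}) (a b : site) : Prop :=
  a \in A /\ reach tadj A [fset a] b.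

(* The plus cluster [U] of the top arc is separated from the bottom arc by the minus
   crossing; flipping it turns the plus boundary condition into the Dobrushin one, and
   below the interface the boundary condition becomes uniform. *)
Lemma crossing_le : psum S (fun A => `[< linked A (i0, ay) (i1, bY) >]%:R * wt t A) <=
  psum S (fun A => t ^+ dis X (A `|` Q)).
Proof.
have t0 : 0 <= t by case/andP: t01 => /ltW.
have SQ : [disjoint S & Q].
  by apply/fdisjointP => x xS; rewrite in_top_arc xS !andbF.
rewrite psum_compl (psum_explore nnadj _ SQ) [leRHS](psum_explore nnadj _ SQ).
apply: ler_psum => U US; case: eqP => UU; rewrite ?mul0r // !mul1r.
set D := unexplored nnadj S Q U.
have DS : D `<=` S by exact: unexplored_sub.
have Dsep y z : y \in D -> z \in U `|` Q -> ~~ nnadj z y.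
  by case/unexploredP=> _ _; apply.
have DU y : y \in D -> y \notin U by case/unexploredP.
have [[I [ID [aI rI]]]|none] := pselect (exists I, I `<=` D /\
    linked (S `\` (U `|` I)) (i0, ay) (i1, bY)); last first.
  apply: (@le_trans _ _ 0); last by apply: psum_ge0 => I _; rewrite exprn_ge0.
  rewrite /psum big1_seq // => I /=; rewrite fpowersetE => ID.
  case: asboolP => [cI|]; last by rewrite mul0r.
  by case: none; exists I.
(* If [U] had a neighbour on the ring outside the top arc, the flip would create a disagreement
   there. *)
have good x y : x \in U -> y \notin S -> nnadj x y -> y \in Q.
  apply: (@blocking i0 i1 y0 y1 ay bY _ _ _ _ _ (S `\` (U `|` I)) U) => //.
    by rewrite fsubsetDl.
  by apply/fdisjointP => z; rewrite !inE negb_or -andbA => /and3P[].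
apply: (@le_trans _ _ (psum D (fun J => t ^+ dis X (S `\` (U `|` J))))).
  apply: ler_psum => J JD; rewrite -[leRHS]mul1r.
  rewrite (@wt_dis _ _ _ X) ?touchingS ?fsubsetDl // ler_wpM2r ?exprn_ge0 //.
  by case: `[< _ >].
(* The sites next to [U] or [Q] that are not in [U]: minus before the flip and plus after it. *)
pose m := S `\` (U `|` D).
pose P (b : bond) := (bond_fst b \in U `|` Q) || (bond_snd b \in U `|` Q).
pose X1 := seq.filter P X; pose X2 := seq.filter (predC P) X.
rewrite psum_compl.
have mJ J : J `<=` D -> S `\` (U `|` (D `\` J)) = m `|` J.
  move=> /fsubsetP JD; apply/fsetP => x; rewrite !(in_fsetD, in_fsetU) !negb_or !negb_and !negbK.
  case xJ: (x \in J); last by rewrite !orbF; case: (x \in D); rewrite ?andbF.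
  by rewrite JD // DU ?(fsubsetP DS) ?JD // orbT.
have disX1 b : b \in X1 -> exists x y, [/\ x \in U `|` Q, nnadj x y,
    (forall A, differ A b = ((x \in A) != (y \in A))) & (x \in S) || (y \in S)].
  rewrite mem_filter => /andP[/orP[bU|bU] bX].
    exists (bond_fst b), (bond_snd b); split; rewrite ?nnadj_bond //.
    by rewrite -touchingE.
  exists (bond_snd b), (bond_fst b); split; rewrite // 1?nnadj_sym ?nnadj_bond //.
    by move=> A; rewrite /differ eq_sym.
  by rewrite orbC -touchingE.
have UQS x : x \in U `|` Q -> x \in S -> x \in U.
  by rewrite inE => /orP[//|xQ xS]; move/fdisjointP: SQ => /(_ _ xS); rewrite xQ.
have mUQ x : x \in U `|` Q -> x \in m = false.
  move=> xU; rewrite in_fsetD; case xS: (x \in S); rewrite ?andbF // andbT.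
  by rewrite in_fsetU (UQS _ xU xS).
have DUQ x : x \in U `|` Q -> x \in D = false.
  move=> xU; apply/negbTE/negP => xD; have := DU _ xD.
  by rewrite (UQS _ xU (fsubsetP DS _ xD)).
(* The flip changes both ends of each bond that touches [U] or [Q], so the disagreements on these
   bonds are preserved. *)
have side J J' : J `<=` D -> J' `<=` D -> dis X1 (m `|` J) = dis X1 (U `|` J' `|` Q).
  move=> /fsubsetP JD /fsubsetP JD'; apply: eq_dis => b /disX1[x [y [xU xy xyE xyS]]].
  rewrite !xyE.
  have xm : x \in m `|` J = false.
    by rewrite in_fsetU mUQ //=; apply/negbTE/negP => /JD; rewrite DUQ.
  have xU' : x \in U `|` J' `|` Q by rewrite fsetUAC in_fsetU xU.
  rewrite xm xU' fsetUAC.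
  have -> : (y \in m `|` J) = (y \in m) || (y \in J) by rewrite in_fsetU.
  have -> : (y \in U `|` Q `|` J') = (y \in U `|` Q) || (y \in J') by rewrite in_fsetU.
  case yU: (y \in U `|` Q) => /=.
    by rewrite mUQ // (_ : (y \in J) = false) //; apply/negbTE/negP => /JD; rewrite DUQ.
  have yD : y \notin D by apply/negP => yD; have := Dsep _ _ yD xU; rewrite xy.
  rewrite (_ : (y \in J') = false); last by apply/negbTE/negP => /JD'; rewrite (negPf yD).
  suff -> : y \in m by [].
  rewrite in_fsetD in_fsetU negb_or yD andbT.
  move: yU; rewrite in_fsetU => /negbT; rewrite negb_or => /andP[yU yQ]; rewrite yU /=.
  case/orP: xyS => // xS; apply/negPn/negP => yS.
  by have := good _ _ (UQS _ xU xS) yS xy; rewrite (negPf yQ).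
apply: (@le_trans _ _ (t ^+ dis X1 (U `|` Q) * psum D (fun J => t ^+ dis X2 (m `|` J)))).
  rewrite -psumZ; apply: ler_psum => J JD; rewrite mJ // (dis_filter P) exprD.
  by rewrite -/X1 -/X2 (side J fset0) ?fsub0set // fsetU0.
apply: (@le_trans _ _ (t ^+ dis X1 (U `|` Q) * psum D (fun J => t ^+ dis X2 J))).
  rewrite ler_wpM2l ?exprn_ge0 //; apply: uniform_boundary_max => //.
  by apply/fdisjointP => x; rewrite in_fsetD in_fsetU negb_or -andbA => /and3P[].
rewrite -psumZ; apply: ler_psum => J JD; rewrite (dis_filter P X) exprD -/X1 -/X2.
rewrite -(side fset0 J) ?fsub0set // (side fset0 fset0) ?fsub0set // fsetU0.
rewrite le_eqVlt; apply/orP; left; apply/eqP; congr (_ * t ^+ _); apply: eq_dis => b.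
rewrite mem_filter /= negb_or => /andP[/andP[b1 b2] _]; rewrite /differ.
have UJ z : z \notin U `|` Q -> (z \in U `|` J `|` Q) = (z \in J).
  by move=> zU; rewrite fsetUAC in_fsetU (negPf zU).
by rewrite !UJ.
Qed.

Lemma crossing_decay (k : nat) : i1 = i0 + k%:Z ->
  psum S (fun A => `[< linked A (i0, ay) (i1, bY) >]%:R * wt t A) ^+ 2 <=
  12 * t ^+ 2 / (1 - t ^+ 2 * (3 + 2 * r)) * (t ^+ 2 * (3 + 2 * r)) ^+ k * Z t S ^+ 2.
Proof.
move=> ik; have t0 : 0 <= t by case/andP: t01 => /ltW.
have ZS : Z t S = psum S (fun A => t ^+ dis X A).
  by apply: eq_psum => A AS; apply: wt_dis; exact: touchingS.
have XR e : e \in X -> [/\ (i0 - 1, ay).1 <= (dual_fst e).1, (dual_fst e).1 <= (i1, bY).1,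
    (i0 - 1, ay).1 <= (dual_snd e).1 & (dual_snd e).1 <= (i1, bY).1].
  rewrite touchingE /S !in_rect /dual_fst /dual_snd /bond_fst /bond_snd.
  by case: e => [[i j] []] /= h; split; move: h; clear; lia.
have q1p : (i0 - 1, ay).1 < (i1, bY).1 by clear -i01; rewrite /=; lia.
have pqk : (i1, bY).1 = (i0 - 1, ay).1 + 1 + k%:Z by rewrite /= ik; clear; lia.
have cd := corr_decay t0 r0 r2 subcritical q1p XR pqk.
apply: (@le_trans _ _ (corr t X (i1, bY) (i0 - 1, ay) ^+ 2)); last apply: le_trans cd _.
- have n1 : 0 <= psum S (fun A => `[< linked A (i0, ay) (i1, bY) >]%:R * wt t A).
    by apply: psum_ge0 => A _; rewrite mulr_ge0 // ltW // wt_gt0.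
  have n2 : 0 <= corr t X (i1, bY) (i0 - 1, ay).
    by apply: psum_ge0 => A _; rewrite mulr_ge0 // exprn_ge0.
  rewrite ler_sqr ?nnegrE //; apply: le_trans crossing_le _.
  by apply: dobrushin_le.
- set c := _ * _ ^+ k; have Z0 := ltW (Z_gt0 t01 S).
  apply: ler_wpM2l.
    have h1 : 0 <= t ^+ 2 * (3 + 2 * r) by rewrite mulr_ge0 ?sqr_ge0 // addr_ge0 // mulr_ge0.
    rewrite /c mulr_ge0 ?exprn_ge0 // divr_ge0 ?subr_ge0 ?(ltW subcritical) //.
    by rewrite mulr_ge0 ?sqr_ge0.
  rewrite ler_sqr ?nnegrE //; last first.
    by apply: psum_ge0 => A _; rewrite mulr_ge0 // exprn_ge0.
  by rewrite ZS; exact: (even_le t01 ay_ge ay_le by_ge by_le i01).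
Qed.

End Crossing.

Lemma fset_argmin (K : choiceType) (f : K -> int) (C : {fset K}) x : x \in C ->
  exists2 a, a \in C & forall z, z \in C -> f a <= f z.
Proof.
elim/fset_ind1: C x => [x|c C cC IH x _]; first by rewrite inE.
have [->|[y yC]] := fset_0Vmem C.
  by exists c => [|z]; rewrite !inE ?eqxx // orbF => /eqP->.
have [a aC amin] := IH y yC; have [ca|ac] := leP (f c) (f a).
  exists c => [|z]; rewrite in_fset1U ?eqxx // => /orP[/eqP->//|/amin]; exact: le_trans.
exists a => [|z]; rewrite in_fset1U ?aC ?orbT // => /orP[/eqP->|/amin//]; exact: ltW.
Qed.

(** * Clusters included in a subdomain *)

Section Inside.
Implicit Types (A B L xi : {fset site}).

(* The union of the clusters of [A] that are included in [B]. *)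
Definition inside B A := (A `&` B) `\` explored tadj (A `\` B) (A `&` B).

Lemma in_inside B A x : x \in A -> (forall y, reach tadj A [fset x] y -> y \in B) ->
  x \in inside B A.
Proof.
move=> xA xB; have xxB : x \in B by apply: xB; apply: reach_seed; rewrite inE.
rewrite in_fsetD in_fsetI xA xxB !andbT; apply/negP => /exploredP[_ /reach_seed1[s]].
rewrite in_fsetD => /andP[sB sA] rs.
have /xB := reach_sym tadj_sym sA (reach_mono (fsubsetIl A B) rs).
by rewrite (negPf sB).
Qed.

Lemma connected_inside B A x y : x \in A -> (forall z, reach tadj A [fset x] z -> z \in B) ->
  reach tadj A [fset x] y -> linked (inside B A) x y.
Proof.
move=> xA xB rxy; split; first exact: in_inside.
elim: rxy => {y} [y|y z ry IH yz zA]; first exact: reach_seed.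
apply: (reach_step IH yz); apply: in_inside => // u ru; apply: xB.
by apply: reach_trans ru; exact: reach_step ry yz zA.
Qed.

Lemma connectedS A A' x y : A `<=` A' -> linked A x y -> linked A' x y.
Proof. by move=> AA' [xA rx]; split; [exact: (fsubsetP AA') | exact: reach_mono rx]. Qed.

Lemma connected_sym A x y : linked A x y -> linked A y x.
Proof.
move=> [xA rx]; split; last exact: (reach_sym tadj_sym xA rx).
by have := reach_in rx; rewrite !inE => /orP[//|/eqP->].
Qed.

Variables (R : realFieldType) (t : R).
Hypothesis t01 : 0 < t <= 1.

(** Given the minus sites outside [B], this is [explored_le]. The factor [G] depends on those sites
    only; it is carried along for the decay of correlations. *)
Lemma inside_le B L (F G : {fset site} -> R) : B `<=` L ->
  (forall A, 0 <= F A) -> (forall A D, A `<=` D -> F A <= F D) -> (forall A, 0 <= G A) ->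
  psum L (fun A => G (A `\` B) * (F (inside B A) * wt t A)) * Z t B <=
  psum B (fun A => F A * wt t A) * psum L (fun A => G (A `\` B) * wt t A).
Proof.
move=> BL F0 Fm G0.
have dis : [disjoint L `\` B & B].
  by apply/fdisjointP => x; rewrite in_fsetD => /andP[].
have {1 2}-> : L = (L `\` B) `|` B.
  apply/fsetP => x; rewrite in_fsetU in_fsetD; case xB: (x \in B); rewrite ?orbF //=.
  by rewrite (fsubsetP BL).
rewrite !psumU // -psumZr -psumZ; apply: ler_psum => xi xiL.
have dB : [disjoint B & xi].
  by rewrite fdisjoint_sym; apply: fdisjointWl xiL dis.
have AB al : al `<=` B -> (xi `|` al) `\` B = xi /\ (xi `|` al) `&` B = al.
  move=> /fsubsetP alB; split; apply/fsetP => x; rewrite !inE.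
    case xxi: (x \in xi); rewrite /= ?andbT.
      by apply/negP => xB; move/fdisjointP: dB => /(_ _ xB); rewrite xxi.
    by apply/negbTE; rewrite negb_and negbK orbC; apply/orP; case xal: (x \in al); [right; exact: alB|left].
  case xal: (x \in al); first by rewrite orbT alB.
  rewrite orbF; apply/negbTE/negP => /andP[xxi xB].
  by move/fdisjointP: dB => /(_ _ xB); rewrite xxi.
rewrite (@eq_psum _ _ B _ (fun al => G xi *
   (F (al `\` explored tadj xi al) * wt t (al `|` xi)))); last first.
  by move=> al alB; rewrite /inside; have [-> ->] := AB _ alB; rewrite fsetUC.
rewrite [X in _ <= _ * X](@eq_psum _ _ B _ (fun al => G xi * wt t (al `|` xi))); last first.
  by move=> al alB; have [-> _] := AB _ alB; rewrite fsetUC.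
rewrite !psumZ -mulrA [leRHS]mulrCA; apply: ler_wpM2l => //.
apply: explored_le => // A D AD _; exact: Fm.
Qed.

End Inside.

Section BigClusters.
Variables (R : rcfType) (t : R).
Let r : R := Num.sqrt 2.
Let rho : R := t * (1 + r).
Hypotheses (t0 : 0 < t) (rho1 : rho < 1).
Implicit Types (A B L : {fset site}).

Let r0 : 0 <= r. Proof. exact: sqrtr_ge0. Qed.
Let r2 : r ^+ 2 = 2. Proof. by rewrite sqr_sqrtr. Qed.
Let rho0 : 0 < rho. Proof. by rewrite mulr_gt0 // ltr_wpDr. Qed.
Let t01 : 0 < t <= 1.
Proof.
rewrite t0 /=; apply: ltW; apply: le_lt_trans rho1.
by rewrite /rho mulrDr mulr1 lerDl mulr_ge0 // ltW.
Qed.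
Let rho2E : t ^+ 2 * (3 + 2 * r) = rho ^+ 2.
Proof. by rewrite /rho exprMn; congr (_ * _); rewrite sqrrD r2 expr1n mul1r; ring. Qed.

Definition crossing_const : R := Num.sqrt (12 * t ^+ 2 / (1 - rho ^+ 2)).

Let crossing_bound (i0 i1 y0 y1 ay bY : int) (k : nat) :
  y0 <= ay -> ay <= y1 -> y0 <= bY -> bY <= y1 -> i1 = i0 + k%:Z ->
  psum (rect i0 i1 y0 y1)
    (fun A => `[< linked A (i0, ay) (i1, bY) >]%:R * wt t A) <=
  crossing_const * rho ^+ k * Z t (rect i0 i1 y0 y1).
Proof.
move=> h1 h2 h3 h4 ik; have i01 : i0 <= i1 by rewrite ik lerDl.
have rho21 : rho ^+ 2 < 1 by rewrite exprn_ilt1 // ltW.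
have := crossing_decay t01 r0 r2 _ h1 h2 h3 h4 i01 ik.
rewrite rho2E => /(_ rho21) cd.
have c0 : 0 <= 12 * t ^+ 2 / (1 - rho ^+ 2).
  by rewrite divr_ge0 ?subr_ge0 ?(ltW rho21) // mulr_ge0 ?sqr_ge0.
rewrite -ler_sqr ?nnegrE; last first.
- by rewrite !mulr_ge0 ?sqrtr_ge0 ?exprn_ge0 ?(ltW rho0) // ltW // Z_gt0.
- by apply: psum_ge0 => A _; rewrite mulr_ge0 // ltW // wt_gt0.
have sq (x y z : R) : (x * y ^+ k * z) ^+ 2 = x ^+ 2 * (y ^+ 2) ^+ k * z ^+ 2.
  by rewrite exprMn exprMn (exprAC y).
by rewrite sq /crossing_const sqr_sqrtr.
Qed.

Definition wide (n : nat) A : Prop :=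
  exists x y, linked A x y /\ n%:Z <= y.1 - x.1.

(** Union bound over a leftmost site [a] and a rightmost site [b] of the cluster: the cluster is
    then included in the full-height strip [S a b] and crosses it, so the crossing estimate on this
    strip applies through [inside]. *)
Lemma wide_prob (x0 x1 y0 y1 : int) (n : nat) (L := rect x0 x1 y0 y1) :
  psum L (fun A => `[< wide n A >]%:R * wt t A) <=
  #|` L|%:R ^+ 2 * crossing_const * rho ^+ n * Z t L.
Proof.
pose S (a b : site) := rect a.1 b.1 y0 y1.
have Sab a b : a \in L -> b \in L -> S a b `<=` L.
  move=> aL bL; apply/fsubsetP => z; move: aL bL; rewrite !in_rect.
  by case: a b z => [? ?] [? ?] [? ?] /=; lia.
pose W a b : R := psum L (fun A => `[< linked (inside (S a b) A) a b >]%:R * wt t A).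
apply: (@le_trans _ _ (\sum_(a <- L) \sum_(b <- L) (n%:Z <= b.1 - a.1)%R%:R * W a b)).
  rewrite /W; under [leRHS]eq_bigr do under eq_bigr do rewrite -psumZ.
  under [leRHS]eq_bigr do rewrite -psum_sum; rewrite -psum_sum.
  apply: ler_psum => A /fsubsetP AL; have w0 : 0 <= wt t A by rewrite ltW // wt_gt0.
  have pos a b : 0 <= (n%:Z <= b.1 - a.1)%R%:R *
      (`[< linked (inside (S a b) A) a b >]%:R * wt t A) by rewrite !mulr_ge0.
  case: asboolP => [[x [y [[xA rxy] nxy]]]|_]; last first.
    by rewrite mul0r sumr_ge0 // => a _; rewrite sumr_ge0.
  have xC : x \in explored tadj [fset x] A.
    by apply/exploredP; split=> //; apply: reach_seed; rewrite inE.
  have [a aC amin] := fset_argmin (fun z : site => z.1) xC.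
  have [b bC bmax] := fset_argmin (fun z : site => - z.1) xC.
  have [aA ra] := exploredP _ _ _ _ aC; have [bA rb] := exploredP _ _ _ _ bC.
  have yA : y \in A by have := reach_in rxy; rewrite !inE => /orP[//|/eqP->].
  have rax := reach_sym tadj_sym xA ra.
  have compS z : reach tadj A [fset a] z -> z \in S a b.
    move=> raz; have rxz := reach_trans ra raz.
    have zA : z \in A by have := reach_in rxz; rewrite !inE => /orP[//|/eqP->].
    have zC : z \in explored tadj [fset x] A by apply/exploredP.
    have := AL _ zA; have := amin _ zC; have := bmax _ zC; rewrite !in_rect.
    by case: z {raz rxz zA zC} => [z1 z2] /=; clear; lia.
  rewrite (bigD1_seq a) ?AL ?fset_uniq //= (bigD1_seq b) ?AL ?fset_uniq //=.
  apply: ler_wpDr; first by rewrite sumr_ge0 // => ? _; rewrite sumr_ge0.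
  apply: ler_wpDr; first by rewrite sumr_ge0.
  rewrite (_ : (n%:Z <= b.1 - a.1)%R) ?mul1r; last first.
    have yC : y \in explored tadj [fset x] A by apply/exploredP.
    apply: le_trans nxy _; apply: lerB; last exact: amin _ xC.
    by rewrite -lerN2; exact: bmax _ yC.
  suff -> : `[< linked (inside (S a b) A) a b >] by rewrite ?mul1r.
  by apply/asboolP; apply: connected_inside => //; exact: reach_trans rax rb.
apply: (@le_trans _ _ (\sum_(a <- L) \sum_(b <- L) crossing_const * rho ^+ n * Z t L)).
  rewrite big_seq [leRHS]big_seq; apply: ler_sum => a aL.
  rewrite big_seq [leRHS]big_seq; apply: ler_sum => b bL.
  have cpos : 0 <= crossing_const * rho ^+ n * Z t L.
    by rewrite !mulr_ge0 ?sqrtr_ge0 ?exprn_ge0 ?(ltW rho0) // ltW // Z_gt0.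
  have [nab|] := boolP (n%:Z <= b.1 - a.1)%R; rewrite ?mul0r // mul1r.
  have ZS := Z_gt0 t01 (S a b); rewrite -(ler_pM2r ZS).
  have cm A D : A `<=` D ->
      `[< linked A a b >]%:R <= `[< linked D a b >]%:R :> R.
    move=> AD; rewrite ler_nat; case: asboolP => // cA; rewrite lt0b.
    by apply/asboolP; exact: connectedS cA.
  have := @inside_le _ t t01 (S a b) L (fun A => `[< linked A a b >]%:R) (fun=> 1)
    (Sab _ _ aL bL) (fun=> ler0n _ _) cm (fun=> ler01).
  rewrite (@eq_psum _ _ L _ (fun A => `[< linked (inside (S a b) A) a b >]%:R * wt t A));
    last by move=> *; rewrite mul1r.
  rewrite [X in _ <= _ * X](@eq_psum _ _ L _ (wt t)); last by move=> *; rewrite mul1r.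
  move=> il; apply: le_trans il _.
  have e : b.1 = a.1 + (absz (b.1 - a.1)%R)%:Z by move: nab; clear; lia.
  move: (aL) (bL); rewrite /L !in_rect => /and4P[_ _ a3 a4] /and4P[_ _ b3 b4].
  have := crossing_bound a3 a4 b3 b4 e; rewrite -!surjective_pairing => cb.
  rewrite [leRHS](_ : _ = crossing_const * rho ^+ n * Z t (S a b) * Z t L); last by ring.
  rewrite ler_wpM2r ?(ltW (Z_gt0 t01 L)) //; apply: le_trans cb _.
  rewrite ler_wpM2r ?(ltW ZS) // ler_wpM2l ?sqrtr_ge0 //.
  by apply: ler_wiXn2l; rewrite ?(ltW rho0) ?(ltW rho1) //; move: nab; clear; lia.
rewrite !big_const_seq !count_predT !iter_addr_0.
have -> (c : R) m : c *+ m *+ m = m%:R ^+ 2 * c by rewrite -(mulr_natl (_ *+ _)) -(mulr_natl c) mulrA expr2.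
by rewrite !mulrA.
Qed.

End BigClusters.

(** * Averages in finite volume *)

Section Transport.
Variables (phi phi' : site -> site) (psi psi' : bond -> bond).
Hypotheses (phiK : cancel phi phi') (phi'K : cancel phi' phi).
Hypotheses (psiK : cancel psi psi') (psi'K : cancel psi' psi).
Hypothesis psi_fst : forall b, bond_fst (psi b) = phi (bond_fst b).
Hypothesis psi_snd : forall b, bond_snd (psi b) = phi (bond_snd b).
Hypothesis phi_tadj : forall x y, tadj (phi x) (phi y) = tadj x y.
Variables (R : realFieldType) (t : R).
Implicit Types (A L : {fset site}).

Let mem_phi A x : (phi x \in phi @` A) = (x \in A).
Proof. by rewrite mem_imfset //; exact: can_inj phiK. Qed.

Lemma wt_imfset A : wt t (phi @` A) = wt t A.
Proof.
rewrite /wt !dis_card; congr (_ ^+ _).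
have dE b : differ (phi @` A) (psi b) = differ A b.
  by rewrite /differ psi_fst psi_snd !mem_phi.
transitivity #|` psi @` [fset b in touching A | differ A b]|; last first.
  by rewrite card_imfset //; exact: can_inj psiK.
congr (#|` _|); apply/fsetP => b.
rewrite -(psi'K b) [RHS]mem_imfset /=; last exact: can_inj psiK.
by rewrite !in_fsetsep dE !touchingE psi_fst psi_snd !mem_phi.
Qed.

Lemma psum_imfset L (F : {fset site} -> R) :
  psum (phi @` L) F = psum L (fun A => F (phi @` A)).
Proof.
have subphi A : A `<=` L -> phi @` A `<=` phi @` L.
  move=> /fsubsetP AL; apply/fsubsetP => x /imfsetP[y /= yA ->].
  by rewrite mem_phi AL.
have K1 A : phi' @` (phi @` A) = A.
  apply/fsetP => x; apply/imfsetP/idP => [[y /= /imfsetP[z /= zA ->] ->]|xA].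
    by rewrite phiK.
  by exists (phi x); rewrite /= ?mem_phi ?phiK.
have K2 A : phi @` (phi' @` A) = A.
  apply/fsetP => x; apply/imfsetP/idP => [[y /= /imfsetP[z /= zA ->] ->]|xA].
    by rewrite phi'K.
  exists (phi' x); rewrite /= ?phi'K //.
  by apply/imfsetP; exists x.
rewrite -(@psum_reindex _ _ _ L (phi @` L) (fun A => phi @` A) (fun A => phi' @` A) xpredT).
- by apply: eq_psum => A _; rewrite mul1r.
- by move=> A AL; rewrite K1 subphi.
- move=> A AL _; rewrite K2; split => //; rewrite -(K1 L).
  apply/fsubsetP => x /imfsetP[y /= /(fsubsetP AL) yL ->].
  by apply/imfsetP; exists y.
Qed.

Lemma connected_imfset A x y : linked A x y -> linked (phi @` A) (phi x) (phi y).
Proof.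
move=> [xA rxy]; split; first by rewrite mem_phi.
elim: rxy => {y} [y|y z _ IH yz zA].
  by rewrite inE => /eqP->; apply: reach_seed; rewrite inE.
by apply: (reach_step IH); rewrite ?phi_tadj ?mem_phi.
Qed.

End Transport.

Definition transpose (x : site) : site := (x.2, x.1).
Definition transpose_bond (b : bond) : bond := (transpose b.1, ~~ b.2).
Definition shift (d : site) (x : site) : site := (x.1 + d.1, x.2 + d.2).
Definition shift_bond (d : site) (b : bond) : bond := (shift d b.1, b.2).

Lemma transposeK : involutive transpose. Proof. by case. Qed.
Lemma transpose_bondK : involutive transpose_bond.
Proof. by case=> [[i j] o]; rewrite /transpose_bond /= negbK. Qed.
Lemma shiftK d : cancel (shift d) (shift (- d.1, - d.2)).
Proof. by case=> i j; rewrite /shift /= !addrK. Qed.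
Lemma shiftNK d : cancel (shift (- d.1, - d.2)) (shift d).
Proof. by case=> i j; rewrite /shift /= !subrK. Qed.
Lemma shift_bondK d : cancel (shift_bond d) (shift_bond (- d.1, - d.2)).
Proof. by case=> x o; rewrite /shift_bond /= shiftK. Qed.
Lemma shift_bondNK d : cancel (shift_bond (- d.1, - d.2)) (shift_bond d).
Proof. by case=> x o; rewrite /shift_bond /= shiftNK. Qed.

Section Averages.
Variables (R : rcfType) (t : R).
Let r : R := Num.sqrt 2.
Let rho : R := t * (1 + r).
Hypotheses (t0 : 0 < t) (rho1 : rho < 1).
Implicit Types (A B L D : {fset site}) (x y : site).

Let r0 : 0 <= r. Proof. exact: sqrtr_ge0. Qed.
Let rho0 : 0 < rho. Proof. by rewrite mulr_gt0 // ltr_wpDr. Qed.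
Let t01 : 0 < t <= 1.
Proof.
rewrite t0 /=; apply: ltW; apply: le_lt_trans rho1.
by rewrite /rho mulrDr mulr1 lerDl mulr_ge0 // ltW.
Qed.
Let wt0 A : 0 <= wt t A. Proof. by rewrite ltW // wt_gt0. Qed.

Definition tall (n : nat) A : Prop :=
  exists x y, linked A x y /\ n%:Z <= y.2 - x.2.

Definition big n A : bool := `[< wide n A \/ tall n A >].

Lemma bigP n A x y : linked A x y -> n%:Z <= `|y.1 - x.1| \/ n%:Z <= `|y.2 - x.2| ->
  big n A.
Proof.
move=> cxy h; have cyx := connected_sym cxy; apply/asboolP.
case: h => [h|h]; [left|right].
  have [s|s] := leP 0 (y.1 - x.1); first by exists x, y; rewrite ger0_norm in h.
  by exists y, x; split=> //; rewrite -opprB -ltr0_norm.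
have [s|s] := leP 0 (y.2 - x.2); first by exists x, y; rewrite ger0_norm in h.
by exists y, x; split=> //; rewrite -opprB -ltr0_norm.
Qed.

Lemma bigS n A D : A `<=` D -> (big n A)%:R <= (big n D)%:R :> R.
Proof.
move=> AD; rewrite ler_nat; case bA: (big n A) => //.
move/asboolP: bA => h; rewrite lt0b; apply/asboolP.
by case: h => -[x [y [c h]]]; [left|right]; exists x, y; split => //; exact: connectedS c.
Qed.

Definition avg D (F : {fset site} -> R) : R := psum D (fun A => F A * wt t A) / Z t D.

Lemma avg_ge0 D F : (forall A, 0 <= F A) -> 0 <= avg D F.
Proof.
move=> F0; rewrite divr_ge0 ?(ltW (Z_gt0 t01 D)) // psum_ge0 // => A _.
by rewrite mulr_ge0.
Qed.

Lemma ler_avg D F G : (forall A, A `<=` D -> F A <= G A) -> avg D F <= avg D G.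
Proof.
move=> FG; rewrite ler_wpM2r ?invr_ge0 ?(ltW (Z_gt0 t01 D)) //.
by apply: ler_psum => A AD; rewrite ler_wpM2r ?FG.
Qed.

Lemma eq_avg D F G : (forall A, A `<=` D -> F A = G A) -> avg D F = avg D G.
Proof. by move=> FG; congr (_ / _); apply: eq_psum => A AD; rewrite FG. Qed.

Lemma avgD D F G : avg D (fun A => F A + G A) = avg D F + avg D G.
Proof.
by rewrite -mulrDl -psumD; congr (_ / _); apply: eq_psum => A _; rewrite mulrDl.
Qed.

Lemma avgZ D c F : avg D (fun A => c * F A) = c * avg D F.
Proof. by rewrite mulrA -psumZ; congr (_ / _); apply: eq_psum => A _; rewrite mulrA. Qed.

Lemma avg_sum (I : Type) (s : seq I) D (F : I -> {fset site} -> R) :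
  avg D (fun A => \sum_(i <- s) F i A) = \sum_(i <- s) avg D (F i).
Proof.
rewrite /avg -mulr_suml -psum_sum; congr (_ / _).
by apply: eq_psum => A _; rewrite mulr_suml.
Qed.

Lemma avg_cst D c : avg D (fun=> c) = c.
Proof.
rewrite /avg psumZ mulfK //; exact: lt0r_neq0 (Z_gt0 t01 D).
Qed.

Lemma avg_mono D L F : D `<=` L -> (forall A B, A `<=` B -> F A <= F B) ->
  avg D F <= avg L F.
Proof.
move=> DL Fm; rewrite ler_pdivrMr ?Z_gt0 // mulrAC ler_pdivlMr ?Z_gt0 //.
by apply: expectation_mono => // A B AB _; exact: Fm.
Qed.

Lemma avg_inside B L F G : B `<=` L ->
  (forall A, 0 <= F A) -> (forall A D, A `<=` D -> F A <= F D) -> (forall A, 0 <= G A) ->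
  avg L (fun A => G (A `\` B) * F (inside B A)) <=
  avg B F * avg L (fun A => G (A `\` B)).
Proof.
move=> BL F0 Fm G0; have ZB := Z_gt0 t01 B; have ZL := Z_gt0 t01 L.
have := inside_le t01 BL F0 Fm G0 => il.
rewrite /avg mulrA ler_wpM2r ?invr_ge0 ?(ltW ZL) // mulrAC ler_pdivlMr //.
by under eq_psum do rewrite -mulrA.
Qed.

Definition big_const : R := 2 * crossing_const t.

Lemma big_prob (x0 x1 y0 y1 : int) (n : nat) (L := rect x0 x1 y0 y1) :
  avg L (fun A => (big n A)%:R) <= big_const * #|` L|%:R ^+ 2 * rho ^+ n.
Proof.
rewrite ler_pdivrMr ?Z_gt0 //.
have -> : big_const * #|` L|%:R ^+ 2 * rho ^+ n * Z t L =
  #|` L|%:R ^+ 2 * crossing_const t * rho ^+ n * Z t L +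
  #|` L|%:R ^+ 2 * crossing_const t * rho ^+ n * Z t L by rewrite /big_const; ring.
apply: (@le_trans _ _ (psum L (fun A => `[< wide n A >]%:R * wt t A) +
    psum L (fun A => `[< tall n A >]%:R * wt t A))).
  rewrite -psumD; apply: ler_psum => A _; rewrite -mulrDl ler_wpM2r // -natrD ler_nat.
  by rewrite /big asbool_or; case: `[< _ >]; case: `[< _ >].
apply: lerD; first exact: wide_prob.
(* Tall clusters become wide ones by transposition, which preserves [tadj] since its diagonal is (1,
   1). *)
pose L' := rect y0 y1 x0 x1.
have tK := transposeK; have tbK := transpose_bondK.
have tfst b : bond_fst (transpose_bond b) = transpose (bond_fst b) by [].
have tsnd b : bond_snd (transpose_bond b) = transpose (bond_snd b) by case: b => [[i j] []].
have ttadj x y : tadj (transpose x) (transpose y) = tadj x y.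
  by case: x y => [? ?] [? ?]; rewrite /tadj /nnadj /=; lia.
have LL' : L = transpose @` L'.
  apply/fsetP => x; rewrite -{2}(tK x) mem_imfset ?in_rect /=; last exact: can_inj tK.
  by case: x => [? ?] /=; lia.
have wtT A : wt t (transpose @` A) = wt t A by exact: (wt_imfset tK tbK tbK tfst tsnd).
have psT F : psum L F = psum L' (fun A => F (transpose @` A)).
  by rewrite LL'; exact: (psum_imfset tK tK).
have ZT : Z t L = Z t L' by rewrite /Z psT; apply: eq_psum => A _; exact: wtT.
have cT : #|` L| = #|` L'| by rewrite LL' card_imfset //; exact: can_inj tK.
rewrite psT ZT cT; apply: le_trans (wide_prob t0 rho1 _ _ _ _ n).
apply: ler_psum => A _; rewrite wtT ler_wpM2r // ler_nat; case: asboolP => // h.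
rewrite lt0b; apply/asboolP; case: h => x [y [c h]].
exists (transpose x), (transpose y); split => //.
have := connected_imfset tK ttadj c.
rewrite -[X in linked X](_ : A = _) //; apply/fsetP => z.
by rewrite -{2}(tK z) !mem_imfset //; exact: can_inj tK.
Qed.

Definition dens D x : R := avg D (fun A => (x \in A)%:R).

Lemma in_mono x A D : A `<=` D -> (x \in A)%:R <= (x \in D)%:R :> R.
Proof. by move=> /fsubsetP AD; rewrite ler_nat; case xA: (x \in A) => //; rewrite AD. Qed.

Lemma dens_mono D L x : D `<=` L -> dens D x <= dens L x.
Proof. by move=> DL; apply: avg_mono => // A B; exact: in_mono. Qed.

Lemma dens_ge0 D x : 0 <= dens D x. Proof. exact: avg_ge0. Qed.

Lemma dens_le1 D x : dens D x <= 1.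
Proof. by rewrite -[leRHS](avg_cst D); apply: ler_avg => A _; case: (_ \in _). Qed.

Let far_or_inside (n : nat) B L x A : A `<=` L ->
  (forall z : site, z \in L -> z \notin B -> n%:Z <= `|z.1 - x.1| \/ n%:Z <= `|z.2 - x.2|) ->
  (x \in A)%:R <= (x \in inside B A)%:R + (big n A)%:R :> R.
Proof.
move=> /fsubsetP AL farB; rewrite -natrD ler_nat; case xA: (x \in A) => //.
case bA: (big n A); first by rewrite addn1.
rewrite addn0 lt0b; apply: in_inside => // y rxy; apply/negPn/negP => yB.
have yA : y \in A by have := reach_in rxy; rewrite !inE => /orP[//|/eqP->].
by have := bigP (conj xA rxy) (farB _ (AL _ yA) yB); rewrite bA.
Qed.

(** Unless some cluster is big, the cluster of [x] stays inside [B], where it is dominated by the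
    plus state on [B]. *)
Lemma dens_local (n : nat) B L x : B `<=` L ->
  (forall z : site, z \in L -> z \notin B -> n%:Z <= `|z.1 - x.1| \/ n%:Z <= `|z.2 - x.2|) ->
  dens L x <= dens B x + avg L (fun A => (big n A)%:R).
Proof.
move=> BL farB; apply: (@le_trans _ _ (avg L (fun A => 1 * (x \in inside B A)%:R +
    (big n A)%:R))).
  by apply: ler_avg => A AL; rewrite mul1r; exact: far_or_inside AL farB.
rewrite avgD lerD2r; apply: le_trans (avg_inside (F := fun A => (x \in A)%:R)
  (G := fun=> 1) BL _ _ _) _ => //; first by move=> A D; exact: in_mono.
by rewrite avg_cst mulr1.
Qed.

(** Unless some cluster is big, that of [x] stays inside [B], where the domination by the plus state
    holds whatever the spin at [y]; hence a bound on the covariance. *)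
Lemma dens_correlation (n : nat) B L x y : B `<=` L -> y \notin B ->
  (forall z : site, z \in L -> z \notin B -> n%:Z <= `|z.1 - x.1| \/ n%:Z <= `|z.2 - x.2|) ->
  avg L (fun A => (x \in A)%:R * (y \in A)%:R) <=
  dens L x * dens L y + avg L (fun A => (big n A)%:R).
Proof.
move=> BL yB farB.
apply: (@le_trans _ _ (avg L (fun A => (y \in A `\` B)%:R * (x \in inside B A)%:R +
    (big n A)%:R))).
  apply: ler_avg => A AL; rewrite in_fsetD yB /=; have := far_or_inside AL farB.
  by case: (y \in A); rewrite ?mulr1 ?mul1r // mulr0 mul0r add0r.
rewrite avgD lerD2r; apply: le_trans (avg_inside (F := fun A => (x \in A)%:R)
  (G := fun A => (y \in A)%:R) BL _ _ _) _ => //; first by move=> A D; exact: in_mono.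
rewrite ler_pM ?avg_ge0 //; first exact: dens_mono.
by apply: ler_avg => A _; apply: in_mono; exact: fsubsetDl.
Qed.

Lemma dens_shift d L x : dens (shift d @` L) (shift d x) = dens L x.
Proof.
have sfst b : bond_fst (shift_bond d b) = shift d (bond_fst b) by [].
have ssnd b : bond_snd (shift_bond d b) = shift d (bond_snd b).
  by case: b => [[i j] []]; rewrite /bond_snd /shift /= addrAC.
have wtT A : wt t (shift d @` A) = wt t A.
  exact: (wt_imfset (@shiftK d) (@shift_bondK d) (@shift_bondNK d) sfst ssnd).
rewrite /dens /avg /Z !(psum_imfset (@shiftK d) (@shiftNK d)); congr (_ / _).
  apply: eq_psum => A _; rewrite wtT mem_imfset //; exact: can_inj (@shiftK d).
by apply: eq_psum => A _; exact: wtT.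
Qed.

End Averages.

(** * Binomial weights *)

Lemma psum_card (K : choiceType) (R : realFieldType) (D : {fset K}) (f : nat -> R) :
  psum D (fun A => f #|` A|) = \sum_(k < #|` D|.+1) 'C(#|` D|, k)%:R * f k.
Proof.
elim/fset_ind1: D f => [|x D xD IH] f.
  by rewrite psum_fset0 cardfs0 big_ord1 bin0 mul1r.
rewrite psumU1 // IH (@eq_psum _ _ D (fun A => f #|` x |` A|) (fun A => f #|` A|.+1)); last first.
  by move=> A AD; rewrite cardfsU1 (contra (fsubsetP AD x) xD).
rewrite (IH (fun k => f k.+1)) cardfsU1 xD add1n [RHS]big_ord_recl bin0 mul1r.
under [in RHS]eq_bigr do rewrite binS natrD mulrDl; rewrite big_split /= addrA; congr (_ + _).
rewrite [in RHS]big_ord_recr /= bin_small // mul0r addr0.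
by rewrite big_ord_recl bin0 mul1r.
Qed.

Section Binomial.
Variables (R : realType) (n : nat) (e : R).
Hypotheses (n0 : (0 < n)%N) (e0 : 0 < e).

Definition binw (k : nat) : R := 'C(n, k)%:R * e ^+ k.
Let p : R := e / (1 + e).
Definition bin_mean : R := n%:R * p.
(** Logarithmic slope of the weights: in a window of half-width a around the mean, consecutive ones
    differ by a factor at most exp (bin_rate * a / n). *)
Definition bin_rate : R := 2 * (1 + e) ^+ 2 / e.

Let e1 : 0 < 1 + e. Proof. by rewrite addr_gt0. Qed.
Let nR : 0 < n%:R :> R. Proof. by rewrite ltr0n. Qed.
Let binw_ge0 k : 0 <= binw k. Proof. by rewrite mulr_ge0 // exprn_ge0 // ltW. Qed.

Lemma sum_binw : \sum_(k < n.+1) binw k = (1 + e) ^+ n.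
Proof.
rewrite exprDn; apply: eq_bigr => k _.
by rewrite expr1n mul1r /binw mulr_natl.
Qed.

Lemma expR_quad (x : R) : x <= 2^-1 -> expR x <= 1 + x + 2 * x ^+ 2.
Proof.
move=> x1; have := expR_ge1Dx (- x); rewrite expRN => h.
have h1 : 0 < 1 - x by lra.
have : expR x <= (1 - x)^-1.
  by rewrite -[expR x]invrK lef_pV2 ?posrE ?invr_gt0 ?expR_gt0.
move/le_trans; apply; rewrite -[leLHS]mul1r ler_pdivrMr //.
have -> : (1 + x + 2 * x ^+ 2) * (1 - x) = 1 + x ^+ 2 * (1 - 2 * x) by ring.
by rewrite lerDl mulr_ge0 ?sqr_ge0 //; lra.
Qed.

Let p0 : 0 < p. Proof. by rewrite divr_gt0. Qed.
Let p1 : p < 1. Proof. by rewrite ltr_pdivrMr // mul1r ltrDr. Qed.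

(** Exponential tilting: [binw k * s ^+ k] is one term of the expansion of [(1 + e * s) ^+ n]. A
    negative [lam] is allowed, so that one bound serves both tails. *)
Lemma binw_chernoff (k : nat) (lam : R) : lam <= 2^-1 ->
  binw k <= (1 + e) ^+ n * expR (2 * n%:R * lam ^+ 2 - lam * (k%:R - bin_mean)).
Proof.
move=> lam1; set s := expR lam.
have s0 : 0 < s by exact: expR_gt0.
have step : 1 + e * s <= (1 + e) * expR (p * lam + 2 * lam ^+ 2).
  have := expR_quad lam1; rewrite -/s => sq.
  have pq : p * (1 + e) = e by rewrite /p mulfVK // gt_eqF.
  apply: le_trans (_ : (1 + e) * (1 + (p * lam + 2 * lam ^+ 2)) <= _); last first.
    by rewrite ler_wpM2l ?(ltW e1) // expR_ge1Dx.
  have -> : (1 + e) * (1 + (p * lam + 2 * lam ^+ 2)) =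
    1 + e * (1 + lam + 2 * lam ^+ 2) + 2 * lam ^+ 2 + (p * (1 + e) - e) * lam by ring.
  rewrite pq subrr mul0r addr0; apply: le_trans (_ : 1 + e * (1 + lam + 2 * lam ^+ 2) <= _).
    by rewrite lerD2l ler_wpM2l // ltW.
  by rewrite lerDl mulr_ge0 // sqr_ge0.
have ub : binw k * s ^+ k <= (1 + e * s) ^+ n.
  have [kn|nk] := leqP k n; last first.
    rewrite /binw bin_small // !mul0r exprn_ge0 // ltW // addr_gt0 // mulr_gt0 //.
  rewrite exprDn (bigD1 (Ordinal (kn : (k < n.+1)%N))) //= expr1n mul1r exprMn -mulr_natl.
  rewrite mulrA lerDl sumr_ge0 // => i _.
  by rewrite mulrn_wge0 // expr1n mul1r exprn_ge0 // ltW // mulr_gt0.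
have sk : 0 < s ^+ k by rewrite exprn_gt0.
rewrite -(ler_pM2r sk); apply: le_trans ub _.
have -> : s ^+ k = expR (lam * k%:R) by rewrite expRM_natr.
rewrite -(mulrA (_ ^+ n)) -expRD.
have -> : 2 * n%:R * lam ^+ 2 - lam * (k%:R - bin_mean) + lam * k%:R =
  (p * lam + 2 * lam ^+ 2) * n%:R by rewrite /bin_mean; ring.
rewrite expRM_natr -exprMn; apply: lerXn2r => //; rewrite nnegrE.
  by rewrite addr_ge0 // mulr_ge0 // ltW.
by rewrite mulr_ge0 ?expR_ge0 // ltW.
Qed.

Lemma binw_tail (k : nat) (h : R) : 0 <= h -> h <= `|k%:R - bin_mean| ->
  binw k <= (1 + e) ^+ n * expR (- (h ^+ 2 / (8 * n%:R))).
Proof.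
move=> h0 hk.
have [kn|nk] := leqP k n; last first.
  by rewrite /binw bin_small // mul0r mulr_ge0 ?expR_ge0 // exprn_ge0 // ltW.
have kn' : k%:R <= n%:R :> R by rewrite ler_nat.
have k0 : 0 <= k%:R :> R by [].
have mn : bin_mean <= n%:R by rewrite /bin_mean ler_piMr // ltW.
have m0 : 0 <= bin_mean by rewrite /bin_mean mulr_ge0 // ltW.
have hn : h <= n%:R by apply: le_trans hk _; rewrite ler_norml; apply/andP; split; lra.
(* The absolute value of [lam] minimizes [2 * n * lam ^+ 2 - lam * h]; it is small enough because
   [h <= n]. *)
pose lam := Num.sg (k%:R - bin_mean) * (h / (4 * n%:R)).
have q0 : 0 <= h / (4 * n%:R) by rewrite divr_ge0 // mulr_ge0.
have q1 : h / (4 * n%:R) <= 2^-1 by rewrite ler_pdivrMr ?mulr_gt0 //; lra.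
have sg1 : Num.sg (k%:R - bin_mean) ^+ 2 <= 1 :> R.
  by rewrite sqr_sg; case: (_ != 0).
have lam1 : lam <= 2^-1.
  apply: le_trans q1; rewrite /lam -[leRHS]mul1r ler_wpM2r //.
  by case: sgrP.
apply: le_trans (binw_chernoff k lam1) _.
rewrite ler_wpM2l ?exprn_ge0 ?(ltW e1) // ler_expR.
have -> : lam * (k%:R - bin_mean) = h / (4 * n%:R) * `|k%:R - bin_mean|.
  by rewrite /lam normrEsg; ring.
have lam2 : 2 * n%:R * lam ^+ 2 <= h ^+ 2 / (8 * n%:R).
  rewrite /lam exprMn; have -> : h ^+ 2 / (8 * n%:R) = 2 * n%:R * (1 * (h / (4 * n%:R)) ^+ 2).
    by field; rewrite gt_eqF.
  by rewrite ler_wpM2l ?mulr_ge0 // ler_wpM2r ?sqr_ge0.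
apply: le_trans (lerB lam2 (ler_wpM2l q0 hk)) _.
have -> : h / (4 * n%:R) * h = 2 * (h ^+ 2 / (8 * n%:R)) by field; rewrite gt_eqF.
by move: (h ^+ 2 / _) => y; lra.
Qed.

Lemma binw_succ (k : nat) : binw k.+1 * k.+1%:R = binw k * ((n%:R - k%:R) * e).
Proof.
have [kn|nk] := leqP k n; last first.
  by rewrite /binw !bin_small ?ltnS ?mul0r // ltnW.
rewrite /binw exprS -natrB //.
have -> : 'C(n, k.+1)%:R * (e * e ^+ k) * k.+1%:R = (k.+1 * 'C(n, k.+1))%:R * (e * e ^+ k) :> R.
  by rewrite natrM; ring.
by rewrite mul_bin_left natrM; ring.
Qed.

Lemma expR_inv_lower (x : R) : 0 <= x -> x <= 2^-1 -> expR (- (2 * x)) <= 1 - x.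
Proof.
move=> x0 x1; rewrite expRN -[leLHS]mul1r ler_pdivrMr ?expR_gt0 //.
have := expR_ge1Dx (2 * x) => h; apply: le_trans (_ : (1 - x) * (1 + 2 * x) <= _).
  nra.
by rewrite ler_wpM2l //; lra.
Qed.

Let rate_ge0 : 0 <= bin_rate.
Proof. by rewrite divr_ge0 ?mulr_ge0 ?sqr_ge0 // ltW. Qed.

(* The hypothesis on [a] keeps [k / n] away from [0] and [1]. *)
Lemma binw_ratio (k : nat) (a : R) : 1 <= a -> 2 * a * (1 + e) <= bin_mean ->
  `|k%:R - bin_mean| <= a ->
  binw k.+1 <= expR (bin_rate * (a / n%:R)) * binw k /\
  binw k <= expR (bin_rate * (a / n%:R)) * binw k.+1.
Proof.
move=> a1 am; rewrite ler_norml => /andP[k1 k2].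
set m := bin_mean in am k1 k2 *.
have m0 : 0 < m by rewrite /m /bin_mean mulr_gt0.
have ks : 0 < k.+1%:R :> R by [].
have kE : k.+1%:R = k%:R + 1 :> R by rewrite -addn1 natrD.
have num : (n%:R - k%:R) * e = m - (k%:R - m) * e.
  by rewrite /m /bin_mean /p; field; rewrite gt_eqF.
have x0 : 0 <= a / m by rewrite divr_ge0 //; lra.
have x1 : a / m * (1 + e) <= 2^-1.
  by rewrite mulrAC ler_pdivrMr //; lra.
have mx : m * (a / m) = a by rewrite mulrCA divff ?mulr1 // gt_eqF.
set x := a / m in x0 x1 mx.
have rateE : 2 * x * (1 + e) = bin_rate * (a / n%:R).
  by rewrite /x /bin_rate /m /bin_mean /p; field; rewrite !gt_eqF.
clearbody x.
have ex0 : 0 <= e * x by rewrite mulr_ge0 // ltW.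
have xx : x <= 2^-1 by move: x1; rewrite mulrDr mulr1; move: ex0; rewrite mulrC; lra.
have low1 : m * (1 - x) <= k.+1%:R by rewrite mulrBr mulr1 mx kE; lra.
have up1 : k.+1%:R <= m * (1 + 2 * x) by rewrite mulrDr mulr1 mulrCA mx kE; lra.
have num_up : (n%:R - k%:R) * e <= m * (1 + e * x).
  rewrite num mulrDr mulr1 mulrCA mx; have : - (k%:R - m) * e <= a * e.
    by rewrite ler_wpM2r ?(ltW e0) //; lra.
  lra.
have num_low : m * (1 - e * x) <= (n%:R - k%:R) * e.
  rewrite num mulrBr mulr1 mulrCA mx; have : (k%:R - m) * e <= a * e.
    by rewrite ler_wpM2r ?(ltW e0) //; lra.
  lra.
have i1 := expR_inv_lower x0 xx.
have exx : e * x <= 2^-1 by move: x1; rewrite mulrDr mulr1 mulrC; lra.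
have i2 := expR_inv_lower ex0 exx.
have j1 := expR_ge1Dx (e * x); have j2 := expR_ge1Dx (2 * x).
have b0 := binw_ge0 k; have succ := binw_succ k.
rewrite -rateE; set X := expR (2 * x * (1 + e)).
have X0 : 0 < X by exact: expR_gt0.
split.
  rewrite -(ler_pM2r ks) succ (_ : X * _ * _ = binw k * (X * k.+1%:R)); last by ring.
  rewrite ler_wpM2l //.
  apply: le_trans num_up _; apply: le_trans (_ : X * (m * (1 - x)) <= _); last first.
    by rewrite ler_wpM2l // ltW.
  rewrite mulrCA ler_pM2l //; apply: le_trans j1 _.
  apply: le_trans (_ : X * expR (- (2 * x)) <= _); last by rewrite ler_wpM2l // ltW.
  by rewrite /X -expRD ler_expR; move: ex0; lra.
rewrite -(ler_pM2r ks) -[leRHS]mulrA succ mulrCA ler_wpM2l //.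
apply: le_trans up1 _; apply: le_trans (_ : X * (m * (1 - e * x)) <= _); last first.
  by rewrite ler_wpM2l // ltW.
rewrite mulrCA ler_pM2l //; apply: le_trans j2 _.
apply: le_trans (_ : X * expR (- (2 * (e * x))) <= _); last by rewrite ler_wpM2l // ltW.
by rewrite /X -expRD ler_expR; lra.
Qed.

Lemma binw_window (k k' : nat) (a : R) : 1 <= a -> 2 * a * (1 + e) <= bin_mean ->
  `|k%:R - bin_mean| <= a -> `|k'%:R - bin_mean| <= a ->
  binw k <= expR (bin_rate * (a / n%:R) * `|k%:R - k'%:R|) * binw k'.
Proof.
move=> a1 am.
wlog suff up : k k' / forall d, k' = (k + d)%N -> `|k%:R - bin_mean| <= a ->
    `|k'%:R - bin_mean| <= a ->
    binw k <= expR (bin_rate * (a / n%:R) * d%:R) * binw k' /\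
    binw k' <= expR (bin_rate * (a / n%:R) * d%:R) * binw k.
  move=> h1 h2; have [kk|kk] := leqP k k'.
    have [] := up k k' (k' - k)%N _ h1 h2; first by rewrite subnKC.
    by rewrite distrC -natrB // ger0_norm.
  have [] := up k' k (k - k')%N _ h2 h1; first by rewrite subnKC // ltnW.
  by rewrite -natrB 1?ltnW // ger0_norm.
move=> d ->; elim: d => [|d IH] h1 h2.
  by rewrite addn0 mulr0 expR0 mul1r.
have h3 : `|(k + d)%:R - bin_mean| <= a.
  move: h1 h2; rewrite !ler_norml addnS -addn1 !natrD => /andP[? ?] /andP[? ?].
  by apply/andP; split; [|]; have : 0 <= d%:R :> R by []; lra.
have [r1 r2] := binw_ratio a1 am h3; have [i1 i2] := IH h1 h3.
have X0 := expR_ge0 (bin_rate * (a / n%:R) * d%:R).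
have Y0 := expR_ge0 (bin_rate * (a / n%:R)).
rewrite addnS -[d.+1]addn1 natrD mulrDr mulr1 expRD; split.
  by apply: le_trans i1 _; rewrite -(mulrA (expR _)) ler_wpM2l.
by apply: le_trans r1 _; rewrite (mulrC (expR (_ * d%:R))) -(mulrA (expR _)) ler_wpM2l.
Qed.

Lemma binw_lower (k : nat) (a : R) : 1 <= a -> 2 * a * (1 + e) <= bin_mean ->
  `|k%:R - bin_mean| <= a ->
  n.+1%:R * expR (- (a ^+ 2 / (8 * n%:R))) <= 2^-1 ->
  (1 + e) ^+ n <= 2 * n.+1%:R * expR (2 * bin_rate * (a ^+ 2 / n%:R)) * binw k.
Proof.
move=> a1 am ka tail; set c := expR _ in tail; set X := expR _.
have E0 : 0 <= (1 + e) ^+ n by rewrite exprn_ge0 // ltW.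
have X0 : 0 <= X by exact: expR_ge0.
have term (j : nat) : binw j <= X * binw k + (1 + e) ^+ n * c.
  have [ja|ja] := leP `|j%:R - bin_mean| a.
    apply: ler_wpDr; first by rewrite mulr_ge0 // expR_ge0.
    apply: le_trans (binw_window a1 am ja ka) _; rewrite ler_wpM2r // ler_expR.
    have -> : 2 * bin_rate * (a ^+ 2 / n%:R) = bin_rate * (a / n%:R) * (2 * a).
      by field; rewrite gt_eqF.
    rewrite ler_wpM2l //; first by rewrite mulr_ge0 // divr_ge0 //; lra.
    have -> : j%:R - k%:R = (j%:R - bin_mean) - (k%:R - bin_mean) by ring.
    by apply: le_trans (ler_normB _ _) _; lra.
  apply: ler_wpDl; first by rewrite mulr_ge0.
  by apply: binw_tail (ltW ja); lra.
have : (1 + e) ^+ n <= n.+1%:R * (X * binw k + (1 + e) ^+ n * c).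
  rewrite -sum_binw; apply: le_trans (ler_sum _ (fun (i : 'I_n.+1) _ => term i)) _.
  by rewrite sum_binw sumr_const card_ord -(mulr_natl (_ + _)).
rewrite mulrDr (mulrCA n.+1%:R _ c) => h.
have : (1 + e) ^+ n * (n.+1%:R * c) <= (1 + e) ^+ n * 2^-1 by rewrite ler_wpM2l.
have -> : 2 * n.+1%:R * X * binw k = 2 * (n.+1%:R * (X * binw k)) by ring.
by move: h; move: (n.+1%:R * (X * _)) ((1 + e) ^+ n * (_ * c)) => y z; lra.
Qed.

End Binomial.

(** * Resampling the free sites *)

Section FreeSites.
Implicit Types (R : realType) (A B D J L xi : {fset site}) (x y z : site).

(* The number of minus neighbours of [y] when [y] itself is plus. *)
Definition minus_nbrs y A : nat := dis (touching [fset y]) A.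

(** Turning a site with j minus neighbours from plus to minus replaces its j disagreements by 4 -
    j. *)
Definition site_weight R (t : R) (j : nat) : R := t ^+ (4 - j) / t ^+ j.

Lemma card_touching1 y : #|` touching [fset y]| = 4%N.
Proof.
have -> : touching [fset y] =
    (y, true) |` ((y, false) |` (((y.1 - 1, y.2), true) |` [fset ((y.1, y.2 - 1), false)])).
  apply/fsetP => b; rewrite touchingE !inE !bondE /= /bond_fst /bond_snd.
  by case: b y => [[i j] []] [y1 y2] /=; rewrite !siteE /=; lia.
rewrite !cardfsU1 !inE !bondE /= cardfs1 ?andbF /=.
by case: y => y1 y2 /=; clear; lia.
Qed.

Lemma touching1_other y b : b \in touching [fset y] -> exists2 z, nnadj y z &
  forall A, differ A b = ((y \in A) != (z \in A)).
Proof.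
rewrite touchingE !inE => /orP[/eqP <-|/eqP <-].
  by exists (bond_snd b) => //; exact: nnadj_bond.
exists (bond_fst b); first by rewrite nnadj_sym nnadj_bond.
by move=> A; rewrite /differ eq_sym.
Qed.

Lemma minus_nbrs_le4 y A : (minus_nbrs y A <= 4)%N.
Proof.
rewrite /minus_nbrs dis_card -(card_touching1 y); apply: fsubset_leq_card.
by apply/fsubsetP => b; rewrite in_fsetsep => /andP[].
Qed.

Lemma wt_addsite R (t : R) y A : 0 < t -> y \notin A ->
  wt t (y |` A) = site_weight t (minus_nbrs y A) * wt t A.
Proof.
move=> t0 yA; set j := minus_nbrs y A.
have AX : touching A `<=` touching (y |` A) by apply: touchingS; exact: fsubsetU1.
rewrite (wt_dis t AX) /wt; set X := touching _.
pose P (b : bond) := b \in touching [fset y].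
have filt A' : dis (seq.filter P X) A' = dis (touching [fset y]) A'.
  rewrite /dis /disagreements; apply: perm_big; apply: uniq_perm.
  - by rewrite filter_uniq ?fset_uniq.
  - exact: fset_uniq.
  move=> b; rewrite mem_filter /= /P; case by_: (b \in touching [fset y]) => //=.
  exact: (fsubsetP (touchingS (fsubsetUl [fset y] A)) _ by_).
have rest : dis (seq.filter (predC P) X) (y |` A) = dis (seq.filter (predC P) X) A.
  apply: eq_dis => b; rewrite mem_filter /= /P touchingE !inE negb_or => /andP[/andP[b1 b2] _].
  by rewrite /differ !inE (negPf b1) (negPf b2).
rewrite (dis_filter P X (y |` A)) (dis_filter P X A) rest !filt !exprD.
have -> : dis (touching [fset y]) (y |` A) = (4 - j)%N.
  rewrite -(card_touching1 y) /j /minus_nbrs !dis_card -cardfsDS; last first.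
    by apply/fsubsetP => b; rewrite in_fsetsep => /andP[].
  congr (#|` _|); apply/fsetP => b; rewrite in_fsetsep in_fsetD in_fsetsep.
  case bT: (b \in touching [fset y]); rewrite ?andbF //= andbT.
  have [z yz dE] := touching1_other bT; rewrite !dE !inE eqxx (negPf yA) /=.
  suff -> : (z == y) = false by case: (z \in A).
  by apply/negbTE/eqP => zy; move: yz; rewrite zy /nnadj; lia.
rewrite -/(minus_nbrs y A) -/j /site_weight mulrA mulfVK //.
by rewrite gt_eqF // exprn_gt0.
Qed.

Definition both_even x : bool := (2 %| x.1)%Z && (2 %| x.2)%Z.

Lemma both_even_nnadj x y : both_even x -> both_even y -> ~~ nnadj x y.
Proof. by rewrite /both_even /nnadj; case: x y => [? ?] [? ?] /=; lia. Qed.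

Lemma minus_nbrs_union y A D : y \notin A -> y \notin D ->
  (forall z, z \in D -> ~~ nnadj y z) -> minus_nbrs y (A `|` D) = minus_nbrs y A.
Proof.
move=> yA yD sep; apply: eq_dis => b /touching1_other[z yz dE].
rewrite !dE !inE (negPf yA) (negPf yD) /=.
by case zD: (z \in D); rewrite ?orbF //; have := sep _ zD; rewrite yz.
Qed.

Lemma wt_free R (t : R) j A D J : 0 < t -> [disjoint A & D] -> J `<=` D ->
  (forall y, y \in D -> both_even y) -> (forall y, y \in D -> minus_nbrs y A = j) ->
  wt t (A `|` J) = site_weight t j ^+ #|` J| * wt t A.
Proof.
move=> t0 dAD + De Dj; elim/fset_ind1: J => [_|y J yJ IH].
  by rewrite fsetU0 cardfs0 mul1r.
rewrite fsubUset fsub1set => /andP[yD JD].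
have yA : y \notin A by move/fdisjointP_sym: dAD; apply.
rewrite fsetUCA wt_addsite ?inE ?negb_or ?yA // IH // cardfsU1 yJ exprS -mulrA.
rewrite minus_nbrs_union //; first by rewrite Dj.
by move=> z /(fsubsetP JD) zD; apply: both_even_nnadj; exact: De.
Qed.

Section Decomposition.
Variables (L B : {fset site}).
Hypothesis BL : B `<=` L.

(** Even sites are never nearest neighbours, hence independent given the others; keeping them away
    from [B] for [tadj] prevents them from influencing the clusters inside [B]. *)
Definition free_sites : {fset site} :=
  [fset y in L | both_even y && all (fun z => (z != y) && ~~ tadj z y) (enum_fset B)].
Let Y := free_sites.
Definition fixed_sites : {fset site} := (L `\` B) `\` Y.
Let X := fixed_sites.

Lemma free_sitesP y : y \in Y ->
  [/\ y \in L, both_even y & forall z, z \in B -> (z != y) && ~~ tadj z y].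
Proof.
by rewrite in_fsetsep => /and3P[? ? /allP h]; split.
Qed.

Lemma majority_exists xi : exists j : nat,
  (#|` Y| <= 5 * #|` [fset y in Y | minus_nbrs y xi == j]|)%N.
Proof.
apply/not_existsP => none.
have lt (j : nat) : (5 * #|` [fset y in Y | minus_nbrs y xi == j]| < #|` Y|)%N.
  by rewrite ltnNge; apply/negP; exact: none.
pose f (j : nat) := #|` [fset y in Y | minus_nbrs y xi == j]|.
have : (#|` Y| <= \sum_(j < 5) f j)%N.
  have cE (P : pred site) : #|` [fset y in Y | P y]| = (\sum_(y <- Y) P y)%N.
    have -> : #|` [fset y in Y | P y]| = size (seq.filter P Y).
      apply: perm_size; apply: uniq_perm; rewrite ?fset_uniq ?filter_uniq ?fset_uniq //.
      by move=> b; rewrite in_fsetsep mem_filter andbC.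
    rewrite size_filter -sum1_count big_mkcond /=; apply: eq_bigr => y _.
    by case: (P y).
  rewrite /f; under eq_bigr do rewrite cE; rewrite exchange_big /= -sum1_size.
  apply: leq_sum => y _.
  have h : (minus_nbrs y xi < 5)%N by rewrite ltnS minus_nbrs_le4.
  by rewrite (bigD1 (Ordinal h)) //= eqxx.
rewrite !big_ord_recr big_ord0 /=.
have := lt 0%N; have := lt 1%N; have := lt 2%N; have := lt 3%N; have := lt 4%N.
by rewrite -!/(f _); move: (f _) (f _) (f _) (f _) (f _) #|` Y|; clear; lia.
Qed.

Definition majority xi : nat := projT1 (cid (majority_exists xi)).
(** It depends on [xi] alone, since the neighbours of a free site are neither free nor in [B];
    resampling therefore leaves it unchanged. *)
Definition resampled xi : {fset site} := [fset y in Y | minus_nbrs y xi == majority xi].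

Lemma resampled_card xi : (#|` Y| <= 5 * #|` resampled xi|)%N.
Proof. exact: (projT2 (cid (majority_exists xi))). Qed.

Lemma resampled_sub xi : resampled xi `<=` Y.
Proof. by apply/fsubsetP => y; rewrite in_fsetsep => /andP[]. Qed.

Lemma psum_decompose R (Phi : {fset site} -> R) :
  psum L Phi = psum X (fun xi => psum (Y `\` resampled xi) (fun J0 =>
    psum B (fun al => psum (resampled xi) (fun J => Phi (al `|` (xi `|` J0) `|` J))))).
Proof.
have YLB : Y `<=` L `\` B.
  apply/fsubsetP => y /free_sitesP[yL _ yB]; rewrite in_fsetD yL andbT.
  by apply/negP => /yB; rewrite eqxx.
have split1 (S T : {fset site}) : T `<=` S -> S = (S `\` T) `|` T.
  move=> TS; apply/fsetP => x; rewrite !inE; case xT: (x \in T); rewrite /= ?orbF //.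
  by rewrite (fsubsetP TS).
have disD (S T : {fset site}) : [disjoint (S `\` T) & T].
  by apply/fdisjointP => x; rewrite inE => /andP[].
rewrite {1}(split1 _ _ BL) {1}(split1 _ _ YLB) psumU; last by rewrite -split1.
rewrite psumU //; apply: eq_psum => xi _.
rewrite {1}(split1 _ _ (resampled_sub xi)) psumU //; apply: eq_psum => J0 _.
rewrite psum_exchange; apply: eq_psum => al _; apply: eq_psum => J _.
by congr Phi; rewrite fsetUA fsetUC fsetUA.
Qed.

Section Fiber.
Variables (xi J0 : {fset site}).
Hypotheses (xiX : xi `<=` X) (J0Y : J0 `<=` Y `\` resampled xi).
Let o := xi `|` J0.
Let F := resampled xi.
Let n := #|` F|.

(** No resampled site is adjacent to [B], so an exploration of [B] from outside does not see [J]. *)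
Lemma inside_free al J : al `<=` B -> J `<=` F -> inside B (al `|` o `|` J) = al `\` explored tadj o al.
Proof.
move=> /fsubsetP alB /fsubsetP JF.
have oB x : x \in o -> x \notin B.
  rewrite inE => /orP[/(fsubsetP xiX)|/(fsubsetP J0Y)].
    by rewrite !in_fsetD => /and3P[].
  rewrite in_fsetD => /andP[_ /free_sitesP[_ _ h]]; apply/negP => /h; by rewrite eqxx.
have JB x : x \in J -> forall z, z \in B -> (z != x) && ~~ tadj z x.
  by move=> /JF; rewrite in_fsetsep => /andP[/free_sitesP[]].
have JnB x : x \in J -> x \notin B by move=> /JB h; apply/negP => /h; rewrite eqxx.
have mem3 x : (x \in al `|` o `|` J) = [|| x \in al, x \in o | x \in J].
  by rewrite !inE !orbA.
have e1 : (al `|` o `|` J) `&` B = al.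
  apply/fsetP => x; rewrite in_fsetI mem3.
  case xal: (x \in al) => /=; first by rewrite alB.
  apply/negbTE/negP => /andP[/orP[xo|xJ] xB].
    by move/negP: (oB x xo); apply.
  by move/negP: (JnB _ xJ); apply.
have e2 : (al `|` o `|` J) `\` B = o `|` J.
  apply/fsetP => x; rewrite in_fsetD mem3.
  have -> : (x \in o `|` J) = (x \in o) || (x \in J) by rewrite in_fsetU.
  case xB: (x \in B) => /=.
    symmetry; apply/negbTE/negP => /orP[xo|xJ].
      by move/negP: (oB x xo); apply.
    by move/negP: (JnB _ xJ); apply.
  by case xal: (x \in al) => //; move/alB: xal; rewrite xB.
rewrite /inside e1 e2; congr (_ `\` _); apply/fsetP => x.
apply/exploredP/exploredP => -[xal rx]; split => //; last first.
  by apply: reach_seedS rx; exact: fsubsetUl.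
have : x \in o `|` J \/ reach tadj al o x.
  elim: rx {xal} => {x} [x|x y rx IH xy yal]; first by left.
  right; case: IH => [|rx']; last exact: reach_step rx' xy yal.
  rewrite in_fsetU => /orP[xo|xJ]; first exact: reach_step (reach_seed _ _ xo) xy yal.
  by have := JB _ xJ _ (alB _ yal); rewrite tadj_sym xy andbF.
case=> //; rewrite in_fsetU => /orP[xo|xJ].
  by have := oB _ xo; rewrite alB.
by have := JnB _ xJ; rewrite alB.
Qed.

Let disj al J : al `<=` B -> J `<=` F -> [/\ [disjoint al & o], [disjoint (al `|` o) & F] &
  forall y, y \in F -> minus_nbrs y (al `|` o) = majority xi].
Proof.
move=> /fsubsetP alB JF.
have xiP x : x \in xi -> (x \notin Y) /\ (x \notin B).
  by move/(fsubsetP xiX); rewrite !in_fsetD => /and3P[].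
have J0P x : x \in J0 -> [/\ x \in Y, x \notin F & x \notin B].
  move/(fsubsetP J0Y); rewrite in_fsetD => /andP[h1 h2]; split => //.
  by have [_ _ h] := free_sitesP h2; apply/negP => /h; rewrite eqxx.
have FP y : y \in F -> [/\ y \in Y, both_even y & forall z, z \in B -> (z != y) && ~~ tadj z y].
  by move/(fsubsetP (resampled_sub xi)) => yY; have [] := free_sitesP yY.
split.
- apply/fdisjointP => x xal; rewrite in_fsetU negb_or; apply/andP; split; apply/negP => h.
    by have [_] := xiP _ h; rewrite alB.
  by have [_ _] := J0P _ h; rewrite alB.
- apply/fdisjointP_sym => y yF; have [yY _ yB] := FP _ yF; rewrite !in_fsetU !negb_or.
  apply/and3P; split; apply/negP => h.
  + by have := yB _ (alB _ h); rewrite eqxx.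
  + by have [] := xiP _ h; rewrite yY.
  + by have [_] := J0P _ h; rewrite yF.
move=> y yF; have [yY ye yB] := FP _ yF.
have yxi : y \notin xi by apply/negP => /xiP[]; rewrite yY.
rewrite /o fsetUCA minus_nbrs_union //.
- by move: yF; rewrite in_fsetsep => /andP[_ /eqP].
- rewrite in_fsetU negb_or; apply/andP; split; apply/negP => h.
    by have := yB _ (alB _ h); rewrite eqxx.
  by have [_] := J0P _ h; rewrite yF.
move=> z; rewrite in_fsetU => /orP[/alB/yB/andP[_]|/J0P[zY _ _]].
  by rewrite /tadj negb_or nnadj_sym => /andP[].
by apply: both_even_nnadj => //; have [] := free_sitesP zY.
Qed.

Lemma fiber_sum R (t : R) (e := site_weight t (majority xi))
    (G : {fset site} -> nat -> R) : 0 < t ->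
  psum B (fun al => psum F (fun J => G al #|` al `|` o `|` J| * wt t (al `|` o `|` J))) =
  psum B (fun al => wt t (al `|` o) *
    \sum_(k < n.+1) binw n e k * G al (#|` al| + #|` o| + k)%N).
Proof.
move=> t0; apply: eq_psum => al alB.
have -> : \sum_(k < n.+1) binw n e k * G al (#|` al| + #|` o| + k)%N =
    psum F (fun J => e ^+ #|` J| * G al (#|` al| + #|` o| + #|` J|)%N).
  rewrite (psum_card F (fun k => e ^+ k * G al (#|` al| + #|` o| + k)%N)).
  by apply: eq_bigr => k _; rewrite mulrA.
rewrite -psumZ; apply: eq_psum => J JF; have [d1 d2 d3] := disj alB JF.
have JP y : y \in F -> both_even y.
  by move/(fsubsetP (resampled_sub xi))/free_sitesP => [].
rewrite (wt_free t0 d2 JF JP d3) (cardfsU _ J) (cardfsU al o).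
have -> : (al `|` o) `&` J = fset0.
  by apply/eqP; apply: fdisjointWr JF d2.
have -> : al `&` o = fset0 by apply/eqP.
by rewrite cardfs0 !subn0; ring.
Qed.

End Fiber.
End Decomposition.
End FreeSites.

Lemma half_gap (R : realFieldType) (a u v : R) : v <= a / 2 -> a < u -> a / 2 <= u - v.
Proof. by lra. Qed.

Lemma window_le (R : realFieldType) (a u v m : R) :
  1 <= a -> - a <= u - v - m -> 4 * a <= m -> v <= u.
Proof. by lra. Qed.

(** * Conditioning on the number of minus spins, one fiber at a time *)

Section Decoupling.
Variables (R : realType) (t : R).
Hypotheses (t0 : 0 < t) (rho1 : t * (1 + Num.sqrt 2) < 1).
Variables (L B : {fset site}).
Hypothesis BL : B `<=` L.
Implicit Types (A J al : {fset site}).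

Let t01 : 0 < t <= 1.
Proof.
rewrite t0 /=; apply: ltW; apply: le_lt_trans rho1.
by rewrite mulrDr mulr1 lerDl mulr_ge0 ?sqrtr_ge0 // ltW.
Qed.
Let wt0 A : 0 <= wt t A. Proof. by rewrite ltW // wt_gt0. Qed.
Let t4 : 0 < t ^+ 4. Proof. by rewrite exprn_gt0. Qed.

(** As [j <= 4], every site weight e lies between t^4 and t^(-4): these two constants bound 1 + e
    and the slope uniformly in the fiber. *)
Definition weight_max : R := 1 + (t ^+ 4)^-1.
Definition rate_max : R := 2 * weight_max ^+ 2 / t ^+ 4.

Let Y := free_sites L B.
Let y : R := #|` Y|%:R.
Hypothesis Y0 : (0 < #|` Y|)%N.

Let y0 : 0 < y. Proof. by rewrite ltr0n. Qed.
Let wm0 : 0 < weight_max. Proof. by rewrite addr_gt0 // invr_gt0. Qed.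

Section Fiber.
Variable xi : {fset site}.
Let F := resampled L B xi.
Let n := #|` F|.
Let e := site_weight t (majority L B xi).
Let m := bin_mean n e.

Let n0 : (0 < n)%N.
Proof. by have := resampled_card L B xi; rewrite -/Y -/F -/n; move: Y0; clear; lia. Qed.
Let nR : 0 < n%:R :> R. Proof. by rewrite ltr0n. Qed.

Let n_le : n%:R <= y.
Proof. by rewrite ler_nat; apply: fsubset_leq_card; exact: resampled_sub. Qed.

Let n_ge : y / 5 <= n%:R.
Proof.
by rewrite ler_pdivrMr // -natrM ler_nat mulnC; exact: resampled_card.
Qed.

Let majority_le4 : (majority L B xi <= 4)%N.
Proof.
have [F0|[z]] := fset_0Vmem F; first by move: n0; rewrite /n F0 cardfs0.
by rewrite in_fsetsep => /andP[_ /eqP <-]; exact: minus_nbrs_le4.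
Qed.

Let e_ge : t ^+ 4 <= e.
Proof.
case/andP: t01 => _ t1; rewrite /e /site_weight ler_pdivlMr ?exprn_gt0 //.
apply: (@le_trans _ _ (t ^+ 4)).
  by apply: ler_piMr; [exact: ltW | apply: exprn_ile1 => //; exact: ltW].
by apply: ler_wiXn2l; rewrite ?leq_subr // ltW.
Qed.

Let e_gt0 : 0 < e. Proof. exact: lt_le_trans e_ge. Qed.

Let e_le : e <= (t ^+ 4)^-1.
Proof.
case/andP: t01 => _ t1; rewrite /e /site_weight; apply: (@le_trans _ _ (t ^+ majority L B xi)^-1).
  apply: ler_piMl; first by rewrite invr_ge0 exprn_ge0 // ltW.
  by apply: exprn_ile1 => //; exact: ltW.
rewrite lef_pV2 ?posrE ?exprn_gt0 //.
by apply: ler_wiXn2l; rewrite ?majority_le4 // ltW.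
Qed.

Let e1_le : 1 + e <= weight_max. Proof. by rewrite lerD2l. Qed.

Let rate_le : bin_rate e <= rate_max.
Proof.
have e1 : 0 < 1 + e by rewrite addr_gt0.
apply: ler_pM.
- by rewrite mulr_ge0 ?sqr_ge0.
- by rewrite invr_ge0 ltW.
- rewrite ler_pM2l // ler_sqr ?nnegrE; [exact: e1_le | exact: ltW | exact: ltW].
- by rewrite lef_pV2 ?posrE.
Qed.

Let rate_ge0 : 0 <= bin_rate e.
Proof. by rewrite /bin_rate divr_ge0 ?(ltW e_gt0) // mulr_ge0 ?sqr_ge0. Qed.

Let mean_ge : y * t ^+ 4 / (5 * weight_max) <= m.
Proof.
have e1 : 0 < 1 + e by rewrite addr_gt0.
have -> : y * t ^+ 4 / (5 * weight_max) = y / 5 * (t ^+ 4 / weight_max).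
  by field; rewrite gt_eqF.
apply: ler_pM.
- by rewrite divr_ge0 // ltW.
- by rewrite divr_ge0 // ltW.
- exact: n_ge.
apply: ler_pM.
- exact: ltW.
- by rewrite invr_ge0 ltW.
- exact: e_ge.
- by rewrite lef_pV2 ?posrE.
Qed.

Let window_ok (a : R) : 0 <= a -> 20 * a * weight_max ^+ 2 <= y * t ^+ 4 ->
  2 * (2 * a) * (1 + e) <= m.
Proof.
move=> a0 h; apply: le_trans mean_ge; rewrite ler_pdivlMr ?mulr_gt0 //.
apply: le_trans h; have -> : 20 * a * weight_max ^+ 2 = 2 * (2 * a) * weight_max * (5 * weight_max).
  by ring.
apply: ler_wpM2r; first by rewrite mulr_ge0 // ltW.
by apply: ler_wpM2l; [rewrite !mulr_ge0 | exact: e1_le].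
Qed.

Let tail_le (a : R) : expR (- ((a / 2) ^+ 2 / (8 * n%:R))) <= expR (- (a ^+ 2 / (32 * y))).
Proof.
rewrite ler_expR lerN2; have -> : (a / 2) ^+ 2 / (8 * n%:R) = a ^+ 2 / (32 * n%:R).
  by field; rewrite gt_eqF.
apply: ler_wpM2l; first exact: sqr_ge0.
by rewrite lef_pV2 ?posrE ?mulr_gt0 // ler_pM2l.
Qed.

Let rate_n (c : R) : 0 <= c -> bin_rate e * (c / n%:R) <= 5 * rate_max * (c / y).
Proof.
move=> c0; have -> : 5 * rate_max * (c / y) = rate_max * (c / (y / 5)).
  by field; rewrite gt_eqF.
apply: ler_pM => //; first by rewrite divr_ge0.
by apply: ler_wpM2l => //; rewrite lef_pV2 ?posrE // divr_gt0.
Qed.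

Lemma hit_sum (N k : nat) : \sum_(i < n.+1) binw n e i * (k + i == N)%N%:R =
  (k <= N)%N%:R * binw n e (N - k).
Proof.
have [kN|Nk] := leqP k N; last first.
  rewrite mul0r big1 // => i _; case: eqP => [E|]; rewrite ?mulr0 //.
  by move: Nk; rewrite -E ltnNge leq_addr.
rewrite mul1r; have [h|h] := ltnP (N - k) n.+1; last first.
  rewrite big1 => [|i _]; first by rewrite /binw bin_small // mul0r.
  case: eqP => [E|]; rewrite ?mulr0 //; move: h; rewrite -E addKn => /(leq_trans (ltn_ord i)).
  by rewrite ltnn.
rewrite (bigD1 (Ordinal h)) //= subnKC // eqxx mulr1 big1 ?addr0 // => i iN.
have [E|_] := (k + i)%N =P N; last by rewrite mulr0.
by case/eqP: iN; apply: val_inj; rewrite /= -E addKn.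
Qed.

Variable J0 : {fset site}.
Hypotheses (xiX : xi `<=` fixed_sites L B) (J0Y : J0 `<=` Y `\` F).
Let o := xi `|` J0.

(** The binomial part must supply the minus sites missing from [o] and [al]. If the target
    [N - #|o|] is farther than [a] from its mean, the tail bound suffices. Otherwise the binomial
    weight depends on [al] only up to a factor [X]: replace it by [c1], apply the exploration bound,
    and change back. *)
Lemma fiber_cond_le (N : nat) (a : R) (f : {fset site} -> R) :
  1 <= a -> #|` B|%:R <= a / 2 -> 20 * a * weight_max ^+ 2 <= y * t ^+ 4 ->
  (forall A, 0 <= f A <= 1) -> (forall A D, A `<=` D -> f A <= f D) ->
  psum B (fun al => psum F (fun J => f (inside B (al `|` o `|` J)) *
    ((#|` al `|` o `|` J| == N)%:R * wt t (al `|` o `|` J)))) <=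
  expR (20 * rate_max * (a * #|` B|%:R / y)) * avg t B f *
    psum B (fun al => psum F (fun J =>
      (#|` al `|` o `|` J| == N)%:R * wt t (al `|` o `|` J))) +
  expR (- (a ^+ 2 / (32 * y))) * psum B (fun al => psum F (fun J => wt t (al `|` o `|` J))).
Proof.
move=> a1 Ba big f01 fm.
have f0 A : 0 <= f A by case/andP: (f01 A).
have f1 A : f A <= 1 by case/andP: (f01 A).
pose I al := al `\` explored tadj o al.
pose c al : R := (#|` al| + #|` o| <= N)%N%:R * binw n e (N - (#|` al| + #|` o|)).
have c0 al : 0 <= c al.
  by rewrite mulr_ge0 // mulr_ge0 // exprn_ge0 // ltW.
pose hit (A : {fset site}) (k : nat) : R := (k == N)%:R.
have T1 : psum B (fun al => psum F (fun J => (#|` al `|` o `|` J| == N)%:R *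
    wt t (al `|` o `|` J))) = psum B (fun al => wt t (al `|` o) * c al).
  rewrite (fiber_sum xiX J0Y hit t0); apply: eq_psum => al _.
  by rewrite /hit hit_sum.
have Tf : psum B (fun al => psum F (fun J => f (inside B (al `|` o `|` J)) *
    ((#|` al `|` o `|` J| == N)%:R * wt t (al `|` o `|` J)))) =
    psum B (fun al => f (I al) * (wt t (al `|` o) * c al)).
  transitivity (psum B (fun al => psum F (fun J =>
     (f (I al) * (#|` al `|` o `|` J| == N)%:R) * wt t (al `|` o `|` J)))).
    apply: eq_psum => al alB; apply: eq_psum => J JF.
    by rewrite (inside_free xiX J0Y alB JF) mulrA.
  rewrite (fiber_sum xiX J0Y (fun al k => f (I al) * (k == N)%:R) t0).
  apply: eq_psum => al _; rewrite mulrCA /c -hit_sum; congr (_ * _).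
  by rewrite mulr_sumr; apply: eq_bigr => k _; rewrite mulrCA.
have T0 : psum B (fun al => psum F (fun J => wt t (al `|` o `|` J))) =
    psum B (fun al => wt t (al `|` o) * (1 + e) ^+ n).
  transitivity (psum B (fun al => psum F (fun J =>
     (fun=> fun=> 1) al #|` al `|` o `|` J| * wt t (al `|` o `|` J)))).
    by apply: eq_psum => al _; apply: eq_psum => J _; rewrite mul1r.
  rewrite (fiber_sum xiX J0Y (fun=> fun=> 1) t0); apply: eq_psum => al _.
  by rewrite -sum_binw; congr (_ * _); apply: eq_bigr => k _; rewrite mulr1.
rewrite T1 Tf T0.
have avg0 : 0 <= avg t B f.
  by rewrite divr_ge0 ?(ltW (Z_gt0 t01 B)) // psum_ge0 // => A _; rewrite mulr_ge0.
have ob : forall al, al `<=` B -> #|` al|%:R <= #|` B|%:R :> R.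
  by move=> al alB; rewrite ler_nat fsubset_leq_card.
have [good|bad] := leP `|N%:R - #|` o|%:R - m| a; last first.
  apply: ler_wpDl.
    apply: mulr_ge0; first by rewrite mulr_ge0 // expR_ge0.
    by apply: psum_ge0 => al _; rewrite mulr_ge0.
  rewrite -psumZ; apply: ler_psum => al alB; rewrite [leRHS]mulrCA.
  apply: le_trans (_ : 1 * (wt t (al `|` o) * c al) <= _).
    by rewrite ler_wpM2r ?f1 // mulr_ge0.
  rewrite mul1r ler_wpM2l // /c; have [mN|_] := leqP; last first.
    by rewrite mul0r mulr_ge0 ?expR_ge0 // exprn_ge0 // addr_ge0 // ltW.
  rewrite mul1r; apply: le_trans (_ : (1 + e) ^+ n * expR (- ((a / 2) ^+ 2 / (8 * n%:R))) <= _).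
    apply: binw_tail => //; first by lra.
    rewrite natrB // natrD.
    have -> : N%:R - (#|` al|%:R + #|` o|%:R) - bin_mean n e =
      (N%:R - #|` o|%:R - m) - #|` al|%:R by rewrite /m; ring.
    have := lerB_dist (N%:R - #|` o|%:R - m) #|` al|%:R.
    have := ob _ alB; rewrite (ger0_norm (_ : 0 <= #|` al|%:R)) //; lra.
  by rewrite [leRHS]mulrC ler_wpM2l // exprn_ge0 // addr_ge0 // ltW.
apply: ler_wpDr.
  by rewrite mulr_ge0 ?expR_ge0 // psum_ge0 // => al _; rewrite mulr_ge0 // exprn_ge0 // addr_ge0 // ltW.
have wok := window_ok (le_trans ler01 a1) big.
have m4 : 4 * a <= m.
  apply: le_trans wok; have -> : 2 * (2 * a) * (1 + e) = 4 * a + 4 * a * e by ring.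
  by rewrite lerDl mulr_ge0 ?(ltW e_gt0) //; lra.
have good' := good; move: good'; rewrite ler_norml => /andP[g1 g2].
have oN : (#|` o| <= N)%N by rewrite -(ler_nat R); lra.
pose c1 := binw n e (N - #|` o|).
pose X := expR (bin_rate e * (2 * a / n%:R) * #|` B|%:R).
have cX al : al `<=` B -> c al <= X * c1 /\ c1 <= X * c al.
  move=> alB; have alb := ob _ alB.
  have aN : (#|` al| + #|` o| <= N)%N by rewrite -(ler_nat R) natrD; lra.
  rewrite /c aN mul1r.
  have al0 : 0 <= #|` al|%:R :> R by [].
  have w1 : `|(N - (#|` al| + #|` o|))%:R - bin_mean n e| <= 2 * a.
    by rewrite natrB // natrD -/m ler_norml; apply/andP; split; lra.
  have w2 : `|(N - #|` o|)%:R - bin_mean n e| <= 2 * a.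
    by rewrite natrB // -/m ler_norml; apply/andP; split; lra.
  have a2 : 1 <= 2 * a by lra.
  have dd : `|(N - (#|` al| + #|` o|))%:R - (N - #|` o|)%:R| <= #|` B|%:R :> R.
    by rewrite !natrB // natrD (_ : _ - _ = - #|` al|%:R); [rewrite normrN ger0_norm | ring].
  have dd' : `|(N - #|` o|)%:R - (N - (#|` al| + #|` o|))%:R| <= #|` B|%:R :> R.
    by rewrite distrC.
  have k0 : 0 <= bin_rate e * (2 * a / n%:R) by rewrite mulr_ge0 // divr_ge0 //; lra.
  split.
    apply: le_trans (binw_window n0 e_gt0 a2 wok w1 w2) _.
    rewrite ler_wpM2r ?mulr_ge0 ?exprn_ge0 ?(ltW e_gt0) // ler_expR.
    by rewrite ler_wpM2l.
  apply: le_trans (binw_window n0 e_gt0 a2 wok w2 w1) _.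
  rewrite ler_wpM2r ?mulr_ge0 ?exprn_ge0 ?(ltW e_gt0) // ler_expR.
  by rewrite ler_wpM2l.
have dBo : [disjoint B & o].
  apply/fdisjointP => x xB; rewrite in_fsetU negb_or; apply/andP; split; apply/negP => h.
    by have := fsubsetP xiX _ h; rewrite !in_fsetD xB andbF.
  have := fsubsetP J0Y _ h; rewrite in_fsetD => /andP[_ /free_sitesP[_ _ hB]].
  by have := hB _ xB; rewrite eqxx.
have expl : psum B (fun al => f (I al) * wt t (al `|` o)) <=
    avg t B f * psum B (fun al => wt t (al `|` o)).
  rewrite /avg mulrAC ler_pdivlMr ?Z_gt0 //.
  by apply: explored_le => // A D AD _; exact: fm.
have X0 : 0 <= X by exact: expR_ge0.
have c10 : 0 <= c1 by rewrite mulr_ge0 // exprn_ge0 // ltW.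
apply: (@le_trans _ _ (X * c1 * psum B (fun al => f (I al) * wt t (al `|` o)))).
  rewrite -psumZ; apply: ler_psum => al alB; rewrite mulrA mulrC ler_wpM2r ?mulr_ge0 //.
  by have [] := cX _ alB.
apply: (@le_trans _ _ (X * c1 * (avg t B f * psum B (fun al => wt t (al `|` o))))).
  by rewrite ler_wpM2l // mulr_ge0.
apply: (@le_trans _ _ (X * avg t B f * (X * psum B (fun al => wt t (al `|` o) * c al)))).
  have -> : X * c1 * (avg t B f * psum B (fun al => wt t (al `|` o))) =
    X * avg t B f * (c1 * psum B (fun al => wt t (al `|` o))) by ring.
  apply: ler_wpM2l; first by rewrite mulr_ge0.
  rewrite -!psumZ; apply: ler_psum => al alB.
  rewrite mulrC [leRHS]mulrCA ler_wpM2l //; by have [] := cX _ alB.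
have -> (P : R) : X * avg t B f * (X * P) = X * X * avg t B f * P by ring.
rewrite ler_wpM2r //; first by rewrite psum_ge0 // => al _; rewrite mulr_ge0.
(* The constant is 20 = 5 * 2 * 2: [n] is at least [y / 5], the window has half-width [2 * a], and
   the factor [X] is paid twice. *)
rewrite ler_wpM2r // /X -expRD ler_expR.
have := rate_n (_ : 0 <= 4 * a * #|` B|%:R); rewrite !mulr_ge0 //; last by lra.
move=> /(_ isT) rn.
set u := bin_rate e * (2 * a / n%:R) * _.
have -> : u + u = bin_rate e * (4 * a * #|` B|%:R / n%:R) by rewrite /u; field; rewrite gt_eqF.
apply: le_trans rn _; rewrite le_eqVlt; apply/orP; left; apply/eqP.
by field; rewrite gt_eqF.
Qed.

(** If [N] is within [a] of the mean in the fiber, [binw_lower] compares the whole fiber with the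
    configurations having exactly [N] minus sites. If not, a count within [a / 2] of [N] is in the
    Gaussian tail and carries at most a quarter of the fiber. *)
Lemma fiber_lower (N : nat) (a : R) : B = fset0 ->
  1 <= a -> 20 * a * weight_max ^+ 2 <= y * t ^+ 4 ->
  (y + 1) * expR (- (a ^+ 2 / (32 * y))) <= 4^-1 ->
  psum F (fun J => (`|#|` o `|` J|%:R - N%:R| <= a / 2)%R%:R * wt t (o `|` J)) <=
  2 * (y + 1) * expR (10 * rate_max * (a ^+ 2 / y)) *
    psum F (fun J => (#|` o `|` J| == N)%:R * wt t (o `|` J)) +
  4^-1 * psum F (fun J => wt t (o `|` J)).
Proof.
move=> B0 a1 big tail.
have w0 := wt0 o; have E0 : 0 <= (1 + e) ^+ n by rewrite exprn_ge0 // addr_ge0 // ltW.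
have fs (g : nat -> R) : psum F (fun J => g #|` o `|` J| * wt t (o `|` J)) =
    wt t o * \sum_(k < n.+1) binw n e k * g (#|` o| + k)%N.
  have := fiber_sum xiX J0Y (fun _ k => g k) t0.
  have psB f : psum B f = f fset0 :> R by rewrite B0 psum_fset0.
  rewrite !psB; cbv beta; rewrite fset0U cardfs0 => fs'.
  by rewrite -{}fs'; apply: eq_psum => J _.
have T1 := fs (fun k => (k == N)%:R); have S := fs (fun k => (`|k%:R - N%:R| <= a / 2)%R%:R).
have T0 : psum F (fun J => wt t (o `|` J)) = wt t o * (1 + e) ^+ n.
  transitivity (psum F (fun J => (fun=> 1) #|` o `|` J| * wt t (o `|` J))).
    by apply: eq_psum => J _; rewrite mul1r.
  rewrite (fs (fun=> 1)) -sum_binw; congr (_ * _).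
  by apply: eq_bigr => k _; rewrite mulr1.
have b0 k : 0 <= binw n e k by rewrite mulr_ge0 // exprn_ge0 // ltW.
have yn : n.+1%:R <= y + 1 by rewrite -addn1 natrD lerD2r.
rewrite /= in T1 S; rewrite S T1 T0 hit_sum mulrCA [X in _ + X]mulrCA -mulrDr ler_wpM2l //.
clear S T1 T0 fs.
have [good|bad] := leP `|N%:R - #|` o|%:R - m| a; last first.
  apply: ler_wpDl.
    apply: mulr_ge0; last by rewrite mulr_ge0.
    by apply: mulr_ge0; [rewrite mulr_ge0 // addr_ge0 // ltW | exact: expR_ge0].
  apply: (@le_trans _ _ (\sum_(k < n.+1) (1 + e) ^+ n * expR (- (a ^+ 2 / (32 * y))))).
    apply: ler_sum => k _; case: (leP _ (a / 2)) => [near|_]; last first.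
      by rewrite mulr0 mulr_ge0 // expR_ge0.
    rewrite mulr1; apply: le_trans (_ : (1 + e) ^+ n * expR (- ((a / 2) ^+ 2 / (8 * n%:R))) <= _).
      clear tail big; apply: binw_tail => //; first by rewrite divr_ge0 // (le_trans ler01).
      have := lerB_dist (N%:R - #|` o|%:R - m) (N%:R - (#|` o| + k)%:R).
      rewrite (distrC N%:R) (_ : _ - (N%:R - _) = k%:R - bin_mean n e).
        by move/(le_trans _); apply; exact: half_gap near bad.
      by rewrite natrD /m; ring.
    by rewrite ler_wpM2l.
  rewrite sumr_const card_ord -(mulr_natl (_ * _)) mulrCA mulrC ler_wpM2r //.
  by apply: le_trans tail; rewrite ler_wpM2r // expR_ge0.
apply: ler_wpDr; first by rewrite mulr_ge0.
have wok := window_ok (le_trans ler01 a1) big.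
have wok' : 2 * a * (1 + e) <= bin_mean n e.
  apply: le_trans wok; rewrite ler_wpM2r ?addr_ge0 ?(ltW e_gt0) //.
  by rewrite ler_pM2l // ler_peMl ?ler1n // (le_trans ler01).
have m4 : 4 * a <= m.
  apply: le_trans wok; have -> : 2 * (2 * a) * (1 + e) = 4 * a + 4 * a * e by ring.
  by rewrite lerDl mulr_ge0 ?(ltW e_gt0) // mulr_ge0 // (le_trans ler01).
have good' := good; move: good'; rewrite ler_norml => /andP[g1 g2].
have oN : (#|` o| <= N)%N by rewrite -(ler_nat R); exact: window_le a1 g1 m4.
rewrite oN mul1r; apply: (@le_trans _ _ ((1 + e) ^+ n)).
  rewrite -sum_binw; apply: ler_sum => k _; rewrite -[leRHS]mulr1 ler_wpM2l //.
  by rewrite lern1 leq_b1.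
have tail2 : (y + 1) * expR (- (a ^+ 2 / (32 * y))) <= 2^-1.
  by apply: le_trans tail _; rewrite lef_pV2 ?posrE // ler_nat.
clear tail big; apply: le_trans (binw_lower n0 e_gt0 a1 wok' (_ : `|(N - #|` o|)%:R - _| <= a) _) _.
- by rewrite natrB.
- apply: le_trans tail2.
  apply: ler_pM; rewrite ?expR_ge0 // ler_expR lerN2.
  apply: ler_wpM2l; first exact: sqr_ge0.
  rewrite lef_pV2 ?posrE ?mulr_gt0 //.
  by apply: ler_pM => //; rewrite ler_nat.
rewrite ler_wpM2r //; apply: ler_pM; rewrite ?expR_ge0 ?mulr_ge0 //.
  by rewrite ler_wpM2l.
have -> : 10 * rate_max * (a ^+ 2 / y) = 2 * (5 * rate_max * (a ^+ 2 / y)) by ring.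
by rewrite ler_expR -[leLHS]mulrA ler_pM2l //; exact: rate_n (sqr_ge0 a).
Qed.

End Fiber.
End Decoupling.

Section Summation.
Variables (R : realType) (t : R).
Hypotheses (t0 : 0 < t) (rho1 : t * (1 + Num.sqrt 2) < 1).
Variable L : {fset site}.

Lemma conditional_le (B : {fset site}) (N : nat) (a : R) (f : {fset site} -> R)
    (y := #|` free_sites L B|%:R) :
  B `<=` L -> (0 < #|` free_sites L B|)%N ->
  1 <= a -> #|` B|%:R <= a / 2 -> 20 * a * weight_max t ^+ 2 <= y * t ^+ 4 ->
  (forall A, 0 <= f A <= 1) -> (forall A D, A `<=` D -> f A <= f D) ->
  psum L (fun A => f (inside B A) * ((#|` A| == N)%:R * wt t A)) <=
  expR (20 * rate_max t * (a * #|` B|%:R / y)) * avg t B f *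
    psum L (fun A => (#|` A| == N)%:R * wt t A) + expR (- (a ^+ 2 / (32 * y))) * Z t L.
Proof.
move=> BL Y0 a1 Ba big f01 fm.
rewrite (psum_decompose BL (fun A => f (inside B A) * _)).
rewrite (psum_decompose BL (fun A => (#|` A| == N)%:R * _)) /Z (psum_decompose BL (wt t)).
rewrite -!psumZ -psumD; apply: ler_psum => xi xiX.
rewrite -!psumZ -psumD; apply: ler_psum => J0 J0Y.
exact: fiber_cond_le.
Qed.

(** Counts near [N] carry at least half of the weight, of which the unfavourable fibers account for
    at most a quarter; the rest is spread onto [N] itself. *)
Lemma count_lower (N : nat) (a : R) (y := #|` free_sites L fset0|%:R) :
  (0 < #|` free_sites L fset0|)%N ->
  1 <= a -> 20 * a * weight_max t ^+ 2 <= y * t ^+ 4 ->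
  (y + 1) * expR (- (a ^+ 2 / (32 * y))) <= 4^-1 ->
  2^-1 <= avg t L (fun A => (`|#|` A|%:R - N%:R| <= a / 2)%R%:R) ->
  Z t L <= 8 * (y + 1) * expR (10 * rate_max t * (a ^+ 2 / y)) *
    psum L (fun A => (#|` A| == N)%:R * wt t A).
Proof.
move=> Y0 a1 big tail half.
have t01 : 0 < t <= 1.
  rewrite t0 /=; apply: ltW; apply: le_lt_trans rho1.
  by rewrite mulrDr mulr1 lerDl mulr_ge0 ?sqrtr_ge0 // ltW.
have BL : fset0 `<=` L by exact: fsub0set.
set c := 2 * (y + 1) * expR (10 * rate_max t * (a ^+ 2 / y)).
have key : psum L (fun A => (`|#|` A|%:R - N%:R| <= a / 2)%R%:R * wt t A) <=
    c * psum L (fun A => (#|` A| == N)%:R * wt t A) + 4^-1 * Z t L.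
  rewrite (psum_decompose BL (fun A => (`|_| <= _)%R%:R * _)).
  rewrite (psum_decompose BL (fun A => (#|` A| == N)%:R * _)) /Z (psum_decompose BL (wt t)).
  rewrite -!psumZ -psumD; apply: ler_psum => xi xiX.
  rewrite -!psumZ -psumD; apply: ler_psum => J0 J0Y.
  rewrite !psum_fset0; cbv beta; rewrite fset0U.
  exact: (fiber_lower t0 rho1 Y0 xiX J0Y N erefl a1 big tail).
move: half; rewrite /avg ler_pdivlMr ?Z_gt0 // => half.
have := le_trans half key; move: (psum L _) (Z t L) => P W.
have -> : 8 * (y + 1) * expR (10 * rate_max t * (a ^+ 2 / y)) * P = 4 * (c * P).
  by rewrite /c; ring.
move: (c * P) => Q h.
have -> : W = 4 * (2^-1 * W - 4^-1 * W) by field.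
by rewrite ler_pM2l // lerBlDr.
Qed.

End Summation.

(** * Boxes, density and magnetization *)

Section Boxes.
Implicit Types (x y z : site) (k L n : nat) (A D : {fset site}).

Lemma card_rect (x0 y0 : int) (m n : nat) :
  #|` rect x0 (x0 + m%:Z - 1) y0 (y0 + n%:Z - 1)| = (m * n)%N.
Proof.
transitivity (size [seq ((x0 + i%:Z, y0 + j%:Z) : site) | i <- iota 0 m, j <- iota 0 n]).
  apply: perm_size; apply: uniq_perm; first exact: fset_uniq.
    apply: allpairs_uniq; rewrite ?iota_uniq // => -[i j] [i' j'] _ _ /= [e1 e2].
    by congr (_, _); lia.
  move=> x; rewrite -[LHS]/(x \in rect _ _ _ _) in_rect.
  apply/and4P/allpairsP => [[h1 h2 h3 h4]|[[i j] /= []]].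
    exists (absz (x.1 - x0)%R, absz (x.2 - y0)%R); split; rewrite /= ?mem_iota.
    - by move: h1 h2; clear; case: x => ? ? /=; lia.
    - by move: h3 h4; clear; case: x => ? ? /=; lia.
    - by apply/eqP; rewrite siteE /=; move: h1 h3; clear; case: x => ? ? /=; lia.
  by rewrite !mem_iota => ? ? -> /=; split; lia.
by rewrite size_allpairs !size_iota.
Qed.

Lemma in_box L x : (x \in box L) =
  [&& - (L./2)%:Z <= x.1, x.1 < L%:Z - (L./2)%:Z, - (L./2)%:Z <= x.2 & x.2 < L%:Z - (L./2)%:Z].
Proof.
apply/imfset2P/and4P => [[i /= ilt [j /= jlt ->]]|[h1 h2 h3 h4]] /=.
  by move: ilt jlt; rewrite !mem_iota; split; lia.
case: x h1 h2 h3 h4 => [x1 x2] /= h1 h2 h3 h4.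
exists (absz (x1 + (L./2)%:Z)%R); first by rewrite /= mem_iota; lia.
exists (absz (x2 + (L./2)%:Z)%R); first by rewrite /= mem_iota; lia.
by apply/eqP; rewrite siteE /=; lia.
Qed.

Lemma box_rect L : box L = rect (- (L./2)%:Z) (- (L./2)%:Z + L%:Z - 1)
  (- (L./2)%:Z) (- (L./2)%:Z + L%:Z - 1).
Proof.
by apply/fsetP => -[x1 x2]; rewrite in_box in_rect /=; lia.
Qed.

Lemma card_box L : #|` box L| = (L * L)%N.
Proof. by rewrite box_rect card_rect. Qed.

Lemma boxS k L : (k <= L)%N -> box k `<=` box L.
Proof.
move=> kL; apply/fsubsetP => -[x1 x2]; rewrite !in_box /=.
have := odd_double_half k; have := odd_double_half L.
by case: (odd k); case: (odd L) => /=; lia.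
Qed.

Lemma shift_box L x : x \in box L ->
  shift (- x.1, - x.2) @` box L `<=` box (2 * L).
Proof.
case: x => [x1 x2]; rewrite in_box /= => xL; apply/fsubsetP => z /imfsetP[[w1 w2] /=].
rewrite in_box /= => wL ->; rewrite in_box /shift /= mul2n doubleK.
by have := odd_double_half L; case: (odd L) => /=; lia.
Qed.

Lemma shift_inner k L x : (k <= L)%N ->
  x \in rect (- (L./2)%:Z + (k./2)%:Z) (- (L./2)%:Z + (k./2)%:Z + (L - k).+1%:Z - 1)
    (- (L./2)%:Z + (k./2)%:Z) (- (L./2)%:Z + (k./2)%:Z + (L - k).+1%:Z - 1) ->
  shift x @` box k `<=` box L.
Proof.
case: x => [x1 x2] kL; rewrite in_rect /= => xL; apply/fsubsetP => z /imfsetP[[w1 w2] /=].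
rewrite in_box /= => wL ->; rewrite in_box /shift /=; lia.
Qed.

Lemma inner_sub k L : (k <= L)%N -> (0 < k)%N ->
  rect (- (L./2)%:Z + (k./2)%:Z) (- (L./2)%:Z + (k./2)%:Z + (L - k).+1%:Z - 1)
    (- (L./2)%:Z + (k./2)%:Z) (- (L./2)%:Z + (k./2)%:Z + (L - k).+1%:Z - 1) `<=` box L.
Proof.
move=> kL k0; apply/fsubsetP => -[x1 x2]; rewrite in_rect in_box /=.
by have := odd_double_half k; case: (odd k) => /=; lia.
Qed.

Lemma box_step k (z : site) : z \notin box k ->
  (k./2)%:Z <= `|z.1 - (0 : int)| \/ (k./2)%:Z <= `|z.2 - (0 : int)|.
Proof.
case: z => [z1 z2]; rewrite in_box /= !subr0 => zk; apply/orP; move: zk.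
by have := odd_double_half k; case: (odd k) => /=; lia.
Qed.

(** About a quarter of the box has even coordinates, and a site of [B] excludes at most its 3 by 3
    block. The shift [m] is even, so that [phi] takes even values. *)
Lemma card_free_sites L (B : {fset site}) :
  ((L./2) * (L./2) <= #|` free_sites (box L) B| + 9 * #|` B|)%N.
Proof.
pose h := L./2; pose m := (h./2).*2.
pose phi (x : site) : site := (2 * x.1 - m%:Z, 2 * x.2 - m%:Z).
have phi_inj : injective phi.
  by case=> [x1 x2] [y1 y2] [e1 e2]; congr (_, _); lia.
pose E := phi @` rect 0 (0 + h%:Z - 1) 0 (0 + h%:Z - 1).
have cE : #|` E| = (h * h)%N by rewrite card_imfset // -[LHS]/(#|` rect _ _ _ _|) card_rect.
pose near (z : site) := [fset ((z.1 + d.1, z.2 + d.2) : site) | d in rect (-1) (-1 + 3%:Z - 1) (-1) (-1 + 3%:Z - 1)].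
pose U : {fset site} := \bigcup_(z <- B) near z.
have cU : (#|` U| <= 9 * #|` B|)%N.
  have gen (s : seq site) : (#|` \bigcup_(z <- s) near z| <= 9 * size s)%N.
    elim: s => [|z s IH]; first by rewrite big_nil cardfs0.
    rewrite big_cons; apply: leq_trans (_ : #|` near z| + #|` \bigcup_(z <- s) near z| <= _)%N.
      by rewrite cardfsU leq_subr.
    have : (#|` near z| <= 9)%N.
      by apply: leq_trans (leq_imfset_card _ _ _) _; rewrite -[X in (X <= _)%N]/(#|` rect _ _ _ _|) card_rect.
    by move: IH => /=; lia.
  exact: gen.
rewrite -cE; apply: leq_trans (_ : #|` free_sites (box L) B `|` U| <= _)%N; last first.
  by apply: leq_trans (_ : #|` free_sites (box L) B| + #|` U| <= _)%N;
    [rewrite cardfsU leq_subr | rewrite leq_add2l].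
apply: fsubset_leq_card; apply/fsubsetP => y /imfsetP[[i j] /=].
rewrite in_rect /= => ij ->; rewrite in_fsetU.
case yU: (_ \in U); rewrite ?orbT // orbF in_fsetsep; apply/and3P; split.
- rewrite in_box /phi /=; have := odd_double_half L; have := odd_double_half h.
  by move: ij; rewrite /m /h; case: (odd L); case: (odd L./2) => /=; lia.
- by rewrite /both_even /phi /m /=; lia.
- apply/allP => z zB; apply/negPn/negP => nz; move/negP: yU; apply.
  apply/bigfcupP; exists z; first by rewrite zB.
  move: (phi (i, j)) nz => P nz.
  apply/imfsetP; exists (P.1 - z.1, P.2 - z.2); last first.
    by apply/eqP; rewrite siteE /= !subrKC !eqxx.
  rewrite /= in_rect /=; move: nz; rewrite negb_and !negbK siteE /tadj /nnadj.
  by case: z P {zB} => [z1 z2] [p1 p2] /=; clear; lia.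
Qed.

Definition near D x (n : nat) : {fset site} :=
  [fset y in D | y \in rect (x.1 - n%:Z) (x.1 + n%:Z) (x.2 - n%:Z) (x.2 + n%:Z)].

Lemma near_sub D x n : near D x n `<=` D.
Proof. by apply/fsubsetP => y; rewrite in_fsetsep => /andP[]. Qed.

Lemma card_near D x n : (#|` near D x n| <= (2 * n + 1) ^ 2)%N.
Proof.
have -> : ((2 * n + 1) ^ 2 = #|` rect (x.1 - n%:Z) (x.1 - n%:Z + (2 * n + 1)%N%:Z - 1)
    (x.2 - n%:Z) (x.2 - n%:Z + (2 * n + 1)%N%:Z - 1)|)%N by rewrite card_rect.
apply: fsubset_leq_card; apply/fsubsetP => y; rewrite in_fsetsep => /andP[_].
by rewrite !in_rect; lia.
Qed.

Lemma card_indicator (R : pzSemiRingType) A D : A `<=` D ->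
  #|` A|%:R = \sum_(x <- D) (x \in A)%:R :> R.
Proof.
move=> AD; rewrite -natr_sum -sum1_size -(big_fset_incl _ AD).
  by congr (_%:R); rewrite big_seq [RHS]big_seq; apply: eq_bigr => x ->.
by move=> x _ /negbTE ->.
Qed.

End Boxes.

Lemma pow_le_expR (R : realType) (lam x : R) (d : nat) : 0 < lam -> 0 <= x ->
  x ^+ d <= (d.+1%:R / lam) ^+ d * expR (lam * x).
Proof.
move=> lam0 x0; have d0 : 0 < d.+1%:R :> R by [].
have -> : x ^+ d = (d.+1%:R / lam) ^+ d * (lam * x / d.+1%:R) ^+ d.
  rewrite -exprMn; congr (_ ^+ d); move: (d.+1%:R : R) d0 => e e0.
  by field; rewrite !lt0r_neq0.
apply: ler_wpM2l; first by rewrite exprn_ge0 // divr_ge0 // ltW.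
have y0 : 0 <= lam * x / d.+1%:R by rewrite divr_ge0 // mulr_ge0 // ltW.
apply: le_trans (_ : expR (lam * x / d.+1%:R) ^+ d <= _).
  rewrite lerXn2r ?nnegrE ?expR_ge0 //; apply: le_trans (expR_ge1Dx _).
  by rewrite lerDr.
rewrite -expRM_natl ler_expR.
have -> : d%:R * (lam * x / d.+1%:R) = lam * x * (d%:R / d.+1%:R) by ring.
rewrite -[leRHS]mulr1.
apply: ler_wpM2l; first by rewrite mulr_ge0 // ltW.
by rewrite ler_pdivrMr // mul1r ler_nat.
Qed.

Lemma pow_geometric_bounded (R : realType) (rho : R) (d : nat) : 0 < rho < 1 ->
  exists2 C : R, 0 < C & forall k, k.+1%:R ^+ d * rho ^+ k <= C.
Proof.
move=> /andP[r0 r1]; have lam0 : 0 < - ln rho by rewrite oppr_gt0 ln_lt0 // r0.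
exists ((d.+1%:R / - ln rho) ^+ d * rho^-1).
  by rewrite mulr_gt0 ?invr_gt0 // exprn_gt0 // divr_gt0.
move=> k; have k0 : 0 <= k.+1%:R :> R by [].
have h := pow_le_expR d lam0 k0.
apply: le_trans (_ : (d.+1%:R / - ln rho) ^+ d * expR (- ln rho * k.+1%:R) * rho ^+ k <= _).
  by apply: ler_wpM2r => //; rewrite exprn_ge0 // ltW.
rewrite -mulrA; apply: ler_wpM2l; first by rewrite exprn_ge0 // divr_ge0 // ltW.
have -> : expR (- ln rho * k.+1%:R) = (rho ^+ k.+1)^-1.
  by rewrite mulNr expRN mulrC expRM_natl lnK // posrE.
rewrite exprSr invfM mulrAC mulVf ?mul1r //.
by rewrite expf_neq0 // lt0r_neq0.
Qed.

Lemma fsum_subset_le (R : numDomainType) (K : choiceType) (A B : {fset K}) (F : K -> R) :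
  A `<=` B -> (forall x, x \in B -> x \notin A -> 0 <= F x) ->
  \sum_(x <- A) F x <= \sum_(x <- B) F x.
Proof.
move=> AB F0; rewrite [leRHS](bigID (mem A)) /=.
have -> : \sum_(x <- B | x \in A) F x = \sum_(x <- A) F x.
  rewrite -big_filter; apply: perm_big; apply: uniq_perm; rewrite ?filter_uniq ?fset_uniq //.
  by move=> x; rewrite mem_filter; case xA: (x \in A) => //=; rewrite (fsubsetP AB).
by rewrite lerDl big_seq_cond sumr_ge0 // => x /andP[]; exact: F0.
Qed.

Lemma inner_area (R : realDomainType) (k l : R) : 0 <= k -> k <= l ->
  l ^+ 2 - 2 * k * l <= (l - k + 1) * (l - k + 1).
Proof. move=> *; nra. Qed.

(** * Density of minus spins and moments of their number *)

Section Statistics.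
Variables (R : realType) (t : R).
Let rho : R := t * (1 + Num.sqrt 2).
Hypotheses (t0 : 0 < t) (rho1 : rho < 1).
Implicit Types (A B D : {fset site}) (x y z : site).

Let rho0 : 0 < rho.
Proof. by rewrite mulr_gt0 // ltr_wpDr // sqrtr_ge0. Qed.

Definition density (k : nat) : R := dens t (box k) (0, 0).

Lemma density_mono k L : (k <= L)%N -> density k <= density L.
Proof. by move=> kL; apply: dens_mono => //; exact: boxS. Qed.

Lemma dens_box_le L x : x \in box L -> dens t (box L) x <= density (2 * L).
Proof.
move=> xL; rewrite -(dens_shift t (- x.1, - x.2)) /shift /= !subrr.
by apply: dens_mono => //; exact: shift_box.
Qed.

Lemma dens_box_ge k L x : (k <= L)%N ->
  x \in rect (- (L./2)%:Z + (k./2)%:Z) (- (L./2)%:Z + (k./2)%:Z + (L - k).+1%:Z - 1)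
    (- (L./2)%:Z + (k./2)%:Z) (- (L./2)%:Z + (k./2)%:Z + (L - k).+1%:Z - 1) ->
  density k <= dens t (box L) x.
Proof.
move=> kL xL; rewrite /density -(dens_shift t x).
have -> : shift x (0, 0) = x by case: (x) => ? ?; rewrite /shift /= !add0r.
by apply: dens_mono => //; exact: shift_inner.
Qed.

Lemma big_box L n : avg t (box L) (fun A => (big n A)%:R) <=
  big_const t * L%:R ^+ 4 * rho ^+ n.
Proof.
have h : avg t (box L) (fun A => (big n A)%:R) <=
    big_const t * #|` box L|%:R ^+ 2 * rho ^+ n by rewrite box_rect; exact: big_prob.
by move: h; rewrite card_box natrM -expr2 -exprM.
Qed.

Lemma density_step k : density k.+1 <= density k + big_const t * k.+1%:R ^+ 4 * rho ^+ k./2.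
Proof.
apply: (@le_trans _ _ (density k + avg t (box k.+1) (fun A => (big k./2 A)%:R))).
  apply: dens_local => //; first by apply: boxS.
  by move=> z _; exact: box_step.
by rewrite lerD2l big_box.
Qed.

Lemma big_const_ge0 : 0 <= big_const t.
Proof. by rewrite mulr_ge0 // sqrtr_ge0. Qed.

(** The increments decay like a power times [rho ^+ k./2], hence faster than k^(-4), and the sum is
    controlled by telescoping: 1 / (m + 1)^4 is at most 1 / m^2 - 1 / (m + 1)^2. *)
Lemma density_gap : exists2 C : R, 0 < C & forall k L, (0 < k <= L)%N ->
  density L <= density k + C / k%:R ^+ 2.
Proof.
have [C1 C10 HC] := @pow_geometric_bounded R rho 8 (introT andP (conj rho0 rho1)).
exists (big_const t * 2 ^+ 8 * C1 + 1).
  by rewrite ltr_wpDl // mulr_ge0 ?(ltW C10) // mulr_ge0 ?big_const_ge0 // exprn_ge0.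
set C := _ + 1.
have C0 : 0 <= C.
  by rewrite addr_ge0 // mulr_ge0 ?(ltW C10) // mulr_ge0 ?big_const_ge0 // exprn_ge0.
have stepC k : (0 < k)%N ->
    big_const t * k.+1%:R ^+ 4 * rho ^+ k./2 <= C / k.+1%:R ^+ 4.
  move=> k0; rewrite ler_pdivlMr ?exprn_gt0 ?ltr0n //.
  have -> : big_const t * k.+1%:R ^+ 4 * rho ^+ k./2 * k.+1%:R ^+ 4 =
    big_const t * (k.+1%:R ^+ 8 * rho ^+ k./2) by rewrite (exprD _ 4 4); ring.
  rewrite /C -[leLHS]addr0; apply: lerD => //; rewrite -mulrA.
  apply: ler_wpM2l; first exact: big_const_ge0.
  apply: le_trans (_ : 2 ^+ 8 * (k./2.+1%:R ^+ 8 * rho ^+ k./2) <= _); last exact: ler_wpM2l.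
  rewrite mulrA; apply: ler_wpM2r; first by rewrite exprn_ge0 // ltW.
  rewrite -exprMn lerXn2r ?nnegrE // -natrM ler_nat.
  by have := odd_double_half k; case: (odd k) => /=; lia.
move=> k L /andP[k0]; elim: L => [|L IH]; first by rewrite leqn0 => /eqP E; rewrite E in k0.
suff main L' : (k <= L')%N -> density L' + C / L'%:R ^+ 2 <= density k + C / k%:R ^+ 2.
  move=> /main; apply: le_trans; rewrite lerDl divr_ge0 // exprn_ge0.
elim: L' => [|m IHm]; first by rewrite leqn0 => /eqP ->.
rewrite leq_eqVlt => /orP[/eqP <- //|km]; apply: le_trans (IHm km).
have m0 : (0 < m)%N by exact: leq_trans k0 km.
apply: le_trans (_ : density m + big_const t * m.+1%:R ^+ 4 * rho ^+ m./2 + C / m.+1%:R ^+ 2 <= _).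
  by rewrite lerD2r density_step.
rewrite -addrA lerD2l; apply: le_trans (_ : C / m.+1%:R ^+ 4 + C / m.+1%:R ^+ 2 <= _).
  by rewrite lerD2r stepC.
rewrite -mulrDr; apply: ler_wpM2l => //.
have x0 : 0 < m%:R :> R by rewrite ltr0n.
rewrite -natr1; move: (m%:R : R) x0 => x x0.
have y0 : 0 < x + 1 by rewrite ltr_wpDr.
rewrite -subr_ge0.
have -> : (x ^+ 2)^-1 - (((x + 1) ^+ 4)^-1 + ((x + 1) ^+ 2)^-1) =
   (2 * x ^+ 3 + 4 * x ^+ 2 + 4 * x + 1) / (x ^+ 2 * (x + 1) ^+ 4).
  by field; rewrite !lt0r_neq0.
by rewrite divr_ge0 //; [nra | rewrite mulr_ge0 ?exprn_ge0 // ltW].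
Qed.

Lemma avg_card D : avg t D (fun A => #|` A|%:R) = \sum_(x <- D) dens t D x.
Proof.
by rewrite -avg_sum; apply: eq_avg => A AD; exact: card_indicator.
Qed.

(** In the variance, a pair at distance at most [k] counts for at most 1, and any other pair for at
    most the probability of a big cluster, by [dens_correlation]. *)
Lemma second_moment D (k : nat) (c : R) :
  avg t D (fun A => (#|` A|%:R - c) ^+ 2) <=
  (avg t D (fun A => #|` A|%:R) - c) ^+ 2 + #|` D|%:R * (2 * k + 1)%:R ^+ 2 +
  #|` D|%:R ^+ 2 * avg t D (fun A => (big k A)%:R).
Proof.
set p := avg t D (fun A => (big k A)%:R).
set M := avg t D (fun A => #|` A|%:R).
have ME : M = \sum_(x <- D) dens t D x by exact: avg_card.
pose B x := near D x k.
have cB x : (#|` B x| <= (2 * k + 1) ^ 2)%N by exact: card_near.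
have sq : avg t D (fun A => #|` A|%:R ^+ 2) <= M ^+ 2 + #|` D|%:R * (2 * k + 1)%:R ^+ 2 +
    #|` D|%:R ^+ 2 * p.
  have -> : avg t D (fun A => #|` A|%:R ^+ 2) =
      \sum_(x <- D) \sum_(y <- D) avg t D (fun A => (x \in A)%:R * (y \in A)%:R).
    under eq_bigr do rewrite -avg_sum.
    rewrite -avg_sum; apply: eq_avg => A AD; rewrite expr2 (card_indicator R AD) mulr_suml.
    by apply: eq_bigr => x _; rewrite mulr_sumr.
  have sumc (a : R) : \sum_(x <- D) a = #|` D|%:R * a.
    by rewrite big_const_seq count_predT iter_addr addr0 -[LHS]mulr_natl.
  apply: (@le_trans _ _ (\sum_(x <- D) \sum_(y <- D)
      (dens t D x * dens t D y + (y \in B x)%:R + p))).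
    rewrite big_seq [leRHS]big_seq; apply: ler_sum => x xD; apply: ler_sum => y _.
    case yB: (y \in B x).
      apply: (@le_trans _ _ 1).
        rewrite -[leRHS](avg_cst t0 rho1 D); apply: ler_avg => // A _.
        by case: (x \in A); case: (y \in A); rewrite ?mulr1 ?mulr0.
      rewrite addrAC lerDr; apply: addr_ge0; last by apply: (avg_ge0 t0 rho1) => A.
      by apply: mulr_ge0; exact: (dens_ge0 t0 rho1).
    rewrite addr0; apply: (@dens_correlation _ _ t0 rho1 k (B x)); rewrite ?yB //.
      exact: near_sub.
    move=> z zD; rewrite in_fsetsep zD in_rect /= => zB; apply/orP; move: zB.
    by case: x z {xD yB zD} => [? ?] [? ?] /=; lia.
  under eq_bigr => x _ do rewrite !big_split /= -mulr_sumr -ME sumc.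
  rewrite !big_split /= -mulr_suml -ME sumc -expr2 mulrA -expr2 lerD2r lerD2l.
  rewrite -sumc; apply: ler_sum => x _; rewrite -card_indicator; last exact: near_sub.
  by rewrite -natrX ler_nat.
have -> : avg t D (fun A => (#|` A|%:R - c) ^+ 2) =
    avg t D (fun A => #|` A|%:R ^+ 2) + (- (2 * c)) * M + c ^+ 2.
  rewrite -(avg_cst t0 rho1 D (c ^+ 2)) -avgZ -!avgD.
  by apply: eq_avg => A _; ring.
have -> : (M - c) ^+ 2 + #|` D|%:R * (2 * k + 1)%:R ^+ 2 + #|` D|%:R ^+ 2 * p =
  M ^+ 2 + #|` D|%:R * (2 * k + 1)%:R ^+ 2 + #|` D|%:R ^+ 2 * p + - (2 * c) * M + c ^+ 2 by ring.
by rewrite !lerD2r.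
Qed.

Lemma chebyshev D (X : {fset site} -> R) (b : R) : 0 < b ->
  avg t D (fun A => X A ^+ 2) <= b ^+ 2 / 2 ->
  2^-1 <= avg t D (fun A => (`|X A| <= b)%R%:R).
Proof.
move=> b0 h; have b2 : 0 < b ^+ 2 by rewrite exprn_gt0.
apply: le_trans (_ : avg t D (fun A => (- (b ^+ 2)^-1) * X A ^+ 2 + 1) <= _).
  rewrite avgD avgZ avg_cst // mulNr.
  have : (b ^+ 2)^-1 * avg t D (fun A => X A ^+ 2) <= 2^-1.
    by rewrite ler_pdivrMl.
  by clear; lra.
apply: ler_avg => // A _; case: (lerP `|X A| b) => hb.
  by rewrite mulNr gerDr oppr_le0 mulr_ge0 ?sqr_ge0 // invr_ge0 ltW.
rewrite mulNr addrC subr_le0 ler_pdivlMl // mulr1 -[X in _ <= X]real_normK ?num_real //.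
by rewrite lerXn2r ?nnegrE ?ltW // (lt_trans b0).
Qed.

Lemma mean_le (theta : R) L : (forall k, density k <= theta) ->
  avg t (box L) (fun A => #|` A|%:R) <= theta * L%:R ^+ 2.
Proof.
move=> h; rewrite avg_card // -natrX -[(L ^ 2)%N]/(L * L)%N -card_box mulr_natr.
have -> : theta *+ #|` box L| = \sum_(x <- box L) theta.
  by rewrite big_const_seq count_predT iter_addr addr0.
rewrite big_seq [leRHS]big_seq; apply: ler_sum => x xL.
by apply: le_trans (h (2 * L)%N); exact: dens_box_le.
Qed.

(** Away from the boundary a translate of [box k] around the site fits into [box L]; the boundary
    layer is discarded. *)
Lemma mean_ge k L : (0 < k <= L)%N ->
  density k * (L%:R ^+ 2 - 2 * k%:R * L%:R) <= avg t (box L) (fun A => #|` A|%:R).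
Proof.
move=> /andP[k0 kL]; rewrite avg_card //.
have sub := inner_sub kL k0; set I := rect _ _ _ _ in sub.
have cI : #|` I| = ((L - k).+1 * (L - k).+1)%N by exact: card_rect.
apply: (@le_trans _ _ (\sum_(x <- I) dens t (box L) x)); last first.
  by apply: (@fsum_subset_le) => // x _ _; exact: dens_ge0.
apply: le_trans (_ : density k * #|` I|%:R <= _).
  apply: ler_wpM2l; first exact: dens_ge0.
  rewrite cI natrM -(natr1 (L - k)%N) natrB //.
  have kp : 0 <= k%:R :> R by [].
  have kl : k%:R <= L%:R :> R by rewrite ler_nat.
  exact: inner_area.
rewrite mulr_natr; have -> : density k *+ #|` I| = \sum_(x <- I) density k.
  by rewrite big_const_seq count_predT iter_addr addr0.
rewrite big_seq [leRHS]big_seq; apply: ler_sum => x xI; exact: dens_box_ge.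
Qed.

End Statistics.

Lemma expR_decay (R : realType) (lam D : R) (d : nat) : 0 < lam -> 0 <= D ->
  exists2 u0 : R, 1 <= u0 & forall u, u0 <= u -> D * u ^+ d * expR (- (lam * u)) <= 1.
Proof.
move=> l0 D0; set C := (d.+2%:R / lam) ^+ d.+1.
have C0 : 0 <= C by rewrite exprn_ge0 // divr_ge0 // ltW.
exists (1 + D * C); first by rewrite lerDl mulr_ge0.
move=> u uu; have u1 : 1 <= u by apply: le_trans uu; rewrite lerDl mulr_ge0.
have u0 : 0 < u by exact: lt_le_trans u1.
have := pow_le_expR d.+1 l0 (ltW u0); rewrite -/C => h.
rewrite expRN ler_pdivrMr ?expR_gt0 // mul1r.
have : D * u ^+ d * u <= expR (lam * u) * u.
  rewrite -mulrA -exprSr; apply: le_trans (_ : D * (C * expR (lam * u)) <= _).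
    exact: ler_wpM2l.
  rewrite mulrA mulrC; apply: ler_wpM2l; first exact: expR_ge0.
  by apply: le_trans uu; rewrite lerDr.
by rewrite ler_pM2r.
Qed.

Lemma sqrt_approx (R : realType) (u : R) : 1 <= u ->
  exists2 k : nat, (0 < k)%N & k%:R ^+ 2 <= u <= 4 * k%:R ^+ 2.
Proof.
move=> u1; have u0 : 0 <= u by apply: le_trans u1.
have s1 : 1 <= Num.sqrt u by rewrite -[leLHS]sqrtr1 ler_wsqrtr.
have s0 : 0 <= Num.sqrt u by exact: sqrtr_ge0.
have /andP[h1 h2] := truncn_itv s0.
have k0 : (0 < Num.truncn (Num.sqrt u))%N by rewrite truncn_gt0.
exists (Num.truncn (Num.sqrt u)) => //.
move: (Num.truncn _) h1 h2 k0 => k h1 h2 k0.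
have us : u = Num.sqrt u ^+ 2 by rewrite sqr_sqrtr.
move: (Num.sqrt u) us s0 h1 h2 => s -> s0 h1 h2 {u u0 u1 s1}.
have k1 : 1 <= k%:R :> R by rewrite ler1n.
move: h2; rewrite -natr1; move: (k%:R : R) k1 h1 => x x1 xs sx.
apply/andP; split; first by rewrite lerXn2r ?nnegrE // (le_trans _ x1).
have -> : 4 * x ^+ 2 = (2 * x) ^+ 2 by ring.
rewrite lerXn2r ?nnegrE //; lra.
Qed.

(** The choice of k^2 of order u balances the two errors: as l^2 is of order u^3, the error l^2 /
    k^2 on the density and the boundary layer k l are both of order u^2. *)
Lemma mean_deviation (R : realFieldType) (C c u k l M theta d N : R) :
  0 <= C -> 0 <= c -> 1 <= k -> 0 <= l -> k ^+ 2 <= u -> u <= 4 * k ^+ 2 -> l ^+ 2 <= c * u ^+ 3 ->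
  0 <= d <= 1 -> theta <= d + C / k ^+ 2 ->
  M <= theta * l ^+ 2 -> d * (l ^+ 2 - 2 * k * l) <= M -> `|N - theta * l ^+ 2| <= u ^+ 2 ->
  `|M - N| <= (4 * c * C + 2 * (1 + c) + 1) * u ^+ 2.
Proof.
move=> C0 c0 k1 l0 ku uk lu /andP[d0 d1] td Mu Ml Nu.
have u1 : 1 <= u by apply: le_trans ku; rewrite -(expr1n R 2) lerXn2r ?nnegrE // (le_trans _ k1).
have k2 : 0 < k ^+ 2 by rewrite exprn_gt0 // (lt_le_trans _ k1).
have u2 : 0 <= u ^+ 2 by rewrite sqr_ge0.
have h1 : l ^+ 2 / k ^+ 2 <= 4 * c * u ^+ 2.
  rewrite ler_pdivrMr //; apply: le_trans lu _.
  have -> : c * u ^+ 3 = c * u ^+ 2 * u by ring.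
  have -> : 4 * c * u ^+ 2 * k ^+ 2 = c * u ^+ 2 * (4 * k ^+ 2) by ring.
  by apply: ler_wpM2l => //; rewrite mulr_ge0.
have h2 : k * l <= (1 + c) * u ^+ 2.
  rewrite -(@ler_pXn2r _ 2) ?nnegrE //; last 2 first.
  - by rewrite mulr_ge0 // (le_trans _ k1).
  - by rewrite mulr_ge0 // addr_ge0.
  rewrite !exprMn; apply: le_trans (_ : u * (c * u ^+ 3) <= _).
    by apply: ler_pM => //; exact: sqr_ge0.
  have -> : u * (c * u ^+ 3) = c * (u ^+ 2) ^+ 2 by ring.
  by apply: ler_wpM2r; [rewrite sqr_ge0 | nra].
have h3 : d * l ^+ 2 - 2 * (k * l) <= M.
  apply: le_trans Ml; have kl0 : 0 <= k * l by rewrite mulr_ge0 // (le_trans _ k1).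
  have -> : d * (l ^+ 2 - 2 * k * l) = d * l ^+ 2 - 2 * (d * (k * l)) by ring.
  have : d * (k * l) <= k * l by rewrite ler_piMl.
  lra.
have h4 : theta * l ^+ 2 <= d * l ^+ 2 + C * (l ^+ 2 / k ^+ 2).
  have -> : d * l ^+ 2 + C * (l ^+ 2 / k ^+ 2) = (d + C / k ^+ 2) * l ^+ 2 by ring.
  by apply: ler_wpM2r => //; exact: sqr_ge0.
have h5 : C * (l ^+ 2 / k ^+ 2) <= C * (4 * c * u ^+ 2) by exact: ler_wpM2l.
have h6 : 0 <= C * (l ^+ 2 / k ^+ 2) by rewrite mulr_ge0 // divr_ge0 ?sqr_ge0 // ltW.
have -> : (4 * c * C + 2 * (1 + c) + 1) * u ^+ 2 = C * (4 * c * u ^+ 2) + 2 * ((1 + c) * u ^+ 2) + u ^+ 2 by ring.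
have h7 : 0 <= k * l by rewrite mulr_ge0 // (le_trans _ k1).
move: Nu; rewrite !ler_norml => /andP[Nu1 Nu2].
set b1 := C * (4 * c * u ^+ 2) in h5 *; set b2 := (1 + c) * u ^+ 2 in h2 *.
set b3 := C * (l ^+ 2 / _) in h4 h5 h6; set b4 := k * l in h2 h3 h7.
move: (theta * l ^+ 2) (d * l ^+ 2) (u ^+ 2) h3 h4 u2 Mu Nu1 Nu2 => b5 b6 b7.
by move: b1 b2 b3 b4 h2 h5 h6 h7; clear; move=> *; apply/andP; split; lra.
Qed.

Section Concentration.
Variables (R : realType) (t : R).
Let rho : R := t * (1 + Num.sqrt 2).
Hypotheses (t0 : 0 < t) (rho1 : rho < 1).
Variable theta : R.
Hypothesis (thetaE : density t n @[n --> \oo] --> theta).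

Let rho0 : 0 < rho.
Proof. by rewrite mulr_gt0 // ltr_wpDr // sqrtr_ge0. Qed.

Let density_nd : nondecreasing_seq (density t).
Proof. by move=> k L; exact: density_mono. Qed.

Lemma density_le k : density t k <= theta.
Proof.
rewrite -(cvg_lim _ thetaE) //; apply: nondecreasing_cvgn_le => //.
by apply/cvg_ex; exists theta.
Qed.

Lemma density_rate : exists2 C : R, 0 < C & forall k, (0 < k)%N ->
  theta <= density t k + C / k%:R ^+ 2.
Proof.
have [C C0 HC] := density_gap t0 rho1; exists C => // k k0.
rewrite -(cvg_lim _ thetaE) //; apply: limr_le; first by apply/cvg_ex; exists theta.
by exists k => // L /= kL; apply: HC; rewrite k0.
Qed.

Lemma concentration (c : R) : 0 < c ->
  exists2 a : R, 1 <= a & forall (L : nat) (N u : R), 1 <= u -> c <= u ^+ 2 ->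
    L%:R ^+ 2 <= c * u ^+ 3 -> u ^+ 3 <= c * L%:R ^+ 2 ->
    `|N - theta * L%:R ^+ 2| <= u ^+ 2 ->
    2^-1 <= avg t (box L) (fun A => (`|#|` A|%:R - N| <= a * u ^+ 2 / 2)%R%:R).
Proof.
move=> c0; have [C C0 HC] := density_rate.
(* Big clusters contribute L^8 [rho ^+ k] to the second moment, and L^8 is at most of order u^12,
   that is k^24. *)
have [C1 C10 HC1] := @pow_geometric_bounded R rho 24 (introT andP (conj rho0 rho1)).
pose e := 4 * c * C + 2 * (1 + c) + 1.
pose s := e ^+ 2 + 9 * c + big_const t * c ^+ 4 * 4 ^+ 12 * C1.
have s0 : 0 <= s.
  rewrite /s; apply: addr_ge0; first by rewrite addr_ge0 ?sqr_ge0 // mulr_ge0 // ltW.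
  apply: mulr_ge0; last exact: ltW.
  apply: mulr_ge0; last exact: exprn_ge0.
  by apply: mulr_ge0; [exact: big_const_ge0 | rewrite exprn_ge0 // ltW].
(* Chebyshev requires [s <= (1 + 8 * s) ^+ 2 / 8]. *)
exists (1 + 8 * s); first by rewrite lerDl mulr_ge0.
move=> L N u u1 cu Lu uL Nu.
have [k k0 /andP[ku uk]] := sqrt_approx u1.
have u0 : 0 < u by exact: lt_le_trans u1.
have kL : (k <= L)%N.
  rewrite -(ler_nat R) -(@ler_pXn2r _ 2) ?nnegrE //; apply: le_trans ku _.
  rewrite -(ler_pM2l c0); apply: le_trans uL; rewrite exprS mulrC.
  by apply: ler_wpM2l => //; exact: ltW.
have k1 : 1 <= k%:R :> R by rewrite ler1n.
set M := avg t (box L) (fun A => #|` A|%:R).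
have dev : `|M - N| <= e * u ^+ 2.
  apply: (@mean_deviation _ C c u k%:R L%:R M theta (density t k) N) => //; try exact: ltW.
  - by rewrite dens_ge0 ?dens_le1.
  - exact: HC.
  - by apply: mean_le => //; exact: density_le.
  - by apply: mean_ge => //; rewrite k0.
apply: chebyshev => //.
  by rewrite divr_gt0 // mulr_gt0 ?exprn_gt0 // ltr_wpDr // mulr_ge0.
apply: le_trans (second_moment t0 rho1 (box L) k N) _.
have b1 : (M - N) ^+ 2 <= e ^+ 2 * u ^+ 4.
  have -> : e ^+ 2 * u ^+ 4 = (e * u ^+ 2) ^+ 2 by ring.
  rewrite -[leLHS]real_normK ?num_real // lerXn2r ?nnegrE //.
  exact: le_trans dev.
have b2 : #|` box L|%:R * (2 * k + 1)%:R ^+ 2 <= 9 * c * u ^+ 4.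
  rewrite card_box natrM -expr2.
  have -> : 9 * c * u ^+ 4 = (c * u ^+ 3) * (9 * u) by ring.
  apply: ler_pM => //; rewrite ?sqr_ge0 //.
  apply: le_trans (_ : (3 * k%:R) ^+ 2 <= _); last by rewrite exprMn -natrX ler_pM2l.
  by rewrite lerXn2r ?nnegrE // -natrM ler_nat; move: k0; clear; lia.
have b3 : #|` box L|%:R ^+ 2 * avg t (box L) (fun A => (big k A)%:R) <=
    big_const t * c ^+ 4 * 4 ^+ 12 * C1 * u ^+ 4.
  apply: le_trans (_ : #|` box L|%:R ^+ 2 * (big_const t * L%:R ^+ 4 * rho ^+ k) <= _).
    by apply: ler_wpM2l; [rewrite sqr_ge0 | exact: big_box].
  rewrite card_box natrM -expr2.
  have -> : (L%:R ^+ 2) ^+ 2 * (big_const t * L%:R ^+ 4 * rho ^+ k) =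
    big_const t * ((L%:R ^+ 2) ^+ 4 * rho ^+ k) by ring.
  have -> : big_const t * c ^+ 4 * 4 ^+ 12 * C1 * u ^+ 4 =
    big_const t * (c ^+ 4 * 4 ^+ 12 * C1 * u ^+ 4) by ring.
  apply: ler_wpM2l; first exact: big_const_ge0.
  apply: le_trans (_ : (c * (4 * k%:R ^+ 2) ^+ 3) ^+ 4 * rho ^+ k <= _).
    apply: ler_wpM2r; first by rewrite exprn_ge0 // ltW.
    rewrite lerXn2r ?nnegrE ?sqr_ge0 //; first by rewrite mulr_ge0 ?exprn_ge0 ?mulr_ge0 ?exprn_ge0 // ltW.
    apply: le_trans Lu _; apply: ler_wpM2l; first exact: ltW.
    by rewrite lerXn2r ?nnegrE ?mulr_ge0 ?exprn_ge0 // ltW.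
  have -> : (c * (4 * k%:R ^+ 2) ^+ 3) ^+ 4 * rho ^+ k =
    c ^+ 4 * 4 ^+ 12 * (k%:R ^+ 24 * rho ^+ k) by ring.
  have -> : c ^+ 4 * 4 ^+ 12 * C1 * u ^+ 4 = c ^+ 4 * 4 ^+ 12 * (C1 * u ^+ 4) by ring.
  apply: ler_wpM2l; first by rewrite mulr_ge0 ?exprn_ge0 // ltW.
  apply: le_trans (_ : C1 * 1 <= _); last first.
    by apply: ler_wpM2l; [exact: ltW | rewrite exprn_ege1].
  rewrite mulr1; apply: le_trans (HC1 k); apply: ler_wpM2r; first by rewrite exprn_ge0 // ltW.
  by rewrite lerXn2r ?nnegrE // ler_nat.
apply: le_trans (_ : s * u ^+ 4 <= _).
  rewrite /s 2!mulrDl; apply: lerD b3; exact: lerD b1 b2.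
have -> : ((1 + 8 * s) * u ^+ 2 / 2) ^+ 2 / 2 = (1 + 8 * s) ^+ 2 / 8 * u ^+ 4 by field.
apply: ler_wpM2r; first by rewrite exprn_ge0 // ltW.
rewrite ler_pdivlMr //; move: s0; clear; move: (s) => x x0; nra.
Qed.

End Concentration.

Lemma sqr_le_half (L : nat) : (2 <= L)%N -> (L ^ 2 <= 9 * (L./2 * L./2))%N.
Proof.
move=> L2; have Lk : (L <= 3 * L./2)%N.
  by have := odd_double_half L; case: (odd L) => /=; lia.
by apply: leq_trans (leq_mul Lk Lk) _; rewrite mulnACA.
Qed.

(** The constant is 4050 = 2 * 81 * 25: for such [u], the sites lost around [B] cost at most half of
    the lower bound u^3 / (9 c). *)
Lemma free_sites_bounds (R : realType) (c u : R) (L : nat) (B : {fset site})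
    (y := #|` free_sites (box L) B|%:R : R) :
  0 < c -> 1 + 4050 * c <= u -> L%:R ^+ 2 <= c * u ^+ 3 -> u ^+ 3 <= c * L%:R ^+ 2 ->
  #|` B|%:R <= 25 * u ^+ 2 -> u ^+ 3 / (18 * c) <= y <= c * u ^+ 3.
Proof.
move=> c0 uu Lu uL Bu; have u0 : 0 < u by lra.
have u1 : 1 <= u by lra.
have L2 : (2 <= L)%N.
  rewrite ltnNge; apply/negP => L1.
  have : L%:R ^+ 2 <= 1 :> R by apply: exprn_ile1 => //; rewrite -(ler_nat R) in L1.
  have : u <= u ^+ 3 by rewrite exprS ler_peMr ?exprn_ege1 // ltW.
  move=> h1 h2; have : c * L%:R ^+ 2 <= c * 1 by apply: ler_wpM2l => //; exact: ltW.
  move: (c * _) (u ^+ 3) uL h1 => p q; lra.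
apply/andP; split; last first.
  apply: le_trans Lu; rewrite -natrX ler_nat -[(L ^ 2)%N]/(L * L)%N -card_box.
  by apply: fsubset_leq_card; apply/fsubsetP => x; rewrite in_fsetsep => /and3P[].
have h := card_free_sites L B.
have : (L ^ 2 <= 9 * (#|` free_sites (box L) B| + 9 * #|` B|))%N.
  apply: leq_trans (_ : 9 * ((L./2) * (L./2)) <= _)%N; last by rewrite leq_mul2l h.
  exact: sqr_le_half.
rewrite -(ler_nat R) natrX natrM natrD natrM -/y.
move: (y) (#|` B|%:R) (L%:R ^+ 2) Bu uL => z b l Bu uL h'.
rewrite ler_pdivrMr ?mulr_gt0 //.
have : 4050 * c * u ^+ 2 <= u ^+ 3.
  by rewrite (exprSr u 2) mulrC; apply: ler_wpM2l; [exact: sqr_ge0 | lra].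
have : c * l <= c * (9 * (z + 9 * (25 * u ^+ 2))).
  by apply: ler_wpM2l; [exact: ltW | lra].
move: (u ^+ 3) (u ^+ 2) uL => u3 u2; lra.
Qed.

Lemma le_quarter (R : realFieldType) (q : R) : 4 * q <= 1 -> q <= 4^-1.
Proof. move=> *; lra. Qed.

(** * Orders of magnitude when L^2 is of order u^3 *)

Section Rates.
Variables (R : realType) (t : R).
Let rho : R := t * (1 + Num.sqrt 2).
Hypotheses (t0 : 0 < t) (rho1 : rho < 1).
Variable theta : R.
Hypothesis (thetaE : density t n @[n --> \oo] --> theta).
Let w := weight_max t.
Let w1 : 1 <= w. Proof. by rewrite lerDl invr_ge0 exprn_ge0 // ltW. Qed.
Let rate0 : 0 < rate_max t.
Proof. by rewrite divr_gt0 ?exprn_gt0 // mulr_gt0 // exprn_gt0 // (lt_le_trans _ w1). Qed.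

(** The variable [u] stands for the square root of v, so that u^3 is v^(3/2). *)
Definition regime (c : R) (L : nat) (u : R) : Prop :=
  L%:R ^+ 2 <= c * u ^+ 3 /\ u ^+ 3 <= c * L%:R ^+ 2.

(* With [u] large, windows of order [u ^+ 2] are small compared with the number
   of free sites, which is of order [u ^+ 3]. *)
Lemma window_small (c a : R) : 0 < c -> 0 <= a -> exists2 u0 : R, 1 <= u0 &
  forall u y : R, u0 <= u -> u ^+ 3 / (18 * c) <= y ->
  20 * (a * u ^+ 2) * w ^+ 2 <= y * t ^+ 4.
Proof.
move=> c0 a0; pose K := 20 * a * w ^+ 2 * (18 * c) / t ^+ 4.
have t4 : 0 < t ^+ 4 by rewrite exprn_gt0.
have K0 : 0 <= K.
  apply: divr_ge0; last exact: ltW.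
  apply: mulr_ge0; last by rewrite mulr_ge0 // ltW.
  by apply: mulr_ge0; [rewrite mulr_ge0 | exact: sqr_ge0].
exists (1 + K); first by rewrite lerDl.
move=> u y uu uy; have u0 : 0 <= u by lra.
rewrite -ler_pdivrMr //; apply: le_trans uy; rewrite ler_pdivlMr ?mulr_gt0 //.
have -> : 20 * (a * u ^+ 2) * w ^+ 2 / t ^+ 4 * (18 * c) = K * u ^+ 2 by rewrite /K; ring.
by rewrite (exprS u 2); apply: ler_wpM2r; [exact: sqr_ge0 | lra].
Qed.

Lemma gaussian_small (c a u y : R) : 0 < c -> 0 < u -> 0 < y -> y <= c * u ^+ 3 ->
  expR (- ((a * u ^+ 2) ^+ 2 / (32 * y))) <= expR (- (a ^+ 2 / (32 * c) * u)).
Proof.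
move=> c0 u0 y0 yu; rewrite ler_expR lerN2 ler_pdivlMr ?mulr_gt0 //.
have -> : a ^+ 2 / (32 * c) * u * (32 * y) = a ^+ 2 * u / c * y by field; exact: lt0r_neq0.
apply: le_trans (_ : a ^+ 2 * u / c * (c * u ^+ 3) <= _).
  apply: ler_wpM2l => //; apply: divr_ge0; last exact: ltW.
  by apply: mulr_ge0; [exact: sqr_ge0 | exact: ltW].
by have -> : a ^+ 2 * u / c * (c * u ^+ 3) = (a * u ^+ 2) ^+ 2 by field; exact: lt0r_neq0.
Qed.

(** By [concentration] half of the mass has a count within order u^2 of [N]; spreading it onto [N]
    costs the exponential of a^2 / y, where a is of order u^2 and y of order u^3. The polynomial
    prefactor is absorbed by the [1] in [C]. *)
Lemma count_bound (c : R) : 0 < c -> exists C u0 : R, [/\ 0 < C, 1 <= u0 &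
  forall (L N : nat) (u : R), u0 <= u -> regime c L u ->
    `|N%:R - theta * L%:R ^+ 2| <= u ^+ 2 ->
    Z t (box L) <= expR (C * u) * psum (box L) (fun A => (#|` A| == N)%:R * wt t A)].
Proof.
move=> c0; have [a a1 Ha] := concentration t0 rho1 thetaE c0.
have a0 : 0 < a by lra.
have [u1 u11 H1] := window_small c0 (ltW a0).
have c1 : 0 <= c + 1 by rewrite addr_ge0 // ltW.
have D0 : 0 <= 4 * (c + 1) by rewrite mulr_ge0.
have D1 : 0 <= 8 * (c + 1) by rewrite mulr_ge0.
have [lam lam0 G] : exists2 lam : R, 0 < lam & forall u y, 0 < u -> 0 < y -> y <= c * u ^+ 3 ->
    expR (- ((a * u ^+ 2) ^+ 2 / (32 * y))) <= expR (- (lam * u)).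
  exists (a ^+ 2 / (32 * c)); first by rewrite divr_gt0 ?exprn_gt0 // mulr_gt0.
  by move=> u y u0 y0 yu; exact: gaussian_small.
have [u2 u21 H2] := expR_decay 3 lam0 D0.
have [u3 u31 H3] := expR_decay 3 (@ltr01 R) D1.
pose C := 10 * rate_max t * a ^+ 2 * (18 * c) + 1.
have C0 : 0 < C.
  rewrite ltr_wpDl //; apply: mulr_ge0; last by rewrite mulr_ge0 // ltW.
  by apply: mulr_ge0; [rewrite mulr_ge0 // ltW | exact: sqr_ge0].
exists C, (1 + 4050 * c + u1 + u2 + u3); split; first exact: C0.
  by lra.
move=> L N u uu [Lu uL] Nu; set y : R := #|` free_sites (box L) fset0|%:R.
have uge1 : 1 <= u by lra.
have u_gt0 : 0 < u by lra.
have u30 : 0 < u ^+ 3 by rewrite exprn_gt0.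
have /andP[ylo yhi] : u ^+ 3 / (18 * c) <= y <= c * u ^+ 3.
  apply: free_sites_bounds => //; first by lra.
  by rewrite cardfs0 mulr_ge0 // sqr_ge0.
have y0 : 0 < y by apply: lt_le_trans ylo; rewrite divr_gt0 // mulr_gt0.
have y1 : y + 1 <= (c + 1) * u ^+ 3.
  by rewrite mulrDl mul1r lerD // exprn_ege1.
have au1 : 1 <= a * u ^+ 2 by rewrite -[leLHS]mulr1 ler_pM // exprn_ege1.
have Y0 : (0 < #|` free_sites (box L) fset0|)%N by rewrite -(ltr_nat R).
apply: le_trans (count_lower t0 rho1 (N := N) Y0 au1 _ _ _) _; rewrite -/y.
- by apply: H1 => //; lra.
- apply: le_trans (_ : (c + 1) * u ^+ 3 * expR (- (lam * u)) <= _).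
    have p0 : 0 <= y + 1 by lra.
    exact: (ler_pM p0 (expR_ge0 _) y1 (G _ _ u_gt0 y0 yhi)).
  have uu2 : u2 <= u by lra.
  have := H2 _ uu2; move: (expR _) => E.
  have -> : 4 * (c + 1) * u ^+ 3 * E = 4 * ((c + 1) * u ^+ 3 * E) by ring.
  exact: le_quarter.
- apply: Ha => //; apply: le_trans (_ : u <= _); first by lra.
  by rewrite expr2 ler_peMr // ltW.
apply: ler_wpM2r.
  apply: psum_ge0 => A _; apply: mulr_ge0 => //; apply: ltW; apply: wt_gt0.
  rewrite t0 /=; apply: ltW; apply: le_lt_trans rho1.
  by rewrite /rho mulrDr mulr1 lerDl mulr_ge0 ?sqrtr_ge0 // ltW.
have -> : C * u = u + 10 * rate_max t * a ^+ 2 * (18 * c) * u by rewrite /C; ring.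
rewrite expRD; apply: ler_pM; rewrite ?expR_ge0 //; first by lra.
  apply: le_trans (_ : 8 * (c + 1) * u ^+ 3 <= _).
    have -> : 8 * (c + 1) * u ^+ 3 = 8 * ((c + 1) * u ^+ 3) by ring.
    by rewrite ler_pM2l.
  have uu3 : u3 <= u by lra.
  by have := H3 _ uu3; rewrite mul1r expRN ler_pdivrMr ?expR_gt0 // mul1r.
rewrite ler_expR.
have -> : 10 * rate_max t * a ^+ 2 * (18 * c) * u =
  10 * rate_max t * (a ^+ 2 * (18 * c) * u) by ring.
apply: ler_wpM2l; first by rewrite mulr_ge0 // ltW.
rewrite ler_pdivrMr //; apply: le_trans (_ : a ^+ 2 * (18 * c) * u * (u ^+ 3 / (18 * c)) <= _).
  by rewrite le_eqVlt; apply/orP; left; apply/eqP; field; exact: lt0r_neq0.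
apply: ler_wpM2l => //; apply: mulr_ge0; last exact: ltW.
by apply: mulr_ge0; [exact: sqr_ge0 | rewrite mulr_ge0 // ltW].
Qed.

End Rates.

(** * Rarity of intermediate clusters *)

Section Spans.
Implicit Types (A B D : {fset site}) (x y : site).

(** The extent of the cluster of [x] is exactly [n] in the sup norm seen from [x]. An exact value
    confines the cluster to [near D x n], the set on which it is decoupled. *)
Definition spans x (n : nat) A : Prop :=
  (forall y, linked A x y -> `|y.1 - x.1| <= n%:Z /\ `|y.2 - x.2| <= n%:Z) /\
  exists y, linked A x y /\ (n%:Z <= `|y.1 - x.1| \/ n%:Z <= `|y.2 - x.2|).

Lemma spans_big D A x n : A `<=` D -> spans x n A -> x \in A /\ big n (inside (near D x n) A).
Proof.
move=> /fsubsetP AD [all_near [y [[xA rxy] far]]]; split => //.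
apply: (@bigP _ _ x y _ far); apply: connected_inside => // z rxz.
have zA : z \in A by have := reach_in rxz; rewrite !inE => /orP[//|/eqP->].
rewrite in_fsetsep AD //= in_rect; have [] := all_near z (conj xA rxz).
by move: x z {y xA rxy far rxz zA all_near} => [? ?] [? ?] /=; clear; lia.
Qed.

End Spans.

Section UnionBound.
Variables (R : realType) (t : R).
Hypotheses (t0 : 0 < t) (rho1 : t * (1 + Num.sqrt 2) < 1).

Lemma union_bound D (P : pred nat) (m : nat) (F : {fset site} -> R) : (forall A, 0 <= F A) ->
  (forall n, P n -> (n < m)%N) ->
  psum D (fun A => `[< exists x n, P n /\ spans x n A >]%:R * F A) <=
  \sum_(x <- D) \sum_(n <- seq.filter P (iota 0 m))
    psum D (fun A => (big n (inside (near D x n) A))%:R * F A).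
Proof.
move=> F0 Pm; under [leRHS]eq_bigr do rewrite -psum_sum.
rewrite -psum_sum.
apply: ler_psum => A AD.
have S0 (s : seq site) : 0 <= \sum_(x <- s) \sum_(n <- seq.filter P (iota 0 m))
    (big n (inside (near D x n) A))%:R * F A.
  by apply: sumr_ge0 => x _; apply: sumr_ge0 => n _; rewrite mulr_ge0.
case: asboolP => [[x [n [Pn sp]]]|_]; last by rewrite mul0r S0.
have [xA bA] := spans_big AD sp; rewrite mul1r.
have xD := fsubsetP AD _ xA.
rewrite (bigD1_seq x) ?fset_uniq //= -[leLHS]addr0; apply: lerD; last first.
  by apply: sumr_ge0 => y _; apply: sumr_ge0 => k _; rewrite mulr_ge0.
rewrite (bigD1_seq n) ?filter_uniq ?iota_uniq ?mem_filter ?Pn ?mem_iota ?Pm //= bA mul1r lerDl.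
by apply: sumr_ge0 => k _; rewrite mulr_ge0.
Qed.

Lemma droplet_term (c Cz u0z : R) : 0 < c -> 0 < Cz -> 1 <= u0z ->
  exists kappa lam u0 : R, [/\ 0 < kappa, 0 < lam, 1 <= u0 &
  forall (L N : nat) (u r : R), u0 <= u -> regime c L u ->
    Z t (box L) <= expR (Cz * u) * psum (box L) (fun A => (#|` A| == N)%:R * wt t A) ->
    forall x n, 1 <= r -> r <= n%:R -> n%:R <= kappa * u ->
    psum (box L) (fun A => (big n (inside (near (box L) x n) A))%:R *
      ((#|` A| == N)%:R * wt t A)) <=
    (big_const t * L%:R ^+ 4 * expR (- (lam * r)) + expR (- u)) *
      psum (box L) (fun A => (#|` A| == N)%:R * wt t A)].
Proof.
move=> c0 Cz0 u0z1.
have rho0 : 0 < t * (1 + Num.sqrt 2) by rewrite mulr_gt0 // ltr_wpDr // sqrtr_ge0.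
set rho := t * (1 + Num.sqrt 2) in rho0 *.
have rho1' : rho < 1 by exact: rho1.
have [lam lam0 rhoE] : exists2 lam : R, 0 < lam & forall n : nat, rho ^+ n = expR (- (2 * lam * n%:R)).
  exists (- ln rho / 2); first by rewrite divr_gt0 // oppr_gt0 ln_lt0 // rho0 rho1'.
  move=> n; have -> : - (2 * (- ln rho / 2) * n%:R) = n%:R * ln rho by field.
  by rewrite expRM_natl lnK // posrE.
have rate0 : 0 < rate_max t.
  rewrite divr_gt0 ?exprn_gt0 // mulr_gt0 // exprn_gt0 //.
  by rewrite ltr_wpDr // invr_ge0 exprn_ge0 // ltW.
(* The first term makes the Gaussian error beat the cost exp (Cz u) of the conditioning, with exp (-
   u) to spare; 50 ensures that [B], of at most 9 u^2 sites, has at most a u^2 / 2 of them. *)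
pose a : R := 32 * c * (Cz + 1) + 50.
have a50 : 50 <= a by rewrite lerDr mulr_ge0 // ?mulr_ge0 ?addr_ge0 // ltW.
have a0 : 0 < a by exact: lt_le_trans a50.
have aa : Cz + 1 <= a ^+ 2 / (32 * c).
  rewrite ler_pdivlMr ?mulr_gt0 //; have h : (Cz + 1) * (32 * c) <= a by rewrite /a mulrC lerDl.
  by apply: le_trans h _; rewrite expr2 ler_peMr ?(ltW a0) // (le_trans _ a50) // ler1n.
have [u1 u11 H1] := window_small t0 c0 (ltW a0).
(* The decoupling factor is at most exp (K kappa n). With [kappa <= lam / K] it uses up half of the
   decay [rho ^+ n], whose exponent is [- 2 * lam * n]. *)
pose K := 20 * rate_max t * (a * 9 * (18 * c)).
have K0 : 0 < K by rewrite /K; apply: mulr_gt0; apply: mulr_gt0 => //; apply: mulr_gt0.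
pose kappa := Num.min 1 (lam / K).
have kap0 : 0 < kappa by rewrite lt_min ltr01 divr_gt0.
have kap1 : kappa <= 1 by rewrite ge_min lexx.
have kapK : K * kappa <= lam.
  by rewrite mulrC -ler_pdivlMr // ge_min lexx orbT.
clearbody kappa.
exists kappa, lam, (1 + 4050 * c + u1); split=> //; first by lra.
move=> L N u r uu [Lu uL] count x n r1 rn nu.
have n1 : 1 <= n%:R :> R by exact: le_trans rn.
have uge1 : 1 <= u by lra.
have u_gt0 : 0 < u by lra.
have u2 : 0 < u ^+ 2 by rewrite exprn_gt0.
have u30 : 0 < u ^+ 3 by rewrite exprn_gt0.
have nu1 : n%:R <= u by apply: le_trans nu _; rewrite ler_piMl // ltW.
set B := near (box L) x n.
have BL : B `<=` box L by exact: near_sub.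
have Bn : #|` B|%:R <= 9 * n%:R ^+ 2 :> R.
  apply: le_trans (_ : ((2 * n + 1) ^ 2)%:R <= _); first by rewrite ler_nat card_near.
  rewrite natrX natrD natrM; have -> : 9 * n%:R ^+ 2 = (3 * n%:R) ^+ 2 :> R by ring.
  by rewrite lerXn2r ?nnegrE //; lra.
have n2u : n%:R ^+ 2 <= u ^+ 2 by rewrite lerXn2r ?nnegrE // ltW.
set y : R := #|` free_sites (box L) B|%:R.
have /andP[ylo yhi] : u ^+ 3 / (18 * c) <= y <= c * u ^+ 3.
  apply: free_sites_bounds => //; first by lra.
  by move: (u ^+ 2) (n%:R ^+ 2) (#|` B|%:R : R) n2u Bn u2 => *; lra.
have y0 : 0 < y by apply: lt_le_trans ylo; rewrite divr_gt0 // mulr_gt0.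
have Y0 : (0 < #|` free_sites (box L) B|)%N by rewrite -(ltr_nat R).
have au1 : 1 <= a * u ^+ 2.
  by rewrite -[leLHS]mulr1 ler_pM ?exprn_ege1 // (le_trans _ a50) // ler1n.
have Ba : #|` B|%:R <= a * u ^+ 2 / 2.
  apply: le_trans Bn _; rewrite ler_pdivlMr //.
  apply: le_trans (_ : 50 * u ^+ 2 <= _); last by rewrite ler_pM2r.
  by move: (u ^+ 2) (n%:R ^+ 2) n2u u2 => *; lra.
have win : 20 * (a * u ^+ 2) * weight_max t ^+ 2 <= y * t ^+ 4 by apply: H1 => //; lra.
set P := psum (box L) (fun A => (#|` A| == N)%:R * wt t A).
have t01 : 0 < t <= 1.
  rewrite t0 /=; apply: ltW; apply: le_lt_trans rho1.
  by rewrite /rho mulrDr mulr1 lerDl mulr_ge0 ?sqrtr_ge0 // ltW.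
have P0 : 0 <= P.
  by apply: psum_ge0 => A _; rewrite mulr_ge0 // ltW // wt_gt0.
apply: le_trans (conditional_le (f := fun A => (big n A)%:R) t0 rho1 N BL Y0 au1 Ba win _ _) _.
- by move=> A; rewrite ler0n lern1 leq_b1.
- by move=> A D; exact: bigS.
rewrite -/P -/y [leRHS]mulrDl; apply: lerD.
  apply: ler_wpM2r => //.
  apply: le_trans (_ : expR (lam * n%:R) * (big_const t * L%:R ^+ 4 * rho ^+ n) <= _).
    apply: ler_pM; rewrite ?expR_ge0 ?avg_ge0 //; last first.
      apply: le_trans (avg_mono t0 rho1 BL _) (big_box t0 rho1 L n) => A D; exact: bigS.
    rewrite ler_expR; apply: le_trans (_ : K * kappa * n%:R <= _); last by rewrite ler_wpM2r.
    have -> : K * kappa * n%:R = 20 * rate_max t * (a * 9 * (18 * c) * (kappa * n%:R)).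
      by rewrite /K; ring.
    apply: ler_wpM2l; first by rewrite mulr_ge0 // ltW.
    rewrite ler_pdivrMr //.
    apply: le_trans (_ : a * u ^+ 2 * (9 * n%:R ^+ 2) <= _).
      by apply: ler_wpM2l => //; rewrite mulr_ge0 // ltW.
    apply: le_trans (_ : a * 9 * (18 * c) * (kappa * n%:R) * (u ^+ 3 / (18 * c)) <= _).
      have -> : a * 9 * (18 * c) * (kappa * n%:R) * (u ^+ 3 / (18 * c)) =
        a * u ^+ 2 * (9 * (n%:R * (kappa * u))) by field; exact: lt0r_neq0.
      apply: ler_wpM2l; first by rewrite mulr_ge0 // ltW.
      by rewrite expr2 ler_pM2l // ler_wpM2l.
    apply: ler_wpM2l => //; apply: mulr_ge0; last by rewrite mulr_ge0 // ltW.
    by apply: mulr_ge0; rewrite mulr_ge0 // ltW.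
  rewrite rhoE mulrCA -expRD; apply: ler_wpM2l; first by rewrite mulr_ge0 ?big_const_ge0 // exprn_ge0.
  rewrite ler_expR; have -> : lam * n%:R - 2 * lam * n%:R = - (lam * n%:R) by ring.
  by rewrite lerN2 ler_wpM2l // ltW.
apply: le_trans (_ : expR (- ((Cz + 1) * u)) * (expR (Cz * u) * P) <= _).
  apply: ler_pM; [exact: expR_ge0 | exact: ltW (Z_gt0 t01 _) | | exact: count].
  apply: le_trans (gaussian_small a c0 u_gt0 y0 yhi) _.
  by rewrite ler_expR lerN2 ler_wpM2r // ltW.
rewrite mulrA -expRD; apply: ler_wpM2r => //; rewrite ler_expR.
by rewrite mulrDl mul1r opprD addrAC addNr add0r.
Qed.

End UnionBound.

Lemma le_of_sum (R : realFieldType) (p q r L : R) : 0 <= p -> 0 <= q -> 0 <= r ->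
  p + q + r + 2 < L -> [/\ 2 <= L, p < L, q <= L & r <= L].
Proof. by move=> *; split; lra. Qed.

Section Rarity.
Variables (R : realType) (t : R).
Hypotheses (t0 : 0 < t) (rho1 : t * (1 + Num.sqrt 2) < 1).
Variable theta : R.
Hypothesis (thetaE : density t n @[n --> \oo] --> theta).

Lemma sum_le_const (I : eqType) (s : seq I) (F : I -> R) (a : R) :
  (forall i, i \in s -> F i <= a) -> \sum_(i <- s) F i <= (size s)%:R * a.
Proof.
elim: s => [|i s IH] Fa; first by rewrite big_nil mul0r.
rewrite big_cons /= -natr1 mulrDl mul1r addrC lerD ?Fa ?mem_head //.
by apply: IH => j js; rewrite Fa // inE js orbT.
Qed.

Lemma droplets_rare (c c0 : R) : 0 < c -> 0 < c0 ->
  exists (kappa K0 : R) (L0 : nat), 0 < kappa /\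
  forall (L N : nat) (u K : R), (L0 <= L)%N -> K0 <= K -> 0 <= u -> regime c L u ->
    `|N%:R - theta * L%:R ^+ 2| <= u ^+ 2 ->
    0 < psum (box L) (fun A => (#|` A| == N)%:R * wt t A) /\
    psum (box L) (fun A => `[< exists x n, (K * ln L%:R <= 3 * n.+1%:R) && (n%:R <= kappa * u) /\
        spans x n A >]%:R * ((#|` A| == N)%:R * wt t A)) <=
    L%:R `^ (- c0) * psum (box L) (fun A => (#|` A| == N)%:R * wt t A).
Proof.
move=> cp c00.
have [Cz [u0z [Cz0 u0z1 Hz]]] := count_bound t0 rho1 thetaE cp.
have [kappa [lam [u1 [kap0 lam0 u11 Ht]]]] := droplet_term t0 rho1 cp Cz0 u0z1.
pose d := (Num.truncn c0).+1.
have cd : c0 <= d%:R by apply: ltW; exact: truncnS_gt.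
have D0 : 0 <= 4 * c ^+ (3 + d) by rewrite mulr_ge0 // exprn_ge0 // ltW.
have [u2 u21 H2] := expR_decay (3 * (3 + d)) (@ltr01 R) D0.
have bc0 := big_const_ge0 t.
have [U [Uz U1 U2 Uc]] : exists U : R, [/\ u0z <= U, u1 <= U, u2 <= U & c <= U].
  by exists (u0z + u1 + u2 + c); split; lra.
have U0 : 0 <= U by lra.
(* The terms ensure in turn [u >= U], the absorption of the constants into L^2, [ln L >= 6] and
   [L >= 2]. *)
pose m0 := c * U ^+ 3 + 4 * big_const t * expR lam + expR 6 + 2.
(* The minimum with 1 gives [n <= u <= L], so that [n] has at most L + 1 values. The 9 is 7 + 2: the
   union bound costs L^2 (L + 1) L^4, and two more powers absorb the constants. The 3 undoes the one
   in front of [n.+1]. *)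
exists (Num.min kappa 1), (3 * (c0 + 9) / lam + 2), (Num.truncn m0).+1.
split; first by rewrite lt_min kap0 ltr01.
move=> L N u K LL KK ug0 [Lu uL] Nu.
have m0L : m0 < L%:R.
  by apply: lt_le_trans (truncnS_gt _) _; rewrite ler_nat.
have p1 : 0 <= c * U ^+ 3 by rewrite mulr_ge0 ?exprn_ge0 // ltW.
have p2 : 0 <= 4 * big_const t * expR lam by rewrite mulr_ge0 ?expR_ge0 // mulr_ge0.
have p3 : 0 <= expR (6 : R) by exact: expR_ge0.
have [L2 Lc Lb Le] : [/\ 2 <= L%:R :> R, c * U ^+ 3 < L%:R,
   4 * big_const t * expR lam <= L%:R & expR 6 <= L%:R :> R].
  exact: le_of_sum p1 p2 p3 m0L.
have L1 : 1 <= L%:R :> R by lra.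
have LL2 : L%:R <= L%:R ^+ 2 :> R by rewrite expr2 ler_peMr //; lra.
have Uu : U <= u.
  rewrite leNgt; apply/negP => uU; have : u ^+ 3 <= U ^+ 3 by rewrite lerXn2r ?nnegrE // ltW.
  move=> h0; have h : c * u ^+ 3 <= c * U ^+ 3 by apply: ler_wpM2l => //; exact: ltW.
  by have := lt_le_trans (le_lt_trans (le_trans Lu h) Lc) LL2; rewrite ltxx.
have uL1 : u <= L%:R.
  have u0 : 0 < u by lra.
  rewrite -(@ler_pXn2r _ 2) ?nnegrE //.
  rewrite -(ler_pM2l cp); apply: le_trans uL; rewrite (exprS u 2).
  by apply: ler_wpM2r; [exact: sqr_ge0 | lra].
have t01 : 0 < t <= 1.
  rewrite t0 /=; apply: ltW; apply: le_lt_trans rho1.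
  by rewrite mulrDr mulr1 lerDl mulr_ge0 ?sqrtr_ge0 // ltW.
have count := Hz L N u (le_trans Uz Uu) (conj Lu uL) Nu.
set P := psum (box L) (fun A => (#|` A| == N)%:R * wt t A) in count *.
have P0 : 0 < P.
  have := lt_le_trans (Z_gt0 t01 (box L)) count.
  by rewrite pmulr_rgt0 ?expR_gt0.
split => //.
have ell6 : 6 <= ln (L%:R : R) by rewrite -(expRK (6 : R)) ler_ln ?posrE ?expR_gt0 // (lt_le_trans _ L1).
set ell := ln (L%:R : R) in ell6 *.
have Lell : L%:R = expR ell :> R by rewrite /ell lnK // posrE; lra.
have K2 : 2 <= K by apply: le_trans KK; rewrite lerDr divr_ge0 ?mulr_ge0 ?addr_ge0 // ltW.
pose r := K * ell / 3 - 1.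
have r1 : 1 <= r.
  have : 2 * 6 <= K * ell by apply: ler_pM.
  by rewrite /r; move: (K * ell) => q; lra.
pose Q n := (r <= n%:R) && (n%:R <= kappa * u) && (n%:R <= u).
have Qlt n : Q n -> (n < L.+1)%N.
  by move=> /andP[_ nu]; rewrite ltnS -(ler_nat R); exact: le_trans uL1.
set W := L%:R `^ (- c0).
have WE : W = expR (- (c0 * ell)) by rewrite /W /powR Lell gt_eqF ?expR_gt0 // expRK mulNr.
have F0 A : 0 <= (#|` A| == N)%:R * wt t A by rewrite mulr_ge0 // ltW // wt_gt0.
apply: le_trans (_ : psum (box L) (fun A => `[< exists x n, Q n /\ spans x n A >]%:R *
    ((#|` A| == N)%:R * wt t A)) <= _).
  apply: ler_psum => A _; apply: ler_wpM2r => //; rewrite ler_nat.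
  case: asboolP => // -[x [n [/andP[n1 n2] sp]]]; rewrite lt0b; apply/asboolP.
  exists x, n; split=> //; apply/andP; split; last first.
    apply: le_trans n2 _; rewrite ler_piMl //; by rewrite ge_min lexx orbT.
  apply/andP; split; last by apply: le_trans n2 _; rewrite ler_wpM2r // ge_min lexx.
  by move: n1; rewrite -natr1 /r; move: (K * ell) => q; lra.
apply: le_trans (union_bound _ F0 Qlt) _.
pose E := (big_const t * L%:R ^+ 4 * expR (- (lam * r)) + expR (- u)) * P.
have E0 : 0 <= E.
  apply: mulr_ge0; last exact: ltW.
  by rewrite addr_ge0 ?expR_ge0 // mulr_ge0 ?expR_ge0 // mulr_ge0 // exprn_ge0.
apply: le_trans (_ : L%:R ^+ 2 * ((L%:R + 1) * E) <= _).
  apply: le_trans (sum_le_const (a := (L%:R + 1) * E) _) _; last first.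
    by rewrite -[size _]/(#|` box L|) card_box natrM -expr2.
  move=> x _; apply: le_trans (_ : (size (seq.filter Q (iota 0 L.+1)))%:R * E <= _).
    apply: sum_le_const => n; rewrite mem_filter => /andP[/andP[/andP[rn nu _]] _].
    apply: (Ht L N u r) => //; lra.
  apply: ler_wpM2r => //; rewrite natr1 ler_nat size_filter.
  by apply: leq_trans (count_size _ _) _; rewrite size_iota.
rewrite /E; set G := _ + expR (- u).
suff : L%:R ^+ 2 * (L%:R + 1) * G <= W.
  move=> h; have -> : L%:R ^+ 2 * ((L%:R + 1) * (G * P)) = L%:R ^+ 2 * (L%:R + 1) * G * P by ring.
  by apply: ler_wpM2r => //; exact: ltW.
have Wpos : 0 < W by rewrite WE expR_gt0.
have h1 : L%:R ^+ 2 * (L%:R + 1) * (big_const t * L%:R ^+ 4 * expR (- (lam * r))) <= W / 2.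
  have hr : expR (- (lam * r)) <= expR lam * (W / L%:R ^+ 9).
    rewrite WE {1}Lell -expRM_natl -expRN -!expRD ler_expR.
    have KL : (3 * (c0 + 9) / lam) * ell <= K * ell.
      by apply: ler_wpM2r; [lra | apply: le_trans KK; lra].
    have -> : lam * r = lam * (K * ell) / 3 - lam by rewrite /r; field.
    have : lam * ((3 * (c0 + 9) / lam) * ell) <= lam * (K * ell).
      by apply: ler_wpM2l KL; exact: ltW.
    have -> : lam * ((3 * (c0 + 9) / lam) * ell) = 3 * (c0 * ell + 9 * ell).
      by field; exact: lt0r_neq0.
    move: (lam * (K * ell)) (c0 * ell) => q1 q2; lra.
  have L0 : 0 < L%:R :> R by lra.
  apply: le_trans (_ : L%:R ^+ 2 * (2 * L%:R) *
      (big_const t * L%:R ^+ 4 * (expR lam * (W / L%:R ^+ 9))) <= _).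
    have q4 : 0 <= big_const t * L%:R ^+ 4 by rewrite mulr_ge0 // exprn_ge0.
    apply: ler_pM.
    - by rewrite mulr_ge0 ?sqr_ge0 //; lra.
    - by rewrite mulr_ge0 ?expR_ge0.
    - by apply: ler_wpM2l; [exact: sqr_ge0 | lra].
    - exact: ler_wpM2l.
  have -> : L%:R ^+ 2 * (2 * L%:R) * (big_const t * L%:R ^+ 4 * (expR lam * (W / L%:R ^+ 9))) =
    (4 * big_const t * expR lam / L%:R ^+ 2) * (W / 2) by field; exact: lt0r_neq0.
  rewrite -[leRHS]mul1r; apply: ler_wpM2r; first by rewrite divr_ge0 // ltW.
  by rewrite ler_pdivrMr ?exprn_gt0 // mul1r (le_trans Lb).
have h2 : L%:R ^+ 2 * (L%:R + 1) * expR (- u) <= W / 2.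
  have uu2 : u2 <= u by lra.
  have := H2 _ uu2; rewrite mul1r => dec.
  have L0 : 0 < L%:R :> R by lra.
  have Wd : (L%:R ^+ d)^-1 <= W.
    rewrite WE {1}Lell -expRM_natl -expRN ler_expR lerN2.
    by apply: ler_wpM2r => //; lra.
  rewrite ler_pdivlMr //.
  apply: le_trans Wd; rewrite -[leRHS]mul1r ler_pdivlMr ?exprn_gt0 //.
  apply: le_trans dec.
  have -> : L%:R ^+ 2 * (L%:R + 1) * expR (- u) * 2 * L%:R ^+ d =
    2 * (L%:R + 1) * L%:R ^+ (2 + d) * expR (- u) by rewrite exprD; ring.
  apply: ler_wpM2r; first exact: expR_ge0.
  apply: le_trans (_ : 4 * L%:R ^+ (3 + d) <= _).
    have -> : 4 * L%:R ^+ (3 + d) = 4 * L%:R * L%:R ^+ (2 + d) :> R by rewrite -mulrA -exprS.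
    by apply: ler_wpM2r; [rewrite exprn_ge0 // ltW | lra].
  rewrite -mulrA ler_pM2l // exprM -exprMn.
  have cu0 : 0 <= c * u ^+ 3 by exact: le_trans (sqr_ge0 _) Lu.
  by rewrite lerXn2r ?nnegrE ?(ltW L0) //; exact: le_trans Lu.
by rewrite /G mulrDr; lra.
Qed.

End Rarity.

(** * Contours and clusters *)

Section Contours.
Variable A : {fset site}.
Implicit Types (gamma : set bond) (b : bond) (p x y : site) (i j k : compass).

Definition minus_config : spins := fun x => x \notin A.
Let dsg := disagreement minus_config.

Lemma disagreementE b : disagreement minus_config b <-> differ A b.
Proof.
rewrite /disagreement /differ /minus_config /=.
by case: (_ \in A); case: (_ \in A); split.
Qed.

Lemma joined_sym (B : set bond) p i j : joined B p i j -> joined B p j i.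
Proof.
move=> [ij Bi Bj h]; split => //; first by move=> ji; apply: ij.
by move=> /h; case: (i) (j) => [] [].
Qed.

Lemma joined_bonds_sym (B : set bond) b b' : joined_bonds B b b' -> joined_bonds B b' b.
Proof. by move=> [p [i [j [h -> ->]]]]; exists p, j, i; split=> //; exact: joined_sym. Qed.

Lemma joined_clos_sym (B : set bond) b b' :
  clos_refl_trans bond (joined_bonds B) b b' -> clos_refl_trans bond (joined_bonds B) b' b.
Proof.
elim=> {b b'} [b b' h|b|b b' b'' _ h1 _ h2]; first by apply: rt_step; exact: joined_bonds_sym.
  exact: rt_refl.
exact: rt_trans h2 h1.
Qed.

Lemma contour_sub gamma b : is_contour minus_config gamma -> gamma b -> dsg b.
Proof.
move=> [b0 db0 ->] /= h; elim: h db0 => {b0 b} [b b' [p [i [j [[_ _ Bj _] _ ->]]]] _|//|] //.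
by move=> b b' b'' _ h1 _ h2 /h1 /h2.
Qed.

Lemma contour_join gamma b b' : is_contour minus_config gamma ->
  gamma b -> joined_bonds dsg b b' -> gamma b'.
Proof. by move=> [b0 db0 ->] /= h hb; apply: rt_trans h _; exact: rt_step. Qed.

Lemma contour_eq gamma gamma' b : is_contour minus_config gamma ->
  is_contour minus_config gamma' -> gamma b -> gamma' b -> gamma = gamma'.
Proof.
move=> [b0 _ ->] [b1 _ ->] /= h0 h1; apply/seteqP; split => c /= hc.
  exact: rt_trans h1 (rt_trans _ _ _ _ _ (joined_clos_sym h0) hc).
exact: rt_trans h0 (rt_trans _ _ _ _ _ (joined_clos_sym h1) hc).
Qed.

Lemma contour_through b : dsg b -> exists2 gamma, is_contour minus_config gamma & gamma b.
Proof.
move=> db; exists [set b' | clos_refl_trans bond (joined_bonds dsg) b b'] => /=; last exact: rt_refl.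
by exists b.
Qed.

Definition minus_end b : site := if bond_fst b \in A then bond_fst b else bond_snd b.

Lemma connected_refl x : x \in A -> linked A x x.
Proof. by move=> xA; split => //; apply: reach_seed; rewrite inE. Qed.

Lemma connected_step x y : x \in A -> y \in A -> tadj x y -> linked A x y.
Proof.
move=> xA yA xy; split => //; apply: (reach_step (x := x)) => //.
by apply: reach_seed; rewrite inE.
Qed.

Lemma connected_trans y x z : linked A x y -> linked A y z -> linked A x z.
Proof. by move=> [xA rxy] [_ ryz]; split => //; exact: reach_trans rxy ryz. Qed.

(** Only the alternating pattern is delicate: a rounded pair surrounds one corner, and either this
    corner is the common minus end or the two minus ends are the diagonal pair of [tadj]. *)
Lemma joined_connected p i j : joined dsg p i j ->
  linked A (minus_end (dual_bond p i)) (minus_end (dual_bond p j)).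
Proof.
case: p => [p1 p2] [ij /disagreementE Bi /disagreementE Bj h].
have h' : (forall k, differ A (dual_bond (p1, p2) k)) -> rounded_pair i j.
  by move=> hk; apply: h => k; apply/disagreementE.
move: Bi Bj h' {h}.
pose sw := (p1, p2); pose se := (p1 + 1, p2); pose nw := (p1, p2 + 1); pose ne := (p1 + 1, p2 + 1).
have t1 : tadj sw se by rewrite /tadj /nnadj /=; lia.
have t2 : tadj sw nw by rewrite /tadj /nnadj /=; lia.
have t3 : tadj se ne by rewrite /tadj /nnadj /=; lia.
have t4 : tadj nw ne by rewrite /tadj /nnadj /=; lia.
have t5 : tadj sw ne by rewrite /tadj /nnadj /=; lia.
have s1 : tadj se sw by rewrite tadj_sym.
have s2 : tadj nw sw by rewrite tadj_sym.
have s3 : tadj ne se by rewrite tadj_sym.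
have s4 : tadj ne nw by rewrite tadj_sym.
have s5 : tadj ne sw by rewrite tadj_sym.
have dE k : differ A (dual_bond (p1, p2) k) = match k with
  | North => (nw \in A) != (ne \in A) | South => (sw \in A) != (se \in A)
  | East => (se \in A) != (ne \in A) | West => (sw \in A) != (nw \in A) end by case: k.
have mE k : minus_end (dual_bond (p1, p2) k) = match k with
  | North => if nw \in A then nw else ne | South => if sw \in A then sw else se
  | East => if se \in A then se else ne | West => if sw \in A then sw else nw end by case: k.
rewrite !mE !dE => Bi Bj h.
have {}h : ((nw \in A) != (ne \in A)) && ((sw \in A) != (se \in A)) &&
    ((se \in A) != (ne \in A)) && ((sw \in A) != (nw \in A)) -> rounded_pair i j.
  by move=> /andP[/andP[/andP[? ?] ?] ?]; apply: h => k; rewrite dE; case: k.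
move: Bi Bj h ij {dE mE}.
clearbody sw se nw ne.
case a1: (sw \in A); case a2: (se \in A); case a3: (nw \in A); case a4: (ne \in A);
  case: i; case: j => //= _ _ h ij; try (by case: (ij));
  first [ exact: connected_refl | exact: connected_step
        | by case: (h isT)
        | by apply: (@connected_trans ne); exact: connected_step
        | by apply: (@connected_trans sw); exact: connected_step ].
Qed.

Lemma contour_connected gamma b b' : is_contour minus_config gamma -> gamma b -> gamma b' ->
  linked A (minus_end b) (minus_end b').
Proof.
move=> ig gb gb'; have [b0 db0 gE] := ig.
have minus_in c : dsg c -> minus_end c \in A.
  by move=> /disagreementE; rewrite /differ /minus_end; case: ifP => // fA; rewrite ?fA; case: (bond_snd c \in A).
have main c : clos_refl_trans bond (joined_bonds dsg) b0 c -> linked A (minus_end b0) (minus_end c).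
  move=> h; have := db0; elim: h => {c} [c c' h dc|c dc|c c' c'' h1 IH1 _ IH2 dc].
  - by move: h => [p [i [j [jp -> ->]]]]; exact: joined_connected.
  - by apply: connected_refl; exact: minus_in.
  - apply: connected_trans (IH1 dc) (IH2 _).
    by apply: contour_sub (_ : [set b' | clos_refl_trans bond (joined_bonds dsg) c b'] c') => //; exists c.
move: gb gb'; rewrite gE /= => h1 h2.
exact: connected_trans (connected_sym (main _ h1)) (main _ h2).
Qed.

Section Local.
Variable gamma : set bond.
Hypothesis ig : is_contour minus_config gamma.
Variable p : site.
Let g k : bool := `[< gamma (dual_bond p k) >].
Let d k : bool := differ A (dual_bond p k).

Let g_sub k : g k -> d k.
Proof. by move=> /asboolP h; apply/disagreementE; exact: contour_sub h. Qed.

Let g_join i j : i <> j -> d i -> d j -> ((forall k, d k) -> rounded_pair i j) -> g i = g j.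
Proof.
move=> ij di dj h.
have jo : joined dsg p i j.
  split => //; try exact/disagreementE.
  by move=> hk; apply: h => k; exact/disagreementE/hk.
apply/asboolP/asboolP => gi.
  by apply: contour_join gi _ => //; exists p, i, j.
by apply: contour_join gi _ => //; exists p, j, i; split=> //; exact: joined_sym.
Qed.

Let d_parity : d North (+) d East (+) d South (+) d West = false.
Proof.
rewrite /d; case: p => p1 p2; rewrite /differ /bond_fst /bond_snd /=.
by case: (_ \in A) (_ \in A) (_ \in A) (_ \in A) => [] [] [] [].
Qed.

(** A contour contains both or none of two joined bonds, and the disagreement bonds at a dual site
    form joined pairs. *)
Lemma contour_parity : g North (+) g East (+) g South (+) g West = false.
Proof.
move: (@g_sub North) (@g_sub East) (@g_sub South) (@g_sub West) d_parity.
have := g_join (i := North) (j := East); have := g_join (i := North) (j := South).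
have := g_join (i := North) (j := West); have := g_join (i := East) (j := South).
have := g_join (i := East) (j := West); have := g_join (i := South) (j := West).
case dN: (d North); case dE: (d East); case dS: (d South); case dW: (d West) => //=.
all: move=> h1 h2 h3 h4 h5 h6 gN gE gS gW _.
all: try (have {}gN : g North = false by case: (g North) gN => // /(_ isT)).
all: try (have {}gE : g East = false by case: (g East) gE => // /(_ isT)).
all: try (have {}gS : g South = false by case: (g South) gS => // /(_ isT)).
all: try (have {}gW : g West = false by case: (g West) gW => // /(_ isT)).
- by rewrite h4 // h3 //; case: (g South); case: (g West).
- by rewrite h6 // ?gS ?gW ?addbF ?addbb // => hk; have := hk South; rewrite dS.
- by rewrite h5 // ?gE ?gW ?addbF ?addbb // => hk; have := hk East; rewrite dE.
- by rewrite h4 // ?gE ?gS ?addbF ?addbb // => hk; have := hk East; rewrite dE.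
- by rewrite gN gW h3 // ?addbF ?addbb // => hk; have := hk North; rewrite dN.
- by rewrite gN gS h2 // ?addbF ?addbb // => hk; have := hk North; rewrite dN.
- by rewrite gN gE h1 // ?addbF ?addbb // => hk; have := hk North; rewrite dN.
- by rewrite gN gE gS gW.
Qed.

Lemma contour_four : (forall k, d k) -> g South = g East /\ g North = g West.
Proof. by move=> h; split; apply: g_join. Qed.

End Local.
End Contours.

Section Color.
Variable A : {fset site}.
Implicit Types (x y p : site) (b : bond).

Section OneContour.
Variable gamma : set bond.
Hypothesis ig : is_contour (minus_config A) gamma.

Definition contour_bonds : {fset bond} := [fset b in touching A | `[< gamma b >]].
Let E := contour_bonds.

Lemma in_contour_bonds b : (b \in contour_bonds) = `[< gamma b >].
Proof.
rewrite in_fsetsep; case: asboolP => gb; rewrite ?andbF // andbT touchingE.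
have /disagreementE := contour_sub ig gb; rewrite /differ.
by case: (_ \in A); case: (_ \in A).
Qed.

Let E_even v : ~~ odd_degree E v.
Proof.
have := contour_parity ig v; rewrite /odd_degree /north_in /south_in /east_in /west_in.
by rewrite !in_contour_bonds => ->.
Qed.

(* Whether the horizontal half-line to the left of [x] crosses the contour an odd
   number of times, i.e. whether [x] is enclosed. *)
Definition color x : bool := row_parity E x.1 x.2.

Lemma color_bond b : color (bond_snd b) = color (bond_fst b) (+) `[< gamma b >].
Proof.
rewrite -in_contour_bonds /color; case: b => [[i j] []]; rewrite /bond_fst /bond_snd /=.
  by rewrite row_parity_succ.
rewrite -(row_parity_differ i j E_even).
by case: (row_parity _ _ _); case: (row_parity _ _ _).
Qed.

Lemma color_bounded : exists m : int, forall x, color x -> `|x.1| <= m /\ `|x.2| <= m.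
Proof.
have [m mP] := fset_bond_bound E; exists (`|m| + 1).
have row x : color x -> exists2 b, b \in E & b.1.2 = x.2 /\ b.1.1 < x.1.
  rewrite /color /row_parity => od.
  have : has (fun b : bond => [&& b.2, b.1.2 == x.2 & b.1.1 < x.1]) (enum_fset E).
    by rewrite has_count lt0n; apply/eqP => c0; rewrite c0 in od.
  by move=> /hasP[b bE /and3P[_ /eqP ? ?]]; exists b.
have out (x : site) : m <= x.2 -> color x = false.
  move=> mx; apply/negbTE/negP => /row[b bE [e _]]; have [_ _ _] := mP b bE; rewrite e.
  by move: mx; clear; lia.
have right (i : int) (k : nat) : m <= i -> color (i, m - k%:Z) = false.
  move=> mi; elim: k => [|k IH]; first by apply: out; rewrite /=; lia.
  have := color_bond ((i, m - k.+1%:Z), false); rewrite /bond_fst /bond_snd /=.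
  have -> : m - k.+1%:Z + 1 = m - k%:Z by lia.
  rewrite IH -in_contour_bonds; case iE: (_ \in _); last by rewrite addbF.
  by have [_ + _ _] := mP _ iE; rewrite /=; move: mi; clear; lia.
move=> [i j] cx; have [b bE [/= e1 e2]] := row _ cx; have [b1 b2 b3 b4] := mP b bE.
rewrite e1 in b3 b4; move: (b.1.1) b1 b2 e2 => k b1 b2 e2.
have mx : i < m.
  rewrite ltNge; apply/negP => mx; have := right i (absz (m - j)) mx.
  have -> : m - (absz (m - j))%:Z = j by move: b3 b4; clear; lia.
  by rewrite cx.
by split; move: b1 b2 b3 b4 e2 mx; clear; lia.
Qed.

Lemma color_nn b : bond_fst b \in A -> bond_snd b \in A -> color (bond_snd b) = color (bond_fst b).
Proof.
move=> b1 b2; rewrite color_bond; case: asboolP => [gb|_]; rewrite ?addbF //.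
by have /disagreementE := contour_sub ig gb; rewrite /differ b1 b2.
Qed.

(** If both other corners are plus, go around through the south and east bonds: they are a rounded
    pair, so the contour is crossed twice or not at all. *)
Lemma color_diag (i j : int) : (i, j) \in A -> (i + 1, j + 1) \in A -> color (i + 1, j + 1) = color (i, j).
Proof.
move=> a1 a2.
case a3: ((i + 1, j) \in A).
  by rewrite (color_nn (b := ((i + 1, j), false))) // (color_nn (b := ((i, j), true))).
case a4: ((i, j + 1) \in A).
  by rewrite (color_nn (b := ((i, j + 1), true))) // (color_nn (b := ((i, j), false))).
have all4 k : differ A (dual_bond (i, j) k).
  by case: k; rewrite /differ /bond_fst /bond_snd /= ?a1 ?a2 ?a3 ?a4.
have [SE _] := contour_four ig (p := (i, j)) all4.
have := color_bond ((i + 1, j), false); have := color_bond ((i, j), true).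
rewrite /bond_fst /bond_snd /= => -> ->; rewrite -[((i, j), true)]/(dual_bond (i, j) South) SE.
by rewrite /= -addbA addbb addbF.
Qed.

Lemma color_step x y : x \in A -> y \in A -> tadj x y -> color x = color y.
Proof.
case: x y => [i j] [k l] xA yA xy.
have : [\/ (k = i + 1 /\ l = j), (k = i /\ l = j + 1) | [\/ (i = k + 1 /\ j = l),
  (i = k /\ j = l + 1) | [\/ (k = i + 1 /\ l = j + 1) | (i = k + 1 /\ j = l + 1)]]].
  move: xy; rewrite /tadj /nnadj /= => xy.
  have : [|| (k == i + 1) && (l == j), (k == i) && (l == j + 1), (i == k + 1) && (j == l),
    (i == k) && (j == l + 1), (k == i + 1) && (l == j + 1) | (i == k + 1) && (j == l + 1)].
    by move: xy; clear; lia.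
  by case/or4P => [|||/or3P[]] /andP[/eqP ? /eqP ?];
    [apply: Or31|apply: Or32|apply: Or33; apply: Or31|apply: Or33; apply: Or32
    |apply: Or33; apply: Or33; left|apply: Or33; apply: Or33; right].
case=> [[e1 e2]|[e1 e2]|[[e1 e2]|[e1 e2]|[[e1 e2]|[e1 e2]]]]; subst.
- by rewrite (color_nn (b := ((i, j), true))).
- by rewrite (color_nn (b := ((i, j), false))).
- by rewrite (color_nn (b := ((k, l), true))).
- by rewrite (color_nn (b := ((k, l), false))).
- by rewrite color_diag.
- by rewrite color_diag.
Qed.

Lemma color_connected x y : linked A x y -> color x = color y.
Proof.
move=> [xA]; elim=> {y} [y|y z ry IH yz zA]; first by rewrite inE => /eqP->.
rewrite IH; apply: color_step => //.
by have := reach_in ry; rewrite !inE => /orP[//|/eqP->].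
Qed.

End OneContour.

(** Take the contour through the bond to the left of a leftmost site of the cluster. All its bonds
    have their minus end in this cluster, so none is farther left: the half-line crosses it once,
    and the colour is constant on the cluster. *)
Lemma leftmost_contour x : x \in A ->
  exists2 gamma, is_contour (minus_config A) gamma & color gamma x.
Proof.
move=> xA; pose C := [fset y in A | `[< linked A x y >]].
have xC : x \in C by rewrite in_fsetsep xA; apply/asboolP; exact: connected_refl.
have [a aC amin] := fset_argmin (fun y : site => y.1) xC.
move: (aC); rewrite in_fsetsep => /andP[aA /asboolP xa].
pose beta : bond := ((a.1 - 1, a.2), true).
have bsnd : bond_snd beta = a by rewrite /beta /bond_snd /= subrK; case: (a).
have bfst : bond_fst beta \notin A.
  apply/negP => bA; have : bond_fst beta \in C.
    rewrite in_fsetsep bA; apply/asboolP; apply: connected_trans xa _.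
    by apply: connected_step => //; rewrite /tadj /nnadj /bond_fst /=; clear; lia.
  by move=> /amin; rewrite /bond_fst /=; clear; lia.
have db : differ A beta by rewrite /differ bsnd aA (negbTE bfst).
have [gamma ig gb] := contour_through (A := A) (proj2 (disagreementE A beta) db).
exists gamma => //; rewrite (color_connected ig xa) -bsnd (color_bond ig).
have -> : `[< gamma beta >] by exact/asboolP.
rewrite addbT /color row_parity_left // => b; rewrite (in_contour_bonds ig) => /asboolP gb' b2 _.
have := contour_connected ig gb gb'.
rewrite {1}/minus_end (negbTE bfst) bsnd => ab.
have bA : minus_end A b \in A by have [] := connected_sym ab.
have /amin : minus_end A b \in C.
  by rewrite in_fsetsep bA; apply/asboolP; exact: connected_trans xa ab.
rewrite /bond_fst /= /minus_end; case: ifP => _; case: b b2 {gb' ab bA} => [[i j] o] /= o1.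
  by rewrite /bond_fst /=; clear; lia.
by rewrite /bond_snd /= o1 /=; clear; lia.
Qed.

End Color.

(** * Curves in the plane *)

Definition all_bool (f : bool -> bool) := f true && f false.

Lemma all_boolP f : all_bool f -> forall b, f b.
Proof. by move=> /andP[h1 h2] []. Qed.

Lemma bool_funE (f : bool -> bool) : exists a b, f = fun c => if c then a else b.
Proof. by exists (f true), (f false); apply/funext; case. Qed.

(* The unit square around a dual site: [v false], [v true], [h false], [h true] tell
   whether the contour uses the south, north, west and east bond, the Booleans [i]
   and [j] designate a corner ([i] for east, [j] for north). *)
Section Square.
Variables v h : bool -> bool.

Definition cut (i j : bool) : bool := [&& v j, h i & (i != j) || ~~ v (~~ j)].
Definition straight_v : bool := [&& v false, v true & ~~ h false].
Definition straight_h : bool := [&& h false, h true & ~~ v false].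

Section Signs.
(* The signs of the two coordinates and of [gap] below, as pairs (>= 0, <= 0). *)
Variables x y g : bool -> bool.

Definition quad (i j : bool) : bool := x i && y j.
Definition off_quad (i j : bool) : bool := x (~~ i) || y (~~ j).
Definition uncut (i j : bool) : bool := cut i j ==> (off_quad i j || g false).
(** A corner that is cut off owns what lies beyond its arc; another corner owns what no arc cuts
    off, on its side of a straight line if there is one. The regions are closed and may overlap
    where no curve separates them. *)
Definition region (i j : bool) : bool :=
  if cut i j then quad i j && g true else
  [&& uncut false false, uncut false true, uncut true false, uncut true true,
      straight_v ==> x i & straight_h ==> y j].
Definition cut_line (i j : bool) : bool := [&& cut i j, quad i j, g true & g false].
Definition on_line : bool :=
  [|| cut_line false false, cut_line false true, cut_line true false, cut_line true true,
      [&& straight_v, x true & x false] | [&& straight_h, y true & y false]].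

Hypothesis even : v true (+) h true (+) v false (+) h false = false.
Hypotheses (xx : x true || x false) (yy : y true || y false) (gg : g true || g false).

Lemma region_cover : [|| region false false, region false true, region true false | region true true].
Proof.
move: even xx yy gg.
rewrite /region /uncut /cut /quad /off_quad /straight_v /straight_h /=.
by case: (v true); case: (v false); case: (h true); case: (h false); case: (x true);
  case: (x false); case: (y true); case: (y false); case: (g true); case: (g false).
Qed.

Lemma region_edge i j : g true -> quad i j -> region i j.
Proof.
move: even; rewrite /region /uncut /cut /quad /off_quad /straight_v /straight_h => ev -> /andP[].
by case: i; case: j => /= -> ->; move: ev; case: (v true); case: (v false); case: (h true);
  case: (h false); rewrite //= ?orbT.
Qed.

End Signs.
End Square.

(** Regions of different colours meet only on the drawn curve. Four bonds, six signs, two corners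
    and a reference colour leave 2^15 Boolean cases, decided by computation. *)
Lemma region_inter (v h x y g : bool -> bool) (col : bool -> bool -> bool) i j i' j' :
  v true (+) h true (+) v false (+) h false = false ->
  x true || x false -> y true || y false -> g true || g false ->
  (x true && x false ==> g false) -> (y true && y false ==> g false) ->
  (forall j, col true j = col false j (+) v j) -> (forall i, col i true = col i false (+) h i) ->
  region v h x y g i j -> region v h x y g i' j' -> col i j != col i' j' -> on_line v h x y g.
Proof.
have [v1 [v0 ->]] := bool_funE v; have [h1 [h0 ->]] := bool_funE h.
have [x1 [x0 ->]] := bool_funE x; have [y1 [y0 ->]] := bool_funE y.
have [g1 [g0 ->]] := bool_funE g => ev xx yy gg xg yg cv ch.
have cE k l : col k l = col false false (+) (if k then v0 else false) (+)
    (if l then (if k then h1 else h0) else false).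
  by case: k; case: l; rewrite ?addbF //= ?ch cv ?addbF.
rewrite (cE i j) (cE i' j') {cE cv ch} => r1 r2; move: (col false false) r1 r2 => c r1 r2 ne.
pose f (b1 b0 : bool) := fun b : bool => if b then b1 else b0.
pose test v1 v0 h1 h0 x1 x0 y1 y0 g1 g0 i j i' j' c :=
  ((v1 (+) h1 (+) v0 (+) h0) == false) && (x1 || x0) && (y1 || y0) && (g1 || g0) &&
  (x1 && x0 ==> g0) && (y1 && y0 ==> g0) &&
  region (f v1 v0) (f h1 h0) (f x1 x0) (f y1 y0) (f g1 g0) i j &&
  region (f v1 v0) (f h1 h0) (f x1 x0) (f y1 y0) (f g1 g0) i' j' &&
  (c (+) (if i then v0 else false) (+) (if j then (if i then h1 else h0) else false) !=
   c (+) (if i' then v0 else false) (+) (if j' then (if i' then h1 else h0) else false)) ==>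
  on_line (f v1 v0) (f h1 h0) (f x1 x0) (f y1 y0) (f g1 g0).
have check : all_bool (fun v1 => all_bool (fun v0 => all_bool (fun h1 => all_bool (fun h0 =>
  all_bool (fun x1 => all_bool (fun x0 => all_bool (fun y1 => all_bool (fun y0 =>
  all_bool (fun g1 => all_bool (fun g0 => all_bool (fun i => all_bool (fun j =>
  all_bool (fun i' => all_bool (fun j' => all_bool (fun c =>
  test v1 v0 h1 h0 x1 x0 y1 y0 g1 g0 i j i' j' c))))))))))))))) by vm_compute.
move/all_boolP/(_ v1)/all_boolP/(_ v0)/all_boolP/(_ h1)/all_boolP/(_ h0): check.
move=> /all_boolP/(_ x1)/all_boolP/(_ x0)/all_boolP/(_ y1)/all_boolP/(_ y0).
move=> /all_boolP/(_ g1)/all_boolP/(_ g0)/all_boolP/(_ i)/all_boolP/(_ j).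
move=> /all_boolP/(_ i')/all_boolP/(_ j')/all_boolP/(_ c)/implyP; apply.
rewrite /= in ev xx yy gg xg yg.
by rewrite ev xx yy gg xg yg r1 r2 ne.
Qed.

Section BooleanClosed.
Variable T : topologicalType.
Implicit Types f g : T -> bool.

Lemma closed_andb f g : closed [set z | f z] -> closed [set z | g z] -> closed [set z | f z && g z].
Proof.
move=> cf cg; have -> : [set z | f z && g z] = ([set z | f z] `&` [set z | g z])%classic.
  by apply/seteqP; split => z /=; [move=> /andP | move=> [? ?]; apply/andP].
exact: closedI.
Qed.

Lemma closed_orb f g : closed [set z | f z] -> closed [set z | g z] -> closed [set z | f z || g z].
Proof.
move=> cf cg; have -> : [set z | f z || g z] = ([set z | f z] `|` [set z | g z])%classic.
  by apply/seteqP; split => z /=; [move=> /orP | move=> [?|?]; apply/orP; [left|right]].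
exact: closedU.
Qed.

Lemma closed_impb (b : bool) f : closed [set z | f z] -> closed [set z | b ==> f z].
Proof. by case: b. Qed.

Lemma closed_region (v h : bool -> bool) (x y g : T -> bool -> bool) i j :
  (forall b, closed [set z | x z b]) -> (forall b, closed [set z | y z b]) ->
  (forall b, closed [set z | g z b]) -> closed [set z | region v h (x z) (y z) (g z) i j].
Proof.
move=> cx cy cg; rewrite /region /uncut /quad /off_quad; case: (cut v h i j).
  by apply: closed_andb; [apply: closed_andb|].
have cu i' j' : closed [set z | cut v h i' j' ==> [|| x z (~~ i'), y z (~~ j') | g z false]].
  by apply: closed_impb; do 2 apply: closed_orb => //.
have -> : [set z | [&& cut v h false false ==> (x z (~~ false) || y z (~~ false)) || g z false,
    cut v h false true ==> (x z (~~ false) || y z (~~ true)) || g z false,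
    cut v h true false ==> (x z (~~ true) || y z (~~ false)) || g z false,
    cut v h true true ==> (x z (~~ true) || y z (~~ true)) || g z false,
    straight_v v h ==> x z i & straight_h v h ==> y z j]] =
  [set z | [&& cut v h false false ==> [|| x z (~~ false), y z (~~ false) | g z false],
    cut v h false true ==> [|| x z (~~ false), y z (~~ true) | g z false],
    cut v h true false ==> [|| x z (~~ true), y z (~~ false) | g z false],
    cut v h true true ==> [|| x z (~~ true), y z (~~ true) | g z false],
    straight_v v h ==> x z i & straight_h v h ==> y z j]].
  by apply/seteqP; split => z /=; rewrite !orbA.
by do ! (apply: closed_andb; first by [exact: cu | apply: closed_impb]); apply: closed_impb.
Qed.

End BooleanClosed.

(** * Zones of the corners in the unit squares around dual sites *)

Section Plane.
Variable R : realType.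
Implicit Types (p x : site) (z w : R * R) (gamma : set bond).

Definition rel_x p z : R := z.1 - (p.1%:~R + 2^-1).
Definition rel_y p z : R := z.2 - (p.2%:~R + 2^-1).
(* Vanishes exactly on the four rounded corners. *)
Definition gap p z : R := Num.sqrt (2 * `|rel_x p z|) + Num.sqrt (2 * `|rel_y p z|) - 1.
Definition sign (r : R) (b : bool) : bool := if b then 0 <= r else r <= 0.
Definition in_square p z : bool := (`|rel_x p z| <= 2^-1) && (`|rel_y p z| <= 2^-1).

Lemma rel_x_continuous p : continuous (rel_x p).
Proof. by move=> z; apply: cvgB; [exact: cvg_fst | exact: cvg_cst]. Qed.

Lemma rel_y_continuous p : continuous (rel_y p).
Proof. by move=> z; apply: cvgB; [exact: cvg_snd | exact: cvg_cst]. Qed.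

Lemma gap_continuous p : continuous (gap p).
Proof.
have c (f : R * R -> R) : continuous f -> continuous (fun z => Num.sqrt (2 * `|f z|)).
  move=> cf z; apply: (continuous_comp (f := fun z => 2 * `|f z|) (g := Num.sqrt)).
    apply: cvgM; first exact: cvg_cst.
    by apply: (continuous_comp (f := f) (g := Num.norm)); [exact: cf | exact: norm_continuous].
  exact: sqrt_continuous.
move=> z; apply: cvgB; last exact: cvg_cst.
by apply: cvgD; apply: c; [exact: rel_x_continuous | exact: rel_y_continuous].
Qed.

Lemma closed_le_fun (f : R * R -> R) (a : R) : continuous f -> closed [set z | f z <= a].
Proof. by move=> /continuous_closedP cf; apply: (cf [set x | x <= a]); exact: closed_le. Qed.

Lemma closed_ge_fun (f : R * R -> R) (a : R) : continuous f -> closed [set z | a <= f z].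
Proof. by move=> /continuous_closedP cf; apply: (cf [set x | a <= x]); exact: closed_ge. Qed.

Lemma closed_sign (f : R * R -> R) b : continuous f -> closed [set z | sign (f z) b].
Proof. by move=> cf; case: b; [exact: closed_ge_fun | exact: closed_le_fun]. Qed.

Lemma closed_in_square p : closed [set z | in_square p z].
Proof.
apply: closed_andb; apply: closed_le_fun => z.
  apply: (continuous_comp (f := rel_x p) (g := Num.norm)); [exact: rel_x_continuous | exact: norm_continuous].
apply: (continuous_comp (f := rel_y p) (g := Num.norm)); [exact: rel_y_continuous | exact: norm_continuous].
Qed.

Definition bond_v gamma p (j : bool) : bool :=
  `[< gamma (dual_bond p (if j then North else South)) >].
Definition bond_h gamma p (i : bool) : bool :=
  `[< gamma (dual_bond p (if i then East else West)) >].
Definition corner p (i j : bool) : site :=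
  (if i then p.1 + 1 else p.1, if j then p.2 + 1 else p.2).
Definition zone gamma p (i j : bool) z : bool := in_square p z &&
  region (bond_v gamma p) (bond_h gamma p) (sign (rel_x p z)) (sign (rel_y p z)) (sign (gap p z)) i j.

Lemma closed_zone gamma p i j : closed [set z | zone gamma p i j z].
Proof.
apply: closed_andb; first exact: closed_in_square.
apply: closed_region => b; apply: closed_sign;
  [exact: rel_x_continuous | exact: rel_y_continuous | exact: gap_continuous].
Qed.

Lemma sign_total (r : R) : sign r true || sign r false.
Proof. exact: le_total. Qed.

Lemma sign_eq0 (r : R) : sign r true && sign r false -> r = 0.
Proof. by move=> /andP[a b]; apply/eqP; rewrite eq_le [_ <= 0]b [0 <= _]a. Qed.

Lemma sqrt_double_le1 (r : R) : `|r| <= 2^-1 -> Num.sqrt (2 * `|r|) <= 1.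
Proof.
by move=> h; rewrite -[leRHS]sqrtr1 ler_wsqrtr // -ler_pdivlMl // mulr1.
Qed.

Lemma gap_axis p z : in_square p z ->
  (sign (rel_x p z) true && sign (rel_x p z) false ==> sign (gap p z) false) /\
  (sign (rel_y p z) true && sign (rel_y p z) false ==> sign (gap p z) false).
Proof.
move=> /andP[hx hy]; split; apply/implyP => /sign_eq0 e;
  rewrite /sign /gap e normr0 mulr0 sqrtr0 ?addr0 ?add0r subr_le0; exact: sqrt_double_le1.
Qed.

Lemma gap_edge p z : `|rel_x p z| = 2^-1 \/ `|rel_y p z| = 2^-1 -> sign (gap p z) true.
Proof.
have s1 : Num.sqrt (2 * 2^-1) = 1 :> R by rewrite mulfV // sqrtr1.
by case=> e; rewrite /sign /gap e s1 subr_ge0 ?lerDl ?lerDr sqrtr_ge0.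
Qed.

Lemma arc_coords p i j (a b : R) :
  dual_point R p + a *: direction R i + b *: direction R j =
  (p.1%:~R + 2^-1 + a * (direction R i).1 + b * (direction R j).1,
   p.2%:~R + 2^-1 + a * (direction R i).2 + b * (direction R j).2).
Proof. by []. Qed.

Lemma on_line_curve gamma p z : in_square p z ->
  on_line (bond_v gamma p) (bond_h gamma p) (sign (rel_x p z)) (sign (rel_y p z)) (sign (gap p z)) ->
  curve gamma z.
Proof.
move=> /andP[sx sy].
have zE1 : z.1 = p.1%:~R + 2^-1 + rel_x p z by rewrite /rel_x addrC subrK.
have zE2 : z.2 = p.2%:~R + 2^-1 + rel_y p z by rewrite /rel_y addrC subrK.
have cutc i j : cut_line (bond_v gamma p) (bond_h gamma p) (sign (rel_x p z)) (sign (rel_y p z))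
    (sign (gap p z)) i j -> curve gamma z.
  move=> /and4P[/and3P[/asboolP vj /asboolP hi ij] /andP[qx qy] g1 g2].
  have g0 : gap p z = 0 by apply: sign_eq0; rewrite g1.
  exists p, (if j then North else South), (if i then East else West); split.
    split => //; first by case: (i) (j) => [] [].
    move=> all4; case: (i) (j) ij => [] [] //=.
    - by rewrite /bond_v; case: asboolP => //; case; exact: all4.
    - by rewrite /bond_v; case: asboolP => //; case; exact: all4.
  have [t [t0 t1 ux uy]] : exists t : R, [/\ 0 <= t, t <= 1,
      `|rel_x p z| = t ^+ 2 / 2 & `|rel_y p z| = (1 - t) ^+ 2 / 2].
    (* Relative to [p], the arc from the vertical to the horizontal bond has abscissa t^2 / 2 and
       ordinate (1 - t)^2 / 2 in absolute value; this recovers the parameter t. *)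
    exists (Num.sqrt (2 * `|rel_x p z|)).
    have tE : 1 - Num.sqrt (2 * `|rel_x p z|) = Num.sqrt (2 * `|rel_y p z|).
      by move: g0; rewrite /gap; move: (Num.sqrt _) (Num.sqrt _) => r1 r2; lra.
    split; first exact: sqrtr_ge0.
    - by rewrite -subr_ge0 tE sqrtr_ge0.
    - by rewrite sqr_sqrtr ?mulr_ge0 // mulrC mulKf.
    - by rewrite tE sqr_sqrtr ?mulr_ge0 // mulrC mulKf.
  exists t; first by rewrite /= in_itv /= t0.
  move: zE1 zE2 ux uy qx qy; rewrite /sign; move: (rel_x _ _) (rel_y _ _) => X Y.
  case: z {sx sy g1 g2 g0} => z1 z2 /= e1 e2.
  case: i {hi ij}; case: j {vj} => u1 u2 h1 h2; move: u1 u2;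
    rewrite ?(ger0_norm h1) ?(ler0_norm h1) ?(ger0_norm h2) ?(ler0_norm h2) => u1 u2;
    rewrite arc_coords /=; congr (_, _); lra.
rewrite /on_line => /or4P[/cutc//|/cutc//|/cutc//|/or3P[/cutc//| |]].
- move=> /andP[/and3P[/asboolP v0 /asboolP v1 /negP h0] /sign_eq0 x0].
  exists p, South, North; split.
    by split => // /(_ West) hW; case: h0; exact/asboolP.
  exists (rel_y p z + 2^-1).
    by rewrite /= in_itv /=; move: sy; rewrite ler_norml => /andP[]; lra.
  rewrite arc_coords; move: zE1 zE2; rewrite x0; case: z {sx sy x0 cutc} => z1 z2 /=; move: (rel_y _ _) => Y -> ->.
  by congr (_, _); field.
- move=> /andP[/and3P[/asboolP v0 /asboolP v1 /negP h0] /sign_eq0 y0].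
  exists p, West, East; split.
    by split => // /(_ South) hW; case: h0; exact/asboolP.
  exists (rel_x p z + 2^-1).
    by rewrite /= in_itv /=; move: sx; rewrite ler_norml => /andP[]; lra.
  rewrite arc_coords; move: zE1 zE2; rewrite y0; case: z {sx sy y0 cutc} => z1 z2 /=; move: (rel_x _ _) => X -> ->.
  by congr (_, _); field.
Qed.

End Plane.

Lemma closed_exists (T : topologicalType) (I : eqType) (s : seq I) (F : I -> T -> bool) :
  (forall q, closed [set z | F q z]) -> closed [set z | has (fun q => F q z) s].
Proof.
move=> cF; elim: s => [|q s IH] /=; last exact: closed_orb.
by rewrite (_ : mkset _ = set0); [exact: closed0 | apply/seteqP; split].
Qed.

Lemma bounded_coords (R : realType) (V : set (R * R)) (M : R) :
  (forall w, V w -> `|w.1| <= M /\ `|w.2| <= M) -> bounded_set V.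
Proof.
move=> VM; exists M; split; first exact: num_real.
move=> B MB w /VM[h1 h2]; rewrite /= prod_normE ge_max.
by apply/andP; split; apply: le_trans (ltW MB).
Qed.

Section Separation.
Variable R : realType.
Variable A : {fset site}.
Variable gamma : set bond.
Hypothesis ig : is_contour (minus_config A) gamma.
Implicit Types (p x : site) (z w : R * R).

Lemma color_v p j : color A gamma (corner p true j) =
  color A gamma (corner p false j) (+) bond_v gamma p j.
Proof.
case: p => p1 p2.
have := color_bond ig (dual_bond (p1, p2) (if j then North else South)).
by case: j.
Qed.

Lemma color_h p i : color A gamma (corner p i true) =
  color A gamma (corner p i false) (+) bond_h gamma p i.
Proof.
case: p => p1 p2.
have := color_bond ig (dual_bond (p1, p2) (if i then East else West)).
by case: i.
Qed.

Lemma bonds_even p : bond_v gamma p true (+) bond_h gamma p true (+) bond_v gamma p false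
  (+) bond_h gamma p false = false.
Proof. exact: contour_parity ig p. Qed.

Lemma zone_cover p z : in_square p z -> exists i j, zone gamma p i j z.
Proof.
move=> sq; rewrite /zone sq /=.
have := region_cover (bonds_even p) (sign_total (rel_x p z)) (sign_total (rel_y p z))
  (sign_total (gap p z)).
by case/or4P => h; do 2 eexists; exact: h.
Qed.

Lemma zone_color_same p z i j i' j' : ~ curve gamma z -> zone gamma p i j z ->
  zone gamma p i' j' z -> color A gamma (corner p i j) = color A gamma (corner p i' j').
Proof.
move=> nz /andP[sq r1] /andP[_ r2]; apply/eqP/negPn/negP => ne; apply: nz.
have [g1 g2] := gap_axis sq; apply: (on_line_curve sq).
apply: (@region_inter _ _ _ _ _ (fun k l => color A gamma (corner p k l)) i j i' j');
  by [exact: bonds_even | exact: sign_total | exact: color_v | exact: color_h |].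
Qed.

Lemma zone_edge p i j z : in_square p z -> `|rel_x p z| = 2^-1 \/ `|rel_y p z| = 2^-1 ->
  sign (rel_x p z) i -> sign (rel_y p z) j -> zone gamma p i j z.
Proof.
move=> sq /gap_edge g sx sy; rewrite /zone sq /=.
by apply: region_edge => //; [exact: bonds_even | apply/andP].
Qed.

Lemma shared_end (a a' : int) (r : R) :
  `|r - (a%:~R + 2^-1)| <= 2^-1 -> `|r - (a'%:~R + 2^-1)| <= 2^-1 ->
  exists i i', [/\ (if i then a + 1 else a) = (if i' then a' + 1 else a'),
    sign (r - (a%:~R + 2^-1)) i, sign (r - (a'%:~R + 2^-1)) i' &
    a <> a' -> `|r - (a%:~R + 2^-1)| = 2^-1 /\ `|r - (a'%:~R + 2^-1)| = 2^-1].
Proof.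
wlog le : a a' / a <= a'.
  move=> H h h'; have [le|/ltW le] := leP a a'; first exact: H.
  have [i [i' [e s s' f]]] := H _ _ le h' h; exists i', i; split => // ne.
  by have [] := f (fun e => ne (esym e)).
have [<- h _|ne] := eqVneq a a'.
  by exists (0 <= r - (a%:~R + 2^-1)), (0 <= r - (a%:~R + 2^-1)); rewrite /sign; case: leP => // /ltW.
have lt : a + 1 <= a' by move: le ne; clear; lia.
have : (a + 1)%:~R <= a'%:~R :> R by rewrite ler_int.
rewrite intrD !ler_norml => l /andP[h1 h2] /andP[h3 h4].
have e1 : r = a%:~R + 1 by move: l h1 h2 h3 h4; move: (a%:~R : R) (a'%:~R : R) => *; lra.
have e2 : a'%:~R = a%:~R + 1 :> R by move: l h1 h2 h3 h4; move: (a%:~R : R) (a'%:~R : R) => *; lra.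
have e3 : a' = a + 1 by apply/eqP; rewrite -(eqr_int R) intrD e2.
exists true, false; rewrite e2 e1 e3 /sign.
have -> : a%:~R + 1 - (a%:~R + 2^-1) = 2^-1 :> R by field.
have -> : a%:~R + 1 - (a%:~R + 1 + 2^-1) = - 2^-1 :> R by field.
by rewrite invr_ge0 oppr_le0 invr_ge0 normrN ger0_norm ?invr_ge0.
Qed.

(** A point of two different squares is on their common boundary, where a corner shared by both
    squares has it in its zone on either side. *)
Lemma zone_color p p' z i j i' j' : ~ curve gamma z -> zone gamma p i j z ->
  zone gamma p' i' j' z -> color A gamma (corner p i j) = color A gamma (corner p' i' j').
Proof.
move=> nz z1 z2; have [e|ne] := eqVneq p p'.
  by rewrite e in z1 *; exact: zone_color_same z2.
have /andP[sq1 _] := z1; have /andP[sq2 _] := z2.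
have /andP[x1 y1] := sq1; have /andP[x2 y2] := sq2.
have [k [k' [ex sx sx' fx]]] := shared_end x1 x2.
have [l [l' [ey sy sy' fy]]] := shared_end y1 y2.
have [b1 b2] : (`|rel_x p z| = 2^-1 \/ `|rel_y p z| = 2^-1) /\
    (`|rel_x p' z| = 2^-1 \/ `|rel_y p' z| = 2^-1).
  have [e1|n1] := eqVneq p.1 p'.1; last by have [] := fx (elimN eqP n1); split; left.
  have n2 : p.2 <> p'.2.
    by move=> e2; case/eqP: ne; case: (p) (p') e1 e2 => [? ?] [? ?] /= -> ->.
  by have [] := fy n2; split; right.
have w1 := zone_edge sq1 b1 sx sy; have w2 := zone_edge sq2 b2 sx' sy'.
rewrite (zone_color_same nz z1 w1) (zone_color_same nz z2 w2).
by congr (color _ _ _); rewrite /corner ex ey.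
Qed.

Lemma floor_square z : in_square (Num.floor z.1, Num.floor z.2) z.
Proof.
have f (r : R) : `|r - ((Num.floor r)%:~R + 2^-1)| <= 2^-1.
  have := floor_itv r; rewrite intrD => /andP[].
  by move: ((Num.floor r)%:~R : R) => f h1 h2; rewrite ler_norml; apply/andP; split; lra.
by rewrite /in_square !f.
Qed.

Lemma near_end (a : int) (b : bool) (r : R) : `|r - (a%:~R + 2^-1)| <= 2^-1 ->
  `|r - (if b then a + 1 else a)%:~R| <= 1.
Proof.
by case: b; rewrite ?intrD; move: (a%:~R : R) => f; rewrite !ler_norml => /andP[? ?];
  apply/andP; split; lra.
Qed.

Lemma square_near_corner p i j z : in_square p z ->
  `|z.1 - (corner p i j).1%:~R| <= 1 /\ `|z.2 - (corner p i j).2%:~R| <= 1.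
Proof. by move=> /andP[hx hy]; split; exact: near_end. Qed.

(** Off the curve, the points in coloured zones and the remaining ones are covered by two disjoint
    closed sets, so the component of [z] stays among the former, which are bounded. The closed set
    [out] of far points reduces both covers to finitely many squares. *)
Lemma zone_component p i j z : ~ curve gamma z -> zone gamma p i j z ->
  color A gamma (corner p i j) ->
  bounded_set (connected_component (~` curve gamma)%classic z).
Proof.
move=> nz zz cz; have [m mP] := color_bounded ig.
have m0 : 0 <= m by have [h _] := mP _ cz; exact: le_trans h.
pose F := rect (- (m + 2)) (m + 1) (- (m + 2)) (m + 1).
pose s := [seq (q, ij) | q <- enum_fset F,
   ij <- [:: (true, true); (true, false); (false, true); (false, false)]].
have sP q k l : q \in F -> (q, (k, l)) \in s.
  by move=> qF; apply: (allpairs_f (fun a b => (a, b))) => //; case: k; case: l; rewrite !inE.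
pose K v w := has (fun q => (color A gamma (corner q.1 q.2.1 q.2.2) == v) &&
  zone gamma q.1 q.2.1 q.2.2 w) s.
pose out w := ((m + 2)%:~R <= `|w.1|) || ((m + 2)%:~R <= `|w.2|).
have cK v : closed [set w | K v w].
  apply: closed_exists => q; case: (_ == v) => /=; first exact: closed_zone.
  by rewrite (_ : mkset _ = set0); [exact: closed0 | apply/seteqP; split].
have cout : closed [set w | out w].
  have cn (f : R * R -> R) : continuous f -> continuous (fun w => `|f w|).
    by move=> cf w; apply: (continuous_comp (f := f) (g := Num.norm)); [exact: cf | exact: norm_continuous].
  apply: closed_orb; apply: closed_ge_fun; apply: cn => w; [exact: cvg_fst | exact: cvg_snd].
have near_origin w : K true w -> `|w.1| <= (m + 1)%:~R /\ `|w.2| <= (m + 1)%:~R.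
  move=> /hasP[[q [k l]] _ /andP[/eqP /= cq zq]].
  have [h1 h2] := mP _ cq; have /andP[sq _] := zq; have [d1 d2] := square_near_corner k l sq.
  have aux (r : R) (a : int) : `|r - a%:~R| <= 1 -> `|a| <= m -> `|r| <= (m + 1)%:~R.
    move=> ra am; have : `|a%:~R| <= m%:~R :> R by rewrite -intr_norm ler_int.
    rewrite intrD; have := ler_normD (r - a%:~R) a%:~R; rewrite subrK.
    move: (`|_|) (`|_|) (`|_|) ra => x1 x2 x3; lra.
  by split; [exact: aux h1 | exact: aux h2].
have cover w : K true w \/ (out w \/ K false w).
  case ow: (out w); first by right; left.
  have := floor_square w; set q := (_, _) => sq.
  have qF : q \in F.
    move/negbT: ow; rewrite /out negb_or -!ltNge !ltr_norml => /andP[/andP[a1 a2] /andP[b1 b2]].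
    rewrite in_rect /q /= !floor_ge_int // -!ltzD1 !floor_lt_int //.
    rewrite -!addrA -[1 + 1]/2 a2 b2 !rmorphN !(ltW a1) !(ltW b1); done.
  have [k [l zq]] := zone_cover sq.
  have hq v : color A gamma (corner q k l) = v -> K v w.
    by move=> cv; apply/hasP; exists (q, (k, l)); [exact: sP | rewrite /= cv eqxx].
  by case cq: (color A gamma (corner q k l)); [left | right; right]; exact: hq.
have excl w : ~ curve gamma w -> K true w -> ~ (out w \/ K false w).
  move=> nw K1 [ow|K0].
    have [h1 h2] := near_origin w K1.
    have lt : (m + 1)%:~R < (m + 2)%:~R :> R by rewrite ltr_int; lia.
    by case/orP: ow => h; have := lt_le_trans lt (le_trans h _); move=> /(_ _ _); [
      have := le_trans h h1 | have := le_trans h h2]; rewrite leNgt lt.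
  case/hasP: K1 => -[q [k l]] _ /andP[/eqP /= c1 z1].
  case/hasP: K0 => -[q' [k' l']] _ /andP[/eqP /= c0 z0].
  by have := zone_color nw z1 z0; rewrite c1 c0.
set U := connected_component _ z.
have Unot w : U w -> ~ curve gamma w by exact: connected_component_sub.
have Uz : U z by exact: connected_component_refl.
have UK : (U `&` [set w | K true w])%classic = U.
  apply: (component_connected (A := (~` curve gamma)%classic) (x := z)).
  - exists z; split=> //; apply/hasP; exists (p, (i, j)); last by rewrite /= cz zz.
    apply: sP; have [h1 h2] := mP _ cz; rewrite in_rect.
    by move: h1 h2; rewrite /corner /=; case: (p) => [p1 p2] /=; case: i {cz zz}; case: j => /=; clear; lia.
  - exists (~` ([set w | out w] `|` [set w | K false w]))%classic.
      by apply: closed_openC; exact: closedU.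
    apply/seteqP; split => w [Uw h]; split=> //=; first exact: excl (Unot _ Uw) h.
    by have [|/h] := cover w.
  - by exists [set w | K true w].
by apply: (@bounded_coords _ _ (m + 1)%:~R) => w; rewrite -UK => -[_ /near_origin].
Qed.

Lemma zone_enclosed p i j z : ~ curve gamma z -> zone gamma p i j z ->
  color A gamma (corner p i j) -> enclosed gamma z.
Proof. by move=> nz zz cz; split=> //; exact: zone_component zz cz. Qed.

End Separation.

Section Arcs.
Variable R : realType.
Implicit Types (p x : site) (z w : R * R) (i j k : compass).

Definition site_point x : R * R := (x.1%:~R, x.2%:~R).

Definition midpoint p i z : Prop :=
  rel_x p z = (direction R i).1 / 2 /\ rel_y p z = (direction R i).2 / 2.

Lemma arc_data p i j z : arc p i j z -> exists a b : R,
  [/\ 0 <= a, 0 <= b, 0 < a + b,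
      rel_x p z = a * (direction R i).1 + b * (direction R j).1 /\
      rel_y p z = a * (direction R i).2 + b * (direction R j).2 &
      [\/ a = 2^-1 /\ b = 0, a = 0 /\ b = 2^-1 | a + b < 2^-1]].
Proof.
move=> [t /= tI <-]; exists ((1 - t) ^+ 2 / 2), (t ^+ 2 / 2); rewrite arc_coords /rel_x /rel_y /=.
move: tI; rewrite in_itv /= => /andP[t0 t1].
split; try by rewrite divr_ge0 ?sqr_ge0.
- nra.
- by split; ring.
- have [->|tn0] := eqVneq t 0; first by apply: Or31; split; field.
  have [->|tn1] := eqVneq t 1; first by apply: Or32; split; field.
  have t0' : 0 < t by rewrite lt_def tn0.
  have t1' : t < 1 by rewrite lt_def eq_sym tn1.
  by apply: Or33; nra.
Qed.

Lemma direction_norm i : `|(direction R i).1| + `|(direction R i).2| = 1.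
Proof. by case: i; rewrite /= ?normrN ?normr0 ?normr1 ?addr0 ?add0r. Qed.

Lemma arc_norm p i j z a b : 0 <= a -> 0 <= b ->
  rel_x p z = a * (direction R i).1 + b * (direction R j).1 ->
  rel_y p z = a * (direction R i).2 + b * (direction R j).2 ->
  `|rel_x p z| + `|rel_y p z| <= a + b.
Proof.
move=> a0 b0 -> ->.
have := direction_norm i; have := direction_norm j.
move: (direction R i) (direction R j) => [u1 u2] [v1 v2] /= hv hu.
have h1 := ler_normD (a * u1) (b * v1); have h2 := ler_normD (a * u2) (b * v2).
rewrite !normrM (ger0_norm a0) (ger0_norm b0) in h1 h2.
apply: le_trans (lerD h1 h2) _; rewrite addrACA -!mulrDr hu hv !mulr1; exact: lexx.
Qed.

Lemma arc_diamond p i j z : arc p i j z -> `|rel_x p z| + `|rel_y p z| <= 2^-1.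
Proof.
move=> /arc_data[a [b [a0 b0 _ [hx hy] c]]]; apply: le_trans (arc_norm a0 b0 hx hy) _.
by case: c => [[-> ->]|[-> ->]|/ltW //]; rewrite ?addr0 ?add0r.
Qed.

Lemma arc_in_square p i j z : arc p i j z -> in_square p z.
Proof.
move=> /arc_diamond; have := normr_ge0 (rel_x p z); have := normr_ge0 (rel_y p z).
by rewrite /in_square; move: (`|_|) (`|_|) => r1 r2 *; apply/andP; split; lra.
Qed.

(** Strictly between its ends an arc is in the open diamond of radius 1/2, hence inside the square;
    so curves in different squares can meet only at midpoints of bonds. *)
Lemma arc_tip p i j z : arc p i j z -> `|rel_x p z| = 2^-1 \/ `|rel_y p z| = 2^-1 ->
  midpoint p i z \/ midpoint p j z.
Proof.
move=> /arc_data[a [b [a0 b0 _ [hx hy] c]]] e.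
case: c => [[ea eb]|[ea eb]|lt].
- by left; split; rewrite ?hx ?hy ea eb mul0r addr0 mulrC.
- by right; split; rewrite ?hx ?hy ea eb mul0r add0r mulrC.
- exfalso; have := arc_norm a0 b0 hx hy.
  have := normr_ge0 (rel_x p z); have := normr_ge0 (rel_y p z).
  by case: e => ->; move: (`|_|) => r; lra.
Qed.

Lemma midpoint_inj p i j z : midpoint p i z -> midpoint p j z -> i = j.
Proof.
rewrite /midpoint; move: (rel_x p z) (rel_y p z) => X Y.
by case: i; case: j => //= -[h1 h2] [e1 e2]; exfalso; lra.
Qed.

Lemma int_half (n : int) (r : R) : `|n%:~R + r| <= 2^-1 ->
  [/\ r = 0 -> n = 0, r = 2^-1 -> n = 0 \/ n = -1 & r = - 2^-1 -> n = 0 \/ n = 1].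
Proof.
rewrite ler_norml => /andP[h1 h2]; split=> e; rewrite e in h1 h2.
- have : (-1)%:~R < n%:~R :> R by lra.
  have : n%:~R < 1%:~R :> R by lra.
  by rewrite !ltr_int; clear; lia.
- have : (-2)%:~R < n%:~R :> R by lra.
  have : n%:~R < 1%:~R :> R by lra.
  rewrite !ltr_int; clear => ? ?; have : (n == 0) || (n == -1) by lia.
  by move=> /orP[] /eqP; [left|right].
- have : (-1)%:~R < n%:~R :> R by lra.
  have : n%:~R < 2%:~R :> R by lra.
  rewrite !ltr_int; clear => ? ?; have : (n == 0) || (n == 1) by lia.
  by move=> /orP[] /eqP; [left|right].
Qed.

Lemma midpoint_shared p p' i z : midpoint p' i z -> in_square p z -> p != p' ->
  exists k, dual_bond p k = dual_bond p' i /\ midpoint p k z.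
Proof.
case: p p' => [p1 p2] [q1 q2] [mx my] /andP[sx sy] ne.
have ex : rel_x (p1, p2) z = (q1 - p1)%:~R + rel_x (q1, q2) z by rewrite /rel_x intrB /=; ring.
have ey : rel_y (p1, p2) z = (q2 - p2)%:~R + rel_y (q1, q2) z by rewrite /rel_y intrB /=; ring.
move: sx sy; rewrite ex ey mx my => /int_half[x0 xp xm] /int_half[y0 yp ym].
have pq : q1 - p1 = 0 -> q2 - p2 = 0 -> False.
  by move=> e1 e2; move: ne; rewrite siteE /= => /negP; apply; clear -e1 e2; lia.
rewrite /midpoint ex ey mx my; case: i {mx my} x0 xp xm y0 yp ym => /= x0 xp xm y0 yp ym.
- have e1 := x0 (mul0r _); have [e2|e2] := yp (mul1r _); first by case: pq.
  exists South; rewrite e1 e2 /=; split; last by split; lra.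
  by congr ((_, _), _); clear -e1 e2; lia.
- have e1 := y0 (mul0r _); have [e2|e2] := xp (mul1r _); first by case: pq.
  exists West; rewrite e1 e2 /=; split; last by split; lra.
  by congr ((_, _), _); clear -e1 e2; lia.
- have e1 := x0 (mul0r _); have [e2|e2] := ym (mulN1r _); first by case: pq.
  exists North; rewrite e1 e2 /=; split; last by split; lra.
  by congr ((_, _), _); clear -e1 e2; lia.
- have e1 := y0 (mul0r _); have [e2|e2] := xm (mulN1r _); first by case: pq.
  exists East; rewrite e1 e2 /=; split; last by split; lra.
  by congr ((_, _), _); clear -e1 e2; lia.
Qed.

Lemma site_half p x : 2^-1 <= `|rel_x p (site_point x)| /\ 2^-1 <= `|rel_y p (site_point x)|.
Proof.
have aux (n m : int) : 2^-1 <= `|n%:~R - (m%:~R + 2^-1) : R|.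
  have [le|lt] := leP n m.
    have : n%:~R <= m%:~R :> R by rewrite ler_int.
    by rewrite ler_normr => h; apply/orP; right; lra.
  have : (m + 1)%:~R <= n%:~R :> R by rewrite ler_int; lia.
  by rewrite intrD ler_normr => h; apply/orP; left; lra.
by split; exact: aux.
Qed.

Lemma site_off_curve gamma x : ~ curve gamma (site_point x).
Proof.
move=> [p [i [j [_ /arc_diamond]]]]; have [] := site_half p x.
by move: (`|_|) (`|_|) => r1 r2; lra.
Qed.

Lemma ray_unbounded (V : set (R * R)) z i :
  (forall r : R, 0 <= r -> V (z + r *: direction R i)) ->
  ~ bounded_set (connected_component V z).
Proof.
move=> Vr [M [_ /(_ (M + 1))]]; rewrite ltrDl => /(_ ltr01) bd.
pose f (r : R) := z + r *: direction R i.
have cr : connected (f @` [set r | 0 <= r])%classic.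
  apply: connected_continuous_connected.
    apply/connected_intervalP => a b /= a0 _ c /andP[ac _]; exact: le_trans ac.
  apply: continuous_subspaceT => r; apply: cvgD; first exact: cvg_cst.
  by apply: cvgZr_tmp; exact: cvg_id.
have sub : (f @` [set r | 0 <= r] `<=` connected_component V z)%classic.
  apply: connected_component_max => //; first by exists 0; rewrite /= /f ?scale0r ?addr0.
  by move=> _ [r /= r0 <-]; exact: Vr.
have bf (r : R) : 0 <= r -> `|(f r).1| <= M + 1 /\ `|(f r).2| <= M + 1.
  move=> r0; have : `|f r| <= M + 1 by apply: bd; apply: sub; exists r.
  by rewrite prod_normE ge_max => /andP.
pose r : R := `|z.1| + `|z.2| + `|M + 1| + 1.
have r0 : 0 <= r by rewrite /r !addr_ge0.
have [] := bf r r0; rewrite /f.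
have -> : (z + r *: direction R i).1 = z.1 + r * (direction R i).1 by [].
have -> : (z + r *: direction R i).2 = z.2 + r * (direction R i).2 by [].
have := ler_norm (M + 1); have := ler_norm z.1; have := ler_norm (- z.1).
have := ler_norm z.2; have := ler_norm (- z.2); rewrite !normrN.
have := normr_ge0 z.1; have := normr_ge0 z.2; have := normr_ge0 (M + 1).
rewrite /r; move: (`|z.1|) (`|z.2|) (`|M + 1|) (z.1) (z.2) => n1 n2 n3 z1 z2.
by case: (i) => /=; rewrite !ler_norml => ? ? ? ? ? ? ? ? /andP[? ?] /andP[? ?]; lra.
Qed.

End Arcs.

(** * External contours as outer boundaries of clusters *)

Section Droplets.
Variable R : realType.
Variable A : {fset site}.
Implicit Types (p x y : site) (z w : R * R) (i j k : compass) (gamma : set bond).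

Lemma minus_corner p k : exists a b, minus_end A (dual_bond p k) = corner p a b /\
  match k with North => b = true | South => b = false | East => a = true | West => a = false end.
Proof.
case: p => p1 p2; rewrite /minus_end; case: k; case: ifP => _.
- by exists false, true.
- by exists true, true.
- by exists true, false.
- by exists true, true.
- by exists false, false.
- by exists true, false.
- by exists false, false.
- by exists false, true.
Qed.

Section Nested.
Variables gamma0 gamma : set bond.
Hypotheses (ig0 : is_contour (minus_config A) gamma0) (ig : is_contour (minus_config A) gamma).
Hypothesis apart : forall b, gamma0 b -> ~ gamma b.
Hypothesis colored : forall b, gamma0 b -> color A gamma (minus_end A b).

Let quarters p : (forall k, differ A (dual_bond p k)) ->
  (gamma0 (dual_bond p South) <-> gamma0 (dual_bond p East)) /\
  (gamma0 (dual_bond p North) <-> gamma0 (dual_bond p West)).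
Proof.
move=> /(contour_four ig0)[e1 e2]; split.
  by split=> /asboolP h; apply/asboolP; [rewrite -e1 | rewrite e1].
by split=> /asboolP h; apply/asboolP; [rewrite -e2 | rewrite e2].
Qed.

Let sub0 b : gamma0 b -> differ A b.
Proof. by move=> h; apply/disagreementE; exact: contour_sub h. Qed.
Let sub1 b : gamma b -> differ A b.
Proof. by move=> h; apply/disagreementE; exact: contour_sub h. Qed.

(* When both contours visit [p], each of them uses one of the two rounded pairs. *)
Let rounded_or_free p i j : joined gamma0 p i j ->
  (forall k, ~ gamma (dual_bond p k)) \/
  (((i = South /\ j = East) \/ (i = East /\ j = South)) /\
    [/\ gamma (dual_bond p North), gamma (dual_bond p West),
        ~ gamma (dual_bond p South) & ~ gamma (dual_bond p East)]) \/
  (((i = North /\ j = West) \/ (i = West /\ j = North)) /\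
    [/\ gamma (dual_bond p South), gamma (dual_bond p East),
        ~ gamma (dual_bond p North) & ~ gamma (dual_bond p West)]).
Proof.
move=> [ij gi gj _].
have [[k gk]|none] := pselect (exists k, gamma (dual_bond p k)); last first.
  by left=> k gk; apply: none; exists k.
right; have ev := contour_parity ig p.
have dN := @apart (dual_bond p North); have dS := @apart (dual_bond p South).
have dE := @apart (dual_bond p East); have dW := @apart (dual_bond p West).
have four : (gamma0 (dual_bond p North) \/ gamma (dual_bond p North)) ->
  (gamma0 (dual_bond p South) \/ gamma (dual_bond p South)) ->
  (gamma0 (dual_bond p East) \/ gamma (dual_bond p East)) ->
  (gamma0 (dual_bond p West) \/ gamma (dual_bond p West)) ->
  (gamma0 (dual_bond p South) <-> gamma0 (dual_bond p East)) /\
  (gamma0 (dual_bond p North) <-> gamma0 (dual_bond p West)).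
  by move=> hN hS hE hW; apply: quarters => -[]; [case: hN|case: hE|case: hS|case: hW];
    by [exact: sub0 | exact: sub1].
move: ij gi gj gk ev dN dS dE dW four.
case: asboolP => gN; case: asboolP => gE; case: asboolP => gS; case: asboolP => gW //=;
  case: i; case: j => //= ij gi gj gk _ dN dS dE dW four; try (by exfalso; tauto).
all: try (by case: (k) gk => gk; exfalso; tauto).
all: try (by left; split; [tauto | split]).
all: try (by right; split; [tauto | split]).
Qed.

(** In different squares the curves could meet only at the midpoint of a common bond. In one square
    they follow opposite rounded pairs, in opposite quadrants and away from the centre. *)
Lemma nested_off_curve z : curve gamma0 z -> ~ curve gamma z.
Proof.
move=> [p [i [j [jo az]]]] [p' [i' [j' [jo' az']]]].
have [e|ne] := eqVneq p p'; last first.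
  have sq := arc_in_square az; have sq' := arc_in_square az'.
  have /andP[x1 y1] := sq; have /andP[x2 y2] := sq'.
  have [_ [_ [_ _ _ fx]]] := shared_end x1 x2; have [_ [_ [_ _ _ fy]]] := shared_end y1 y2.
  have [b1 b2] : (`|rel_x p z| = 2^-1 \/ `|rel_y p z| = 2^-1) /\
      (`|rel_x p' z| = 2^-1 \/ `|rel_y p' z| = 2^-1).
    have [e1|n1] := eqVneq p.1 p'.1; last by have [] := fx (elimN eqP n1); split; left.
    have n2 : p.2 <> p'.2.
      by move=> e2; case/eqP: ne; case: (p) (p') e1 e2 => [? ?] [? ?] /= -> ->.
    by have [] := fy n2; split; right.
  have [_ gi gj _] := jo; have [_ gi' gj' _] := jo'.
  have [k [ek mk]] : exists k, gamma (dual_bond p k) /\ midpoint p k z.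
    by case: (arc_tip az' b2) => /midpoint_shared/(_ sq ne) [k [<- mk]] in gi' gj' *; exists k.
  by case: (arc_tip az b1) => m; have e := midpoint_inj m mk; subst; [case: (apart gi) | case: (apart gj)].
subst p'; have [_ gi' gj' _] := jo'; have [ij' _ _ _] := jo'.
have [a [b [a0 b0 ab [hx hy] _]]] := arc_data az.
have [c [d [c0 d0 cd [kx ky] _]]] := arc_data az'.
move: hx hy kx ky; move: (rel_x p z) (rel_y p z) => X Y.
case: (rounded_or_free jo) => [none|[[ie [gN gW gS gE]]|[ie [gS gE gN gW]]]].
- by case: (none i').
- by case: i' gi' ij' {jo' az'} => gi' ij' //; case: j' gj' ij' => gj' ij' //;
    case: ie => [] [-> ->] /=; lra.
- by case: i' gi' ij' {jo' az'} => gi' ij' //; case: j' gj' ij' => gj' ij' //;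
    case: ie => [] [-> ->] /=; lra.
Qed.

(** Each arc of [gamma0] lies in the zone, for [gamma], of a corner that is the minus end of one of
    its bonds; this corner is coloured by hypothesis. *)
Lemma nested_surrounded : surrounded R gamma0 gamma.
Proof.
move=> z cz; have nz := nested_off_curve cz; have [p [i [j [jo az]]]] := cz.
have [_ gi _ _] := jo; have ci := colored gi; have sq := arc_in_square az.
have [a [b [e ab]]] := minus_corner p i.
rewrite e in ci; apply: (zone_enclosed ig nz _ ci); rewrite /zone sq /=.
have [s [r [s0 r0 _ [hx hy] _]]] := arc_data az.
have vals (n so e' w' : bool) : `[< gamma (dual_bond p North) >] = n ->
    `[< gamma (dual_bond p South) >] = so -> `[< gamma (dual_bond p East) >] = e' ->
    `[< gamma (dual_bond p West) >] = w' ->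
    [/\ bond_v gamma p true = n, bond_v gamma p false = so, bond_h gamma p true = e' &
      bond_h gamma p false = w'] by [].
rewrite /region /uncut /cut /straight_v /straight_h /off_quad /quad.
case: (rounded_or_free jo) => [none|[[ie [gN gW gS gE]]|[ie [gS gE gN gW]]]].
- have [b1 b2 b3 b4] := vals _ _ _ _ (asboolF (none North)) (asboolF (none South))
    (asboolF (none East)) (asboolF (none West)).
  by case: (a); case: (b); rewrite /= ?b1 ?b2 ?b3 ?b4.
- have [b1 b2 b3 b4] := vals _ _ _ _ (asboolT gN) (asboolF gS) (asboolF gE) (asboolT gW).
  have xp : 0 <= rel_x p z by rewrite hx; case: ie => -[-> ->] /=; lra.
  by case: ie => -[ei ej]; subst i; rewrite /= in ab; subst; [case: a {e ci} | case: b {e ci}];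
    rewrite /= ?b1 ?b2 ?b3 ?b4 /= ?xp.
- have [b1 b2 b3 b4] := vals _ _ _ _ (asboolF gN) (asboolT gS) (asboolT gE) (asboolF gW).
  have xm : rel_x p z <= 0 by rewrite hx; case: ie => -[-> ->] /=; lra.
  by case: ie => -[ei ej]; subst i; rewrite /= in ab; subst; [case: a {e ci} | case: b {e ci}];
    rewrite /= ?b1 ?b2 ?b3 ?b4 /= ?xm.
Qed.

End Nested.

Lemma site_enclosed gamma x : is_contour (minus_config A) gamma -> color A gamma x ->
  enclosed gamma (site_point R x).
Proof.
move=> ig cx; have nz := @site_off_curve R gamma x.
have rx : rel_x x (site_point R x) = - 2^-1 by rewrite /rel_x /=; ring.
have ry : rel_y x (site_point R x) = - 2^-1 by rewrite /rel_y /=; ring.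
apply: (zone_enclosed ig nz (p := x) (i := false) (j := false)); last by rewrite /corner -surjective_pairing.
have half0 : 0 <= 2^-1 :> R by [].
apply: (zone_edge ig); rewrite /in_square /sign ?rx ?ry ?normrN ?(ger0_norm half0) ?oppr_le0 ?lexx //.
by left.
Qed.

(** From a point outside the square that contains the curve, an axis-parallel ray escapes to
    infinity without meeting the curve. *)
Lemma enclosed_near gamma x (M : R) :
  (forall z, curve gamma z -> `|z.1 - x.1%:~R| <= M /\ `|z.2 - x.2%:~R| <= M) ->
  forall z, enclosed gamma z -> `|z.1 - x.1%:~R| <= M /\ `|z.2 - x.2%:~R| <= M.
Proof.
move=> near z [_ bd].
have ray i (P : R * R -> Prop) : (forall w, P w -> ~ curve gamma w) ->
    (forall r : R, 0 <= r -> P (z + r *: direction R i)) -> False.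
  by move=> off Pr; apply: (@ray_unbounded R (~` curve gamma)%classic z i) bd => r r0; apply: off; exact: Pr.
have fstE i (r : R) : (z + r *: direction R i).1 = z.1 + r * (direction R i).1 by [].
have sndE i (r : R) : (z + r *: direction R i).2 = z.2 + r * (direction R i).2 by [].
split; rewrite leNgt; apply/negP; rewrite ltr_normr => /orP[] h.
- apply: (ray East (fun w => M < w.1 - x.1%:~R)) => [w hw cw|r r0].
    by have [+ _] := near w cw; rewrite leNgt ltr_normr hw.
  by rewrite fstE /=; lra.
- apply: (ray West (fun w => M < - (w.1 - x.1%:~R))) => [w hw cw|r r0].
    by have [+ _] := near w cw; rewrite leNgt ltr_normr hw orbT.
  by rewrite fstE /=; lra.
- apply: (ray North (fun w => M < w.2 - x.2%:~R)) => [w hw cw|r r0].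
    by have [_ +] := near w cw; rewrite leNgt ltr_normr hw.
  by rewrite sndE /=; lra.
- apply: (ray South (fun w => M < - (w.2 - x.2%:~R))) => [w hw cw|r r0].
    by have [_ +] := near w cw; rewrite leNgt ltr_normr hw orbT.
  by rewrite sndE /=; lra.
Qed.

Lemma contour_near gamma x (n : nat) : is_contour (minus_config A) gamma ->
  (forall b, gamma b -> linked A x (minus_end A b)) ->
  (forall y, linked A x y -> `|y.1 - x.1| <= n%:Z /\ `|y.2 - x.2| <= n%:Z) ->
  forall z, curve gamma z -> `|z.1 - x.1%:~R| <= n.+1%:R /\ `|z.2 - x.2%:~R| <= n.+1%:R.
Proof.
move=> ig lk near z [p [i [j [[_ gi _ _] az]]]].
have [a [b [e _]]] := minus_corner p i.
have [h1 h2] := near _ (lk _ gi); rewrite e in h1 h2.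
have aux (c d : int) (r : R) : `|c - d| <= n%:Z -> `|r - c%:~R| <= 1 -> `|r - d%:~R| <= n.+1%:R.
  rewrite -(ler_int R) intr_norm intrB -natr1 => h1' h2'.
  rewrite -(subrKA c%:~R) addrC.
  by apply: le_trans (ler_normD _ _) _; rewrite lerD.
have [c1 c2] := square_near_corner a b (arc_in_square az).
by split; [exact: aux h1 c1 | exact: aux h2 c2].
Qed.

Lemma extent x : x \in A -> exists n, spans x n A.
Proof.
move=> xA; pose C := [fset y in A | `[< linked A x y >]].
have CE y : linked A x y -> y \in C.
  move=> lxy; rewrite in_fsetsep; apply/andP; split; last exact/asboolP.
  by have [] := connected_sym lxy.
have xC : x \in C by apply: CE; exact: connected_refl.
have [y yC ymin] := fset_argmin (fun y : site => - (Num.max `|y.1 - x.1| `|y.2 - x.2|)) xC.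
move: (yC); rewrite in_fsetsep => /andP[yA /asboolP lxy].
exists (absz (Num.max `|y.1 - x.1| `|y.2 - x.2|)); split.
  move=> w /CE/ymin; move: x w y {xA C CE xC yC ymin yA lxy} => [? ?] [? ?] [? ?] /=; clear; lia.
exists y; split=> //; apply/orP.
by move: x y {xA C CE xC yC ymin yA lxy} => [? ?] [? ?] /=; clear; lia.
Qed.

(** The contour given by [leftmost_contour] would surround [gamma] if it were another one; by
    externality it is [gamma], which thus encloses its whole cluster. The 3 bounds sqrt 8, from the
    diagonal of a square of half-side [n.+1]. *)
Lemma external_droplet gamma (s D : R) : external_contour R (minus_config A) gamma ->
  s <= diam R gamma <= D ->
  exists x n, [/\ spans x n A, s <= 3 * n.+1%:R & n%:R <= D].
Proof.
move=> [ig ext] /andP[sd dD]; have [b db gE] := ig.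
have gb : gamma b by rewrite gE /=; exact: rt_refl.
have ends b' : gamma b' -> linked A (minus_end A b) (minus_end A b').
  exact: contour_connected ig gb.
set x := minus_end A b in ends.
have xA : x \in A by have [] := ends _ gb.
have [gamma' ig' cx] := leftmost_contour xA.
have cg : color A gamma x.
  have [<- //|ne] := pselect (gamma' = gamma); exfalso.
  apply: (ext gamma' ig' ne); apply: nested_surrounded => //.
    by move=> c h h'; apply: ne; exact: contour_eq ig' ig h' h.
  by move=> c /ends /(color_connected ig') <-.
have [n sp] := extent xA; have [near [y [lxy far]]] := sp.
have close := enclosed_near (contour_near ig ends near).
pose S := [set d | exists z w, [/\ enclosed gamma z, enclosed gamma w & d = euclidean_dist z w]]%classic.
have ub d : S d -> d <= 3 * n.+1%:R.
  move=> [z [w [/close[z1 z2] /close[w1 w2] ->]]].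
  have pos : 0 <= 3 * n.+1%:R :> R by rewrite mulr_ge0.
  rewrite -(ger0_norm pos) -sqrtr_sqr ler_wsqrtr //.
  have aux (r r' c : R) : `|r - c| <= n.+1%:R -> `|r' - c| <= n.+1%:R ->
      (r - r') ^+ 2 <= (2 * n.+1%:R) ^+ 2.
    move=> h h'; rewrite -[leLHS]real_normK ?num_real // lerXn2r ?nnegrE ?mulr_ge0 //.
    rewrite -(subrKA c); apply: le_trans (ler_normD _ _) _.
    by rewrite (distrC c) mulr2n mulrDl !mul1r lerD.
  apply: le_trans (lerD (aux _ _ _ z1 w1) (aux _ _ _ z2 w2)) _.
  by move: (n.+1%:R : R) => m; nra.
have hub : has_ubound S by exists (3 * n.+1%:R) => d; exact: ub.
exists x, n; split=> //.
  apply: le_trans sd _; have [S0|S0] := pselect (S !=set0)%classic.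
    by apply: sup_le_ub => // d; exact: ub.
  (* The supremum of an empty set is 0 by convention. *)
  rewrite /diam -/S (_ : S = set0) ?sup0 ?mulr_ge0 //.
  by apply/seteqP; split => // d Sd; case: S0; exists d.
apply: le_trans dD; apply: le_trans (_ : euclidean_dist (site_point R y) (site_point R x) <= _).
  rewrite /euclidean_dist /= -!intrB.
  have aux (c e : int) : n%:Z <= `|c| -> n%:R <= Num.sqrt (c%:~R ^+ 2 + e%:~R ^+ 2) :> R.
    move=> nc; apply: le_trans (_ : `|c%:~R| <= _).
      by rewrite -intr_norm -[n%:R]/(n%:Z%:~R) ler_int.
    by rewrite -sqrtr_sqr ler_wsqrtr // lerDl sqr_ge0.
  by case: far => /aux h; [exact: h | rewrite addrC; exact: h].
apply: ub_le_sup => //; exists (site_point R y), (site_point R x); split=> //.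
  by apply: site_enclosed => //; rewrite -(color_connected ig lxy).
exact: site_enclosed.
Qed.

End Droplets.

(** * Gibbs measures *)

Section Link.
Variables (R : realType) (beta : R).
Let t : R := expR (- (2 * beta)).

Section Volume.
Variable D : {fset site}.
Implicit Types (sigma : {ffun D -> bool}).

Definition minus_set sigma : {fset site} := [fset x in D | ~~ plus_ext sigma x].

Lemma plus_extE sigma : plus_ext sigma = minus_config (minus_set sigma).
Proof.
apply/funext => x; rewrite /minus_config in_fsetsep negb_and negbK.
by case xD: (x \in D) => //=; rewrite /plus_ext insubN // xD.
Qed.

Lemma plus_ext_val sigma (x : D) : plus_ext sigma (val x) = sigma x.
Proof. by rewrite /plus_ext valK. Qed.

Lemma minus_set_inj : injective minus_set.
Proof.
move=> s1 s2 e; apply/ffunP => x; rewrite -!plus_ext_val !plus_extE.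
by rewrite e.
Qed.

Lemma sum_configs (G : {fset site} -> R) : \sum_sigma G (minus_set sigma) = psum D G.
Proof.
rewrite /psum -(big_map minus_set xpredT G); apply: perm_big; apply: uniq_perm.
- by rewrite map_inj_uniq ?index_enum_uniq //; exact: minus_set_inj.
- exact: fset_uniq.
move=> A; rewrite fpowersetE; apply/mapP/idP => [[sigma _ ->]|AD].
  by apply/fsubsetP => x; rewrite in_fsetsep => /andP[].
exists [ffun x : D => val x \notin A]; first by rewrite mem_index_enum.
apply/fsetP => x; rewrite in_fsetsep; case xD: (x \in D) => /=.
  rewrite -[x]/(val (FSetSub xD)) plus_ext_val ffunE negbK //.
by apply/negbTE/negP => /(fsubsetP AD); rewrite xD.
Qed.

Lemma weightE sigma : weight beta sigma =
  expR (beta * #|` touching D|%:R) * wt t (minus_set sigma).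
Proof.
set A := minus_set sigma.
have AD : A `<=` D by apply/fsubsetP => x; rewrite in_fsetsep => /andP[].
rewrite /weight /hamiltonian plus_extE -/A.
have -> : [set b | (bond_fst b \in D) || (bond_snd b \in D)]%classic = [set` touching D].
  by apply/seteqP; split => b /=; rewrite touchingE.
rewrite fsbig_finite ?set_fsetK //=.
have spinE b : spin R (minus_config A (bond_fst b)) * spin R (minus_config A (bond_snd b)) =
    1 - 2 * (differ A b)%:R.
  by rewrite /minus_config /differ /spin; case: (_ \in A); case: (_ \in A) => /=; ring.
under eq_bigr do rewrite spinE.
rewrite sumrB -mulr_sumr -natr_sum.
rewrite (@wt_dis _ _ _ (touching D)) ?touchingS //.
rewrite big_const_seq count_predT iter_addr addr0 /t -expRM_natl -expRD.
by congr expR; rewrite -[\sum_(b <- _) _]/(dis (touching D) A); ring.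
Qed.

Let t01 : 0 < t. Proof. exact: expR_gt0. Qed.

Let c0 : 0 < expR (beta * #|` touching D|%:R). Proof. exact: expR_gt0. Qed.

Lemma sum_weight (G : {fset site} -> R) :
  \sum_sigma G (minus_set sigma) * weight beta sigma =
  expR (beta * #|` touching D|%:R) * psum D (fun A => G A * wt t A).
Proof.
rewrite -psumZ -sum_configs; apply: eq_bigr => sigma _.
by rewrite weightE; ring.
Qed.

Lemma partition_functionE :
  partition_function beta D = expR (beta * #|` touching D|%:R) * Z t D.
Proof.
rewrite /partition_function /Z; have := sum_weight (fun=> 1).
under eq_bigr do rewrite mul1r.
by move=> ->; congr (_ * _); apply: eq_psum => A _; rewrite mul1r.
Qed.

Lemma gibbs_meanE (G : {fset site} -> R) :
  gibbs_mean beta (fun sigma => G (minus_set sigma)) = avg t D G.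
Proof.
rewrite /gibbs_mean sum_weight partition_functionE /avg invfM mulrACA.
by rewrite mulfV ?mul1r // lt0r_neq0.
Qed.

Lemma gibbsE (B : set {ffun D -> bool}) (f : pred {fset site}) :
  (forall sigma, B sigma <-> f (minus_set sigma)) ->
  gibbs beta B = avg t D (fun A => (f A)%:R).
Proof.
move=> Bf; rewrite -gibbs_meanE /gibbs /gibbs_mean; congr (_ / _).
rewrite big_mkcond; apply: eq_bigr => sigma _.
have -> : (sigma \in B) = f (minus_set sigma).
  by apply/idP/idP; [rewrite inE => /Bf | move=> /Bf; rewrite inE].
by case: (f _); rewrite ?mul1r ?mul0r.
Qed.

Lemma gibbs_cond_le (E B : set {ffun D -> bool}) (e f : pred {fset site}) (c : R) :
  (forall sigma, B sigma <-> f (minus_set sigma)) ->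
  (forall sigma, E sigma -> e (minus_set sigma)) ->
  0 < psum D (fun A => (f A)%:R * wt t A) ->
  psum D (fun A => (e A)%:R * ((f A)%:R * wt t A)) <= c * psum D (fun A => (f A)%:R * wt t A) ->
  gibbs_cond beta E B <= c.
Proof.
move=> Bf Ee P0 h; rewrite /gibbs_cond (gibbsE Bf).
have w0 sigma : 0 <= weight beta sigma by exact: expR_ge0.
have pf0 : 0 < partition_function beta D.
  rewrite partition_functionE mulr_gt0 //; apply: psum_gt0 => A _.
  by rewrite exprn_gt0.
have Z0 : 0 < Z t D by move: pf0; rewrite partition_functionE pmulr_rgt0.
have a0 : 0 < avg t D (fun A => (f A)%:R) by rewrite divr_gt0.
rewrite ler_pdivrMr //; apply: le_trans (_ : avg t D (fun A => (e A && f A)%:R) <= _).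
  rewrite -gibbs_meanE /gibbs /gibbs_mean; apply: ler_wpM2r; first by rewrite invr_ge0 ltW.
  rewrite big_mkcond; apply: ler_sum => sigma _.
  case: ifP => [|_]; last by rewrite mulr_ge0.
  by rewrite inE => -[/Ee -> /Bf ->]; rewrite mul1r.
rewrite /avg mulrA; apply: ler_wpM2r; first by rewrite invr_ge0 ltW.
apply: le_trans h; rewrite le_eqVlt; apply/orP; left; apply/eqP; apply: eq_psum => A _.
by rewrite mulrA -natrM mulnb.
Qed.

Lemma magnetizationE sigma :
  magnetization R sigma = #|` D|%:R - 2 * #|` minus_set sigma|%:R.
Proof.
set A := minus_set sigma.
have AD : A `<=` D by apply/fsubsetP => x; rewrite in_fsetsep => /andP[].
have cA := card_indicator R AD.
have cD : #|` D|%:R = \sum_(x <- D) 1 :> R.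
  by rewrite big_const_seq count_predT iter_addr addr0.
rewrite cA cD mulr_sumr -sumrB big_seq_fsetE; apply: eq_bigr => x _ /=.
rewrite -plus_ext_val plus_extE -/A /minus_config /spin.
by case: (_ \in A) => /=; ring.
Qed.

End Volume.

Lemma magnetization_at_origin L :
  gibbs_mean beta (fun sigma : {ffun box L -> bool} => spin R (plus_ext sigma (0, 0))) =
  1 - 2 * density t L.
Proof.
have rho1 : True by [].
transitivity (avg t (box L) (fun A => 1 - 2 * ((0, 0) \in A)%:R)).
  rewrite -gibbs_meanE; congr (gibbs_mean _ _); apply/funext => sigma.
  by rewrite plus_extE /minus_config /spin; case: (_ \in _) => /=; ring.
have t01 : 0 < t by exact: expR_gt0.
have Z0 : 0 < Z t (box L) by apply: psum_gt0 => A _; rewrite exprn_gt0.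
rewrite /density /dens /avg.
have -> : psum (box L) (fun A => (1 - 2 * ((0, 0) \in A)%:R) * wt t A) =
    Z t (box L) + (-2) * psum (box L) (fun A => ((0, 0) \in A)%:R * wt t A).
  by rewrite /Z -psumZ -psumD; apply: eq_psum => A _; ring.
by rewrite mulrDl mulfV ?lt0r_neq0 // mulNr mulNr mulrA.
Qed.

Lemma origin_spin_continuous : continuous (fun omega : spins => spin R (omega (0, 0))).
Proof.
move=> omega; apply: (continuous_comp (f := fun omega : spins => omega (0, 0)) (g := spin R)).
  exact: (@proj_continuous _ (fun _ : site => bool) (0, 0)).
by move=> B /nbhs_singleton Bb; apply: filterS (discrete_set1 _) => b ->.
Qed.

(** The spin at the origin is a continuous observable with mean [1 - 2 * density t L] in the box.
    These means lie in [-1, 1], so the limit is finite and [fine] loses nothing. *)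
Lemma density_cvg (mu : probability spinsB R) : plus_state beta mu ->
  density t n @[n --> \oo] --> (1 - m_star mu) / 2 /\ `|m_star mu| <= 1.
Proof.
move=> /(_ _ origin_spin_continuous); set E := expectation _ _ => h.
have {}h : (1 - 2 * density t L)%:E @[L --> \oo] --> E.
  apply: cvg_trans h; apply: near_eq_cvg; near=> L.
  by rewrite magnetization_at_origin.
have t0 : 0 < t by exact: expR_gt0.
have d01 L : 0 <= density t L <= 1.
  have Z0 : 0 < Z t (box L) by apply: psum_gt0 => A _; rewrite exprn_gt0.
  apply/andP; split.
    by rewrite divr_ge0 ?(ltW Z0) // psum_ge0 // => A _; rewrite mulr_ge0 // exprn_ge0 // ltW.
  rewrite ler_pdivrMr // mul1r; apply: ler_psum => A _.
  by rewrite ler_piMl // ?exprn_ge0 ?(ltW t0) // lern1 leq_b1.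
have cE : cvgn (fun L => (1 - 2 * density t L)%:E) by apply/cvg_ex; exists E.
have limE := cvg_lim (@ereal_hausdorff R) h.
have E1 : (E <= 1%:E)%E.
  rewrite -limE; apply: lime_le => //; near=> L; rewrite lee_fin.
  by have /andP[] := d01 L; move: (density t L) => d; lra.
have E2 : ((-1)%:E <= E)%E.
  rewrite -limE; apply: lime_ge => //; near=> L; rewrite lee_fin.
  by have /andP[] := d01 L; move: (density t L) => d; lra.
have mE : m_star mu = fine E by [].
have Efin : E \is a fin_num.
  by rewrite fin_numE; apply/andP; split; apply/eqP => e; move: E1 E2; rewrite e.
have EE : E = (m_star mu)%:E by rewrite mE fineK.
rewrite EE !lee_fin in E1 E2 h; split; last by rewrite ler_norml E1 E2.
have /fine_cvgP[_ h'] := h.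
have -> : density t = fun L => (1 - (1 - 2 * density t L)) / 2.
  by apply/funext => L; field.
by apply: cvgMl; apply: cvgB; [exact: cvg_cst | exact: h'].
Unshelve. all: by end_near.
Qed.

Lemma subcritical : beta_c R < beta -> t * (1 + Num.sqrt 2) < 1.
Proof.
have s0 : 0 < 1 + Num.sqrt 2 :> R by rewrite ltr_wpDr // sqrtr_ge0.
rewrite /beta_c /t ltr_pdivrMr // => h.
rewrite expRN mulrC ltr_pdivrMr ?expR_gt0 // mul1r -[ltLHS]lnK ?posrE // ltr_expR.
by rewrite mulrC.
Qed.

End Link.

(** * From the sequence v to the scaling regime *)

Lemma three_halves (R : realType) (v : R) : 0 < v -> v `^ (3 / 2) = Num.sqrt v ^+ 3.
Proof.
move=> v0; have -> : 3 / 2 = 2^-1 * 3%:R :> R by rewrite mulrC.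
by rewrite powRrM powR_mulrn ?powR_ge0 // powR12_sqrt // ltW.
Qed.

(** The ratio [w / a] lies between l / 2 and 3 l / 2; the constant bounds both this ratio and its
    inverse. *)
Lemma regime_of_ratio (R : realFieldType) (l w a : R) : 0 < l -> 0 < a -> `|l - w / a| < l / 2 ->
  a <= (2 * l + 2 / l) * w /\ w <= (2 * l + 2 / l) * a.
Proof.
move=> l0 a0; rewrite ltr_distlC => /andP[].
rewrite -ltrBlDr => h1 h2.
have {}h1 : l / 2 * a < w by rewrite -ltr_pdivlMr //; lra.
have {}h2 : w < 2 * l * a by rewrite -ltr_pdivrMr //; lra.
have li : 0 < 2 / l by rewrite divr_gt0.
have w0 : 0 < w by apply: lt_trans h1; rewrite mulr_gt0 // divr_gt0.
split; rewrite mulrDl.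
  have e : a = 2 / l * (l / 2 * a) by field; exact: lt0r_neq0.
  have : 2 / l * (l / 2 * a) <= 2 / l * w by rewrite ler_pM2l // ltW.
  have : 0 <= 2 * l * w by rewrite mulr_ge0 ?mulr_ge0 // ltW.
  by rewrite -e; move: (2 * l * w) (2 / l * w) => x y *; lra.
have : 0 <= 2 / l * a by rewrite mulr_ge0 // ltW.
by move: (2 * l * a) (2 / l * a) h2 => x y *; lra.
Qed.

Local Open Scope classical_set_scope.
Local Open Scope ring_scope.

Theorem theorem4p1 (R : realType) (beta : R) (mu : probability spinsB R)
    (v : nat -> R) (l : R) :
  beta_c R < beta ->
  plus_state beta mu ->
  (forall L : nat, (0 < L)%N -> 0 < v L) ->
  (forall L : nat, (0 < L)%N -> exists sigma : {ffun box L -> bool},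
     magnetization R sigma
       = m_star mu * #|` box L|%:R - 2 * m_star mu * v L) ->
  0 < l ->
  (v L `^ (3 / 2) / #|` box L|%:R) @[L --> \oo] --> l ->
  forall c0 : R, 0 < c0 ->
  exists (kappa K0 : R) (L0 : nat), 0 < kappa /\
    forall (K : R) (L : nat), K0 <= K -> (L0 <= L)%N ->
      gibbs_cond beta
        (@intermediate R kappa (K * ln L%:R) (v L) L)
        [set sigma : {ffun box L -> bool} |
           magnetization R sigma
             = m_star mu * #|` box L|%:R - 2 * m_star mu * v L]
      <= L%:R `^ (- c0).
Proof.
move=> bc ps v0 allowed l0 vl c0 c00.
have t0 : 0 < expR (- (2 * beta)) by exact: expR_gt0.
have rho1 := subcritical bc.
have [thetaE m1] := density_cvg ps.
have cp : 0 < 2 * l + 2 / l by rewrite addr_gt0 ?divr_gt0 ?mulr_gt0.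
have [kappa [K0 [L0 [kap0 H]]]] := droplets_rare t0 rho1 thetaE cp c00.
have [L1 _ HL1] : \forall L \near \oo, `|l - v L `^ (3 / 2) / #|` box L|%:R| < l / 2.
  by move/cvgrPdist_lt: vl; apply; rewrite divr_gt0.
exists kappa, K0, (maxn 1 (maxn L0 L1)); split=> // K L KK.
rewrite !geq_max => /and3P[L1' LL0 LL1].
have vL := v0 L L1'; have [sigma0 M0] := allowed L L1'.
pose u := Num.sqrt (v L); have u0 : 0 <= u by exact: sqrtr_ge0.
have u2 : u ^+ 2 = v L by rewrite sqr_sqrtr // ltW.
have L2 : #|` box L|%:R = L%:R ^+ 2 :> R by rewrite card_box natrM expr2.
have L20 : 0 < L%:R ^+ 2 :> R by rewrite exprn_gt0 // ltr0n.
have reg : regime (2 * l + 2 / l) L u.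
  by apply: regime_of_ratio => //; have := HL1 L LL1; rewrite /= L2 three_halves.
pose N := #|` minus_set sigma0|%N.
have NE : L%:R ^+ 2 - 2 * N%:R = m_star mu * L%:R ^+ 2 - 2 * m_star mu * v L.
  by rewrite -L2 -M0 magnetizationE.
(* The number of minus sites imposed by the conditioning exceeds its bulk value by
   [m_star mu * v L], and [m_star mu] is at most 1 in absolute value. *)
have dev : `|N%:R - (1 - m_star mu) / 2 * L%:R ^+ 2| <= u ^+ 2.
  have -> : N%:R - (1 - m_star mu) / 2 * L%:R ^+ 2 = m_star mu * v L.
    by move: NE; move: (m_star mu) (N%:R : R) (L%:R ^+ 2 : R) (v L) => m x y z; lra.
  by rewrite u2 normrM (gtr0_norm vL) ler_piMl // ltW.
have [P0 rare] := H L N u K LL0 KK u0 reg dev.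
apply: gibbs_cond_le P0 rare => sigma /=.
  rewrite magnetizationE -M0 magnetizationE; split=> [e|/eqP ->//].
  rewrite -(eqr_nat R) -/N; apply/eqP; move: e; rewrite -/N.
  by move: (#|` box L|%:R : R) (N%:R : R) (#|` minus_set sigma|%:R : R) => x y z; lra.
move=> [gamma ext dm]; apply/asboolP; rewrite plus_extE in ext.
have [x [n [sp sn nD]]] := external_droplet ext dm.
by exists x, n; split=> //; rewrite sn.
Qed.
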